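(* Let $\alpha \geq \beta > -1$ and $\delta>0$ be real numbers and let $d \in \mathbb{N}$. There exists a radial extremizer for $(\mathbb{EP}1)(\alpha, \beta\,; d\,; \delta)$.
   Context: For $z = (z_1,\ldots,z_d) \in \mathbb{C}^d$ let $\|z\| := \sup \{ |\sum_{n=1}^d z_n t_n| : t \in \mathbb{R}^d, |t|\leq 1\}$, where $|t|$ is the Euclidean norm. An entire function $F: \mathbb{C}^d \to \mathbb{C}$, not identically zero, has exponential type if $\tau(F):= \limsup_{\|z\|\to \infty} \|z\|^{-1}\log|F(z)| < \infty$, and $\tau(F)$ is then called its exponential type. For $\alpha>-1$ and $\delta>0$, $\mathcal{H}_{\alpha}(d; \delta)$ is the Hilbert space of entire functions $F:\mathbb{C}^d\to\mathbb{C}$ of exponential type at most $\delta$ (together with the zero function) such that $\int_{\mathbb{R}^d} |F(x)|^2 |x|^{2\alpha + 2 -d}\,dx <\infty$. For $\alpha \geq \beta > -1$ one has $\mathcal{H}_{\alpha}(d;\delta)\subset \mathcal{H}_{\beta}(d;\delta)$, and one defines $$(\mathbb{EP}1)(\alpha, \beta\,; d\,; \delta):= \inf_{ 0 \neq F \in \mathcal{H}_{\alpha}(d; \delta) } \frac{\int_{\mathbb{R}^d} |F(x)|^2 \, |x|^{2\alpha + 2 -d}\,dx}{\int_{\mathbb{R}^d} |F(x)|^2 \, |x|^{2\beta + 2 -d}\,dx}.$$ A function $0 \neq F \in \mathcal{H}_{\alpha}(d; \delta)$ is an extremizer for $(\mathbb{EP}1)(\alpha, \beta\,; d\,; \delta)$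 if it attains this infimum. An entire function $F:\mathbb{C}^d\to\mathbb{C}$ is called radial if its restriction to $\mathbb{R}^d$ is radial. *)

(* Defs.v *)
From HB Require Import structures.
From mathcomp Require Import all_boot all_order all_algebra complex.
From mathcomp Require Import all_classical all_reals all_analysis.

Set Implicit Arguments.
Unset Strict Implicit.
Unset Printing Implicit Defensive.

Import Order.TTheory GRing.Theory Num.Theory.
Import numFieldNormedType.Exports.
Import ComplexField.Normc.

Local Open Scope classical_set_scope.
Local Open Scope ring_scope.
Local Open Scope complex_scope.

(* The library's sigma-finiteness instance for [m1 \x m2] is shadowed by the one
   for subprobabilities, so the fact is reproved here as a lemma. *)
Lemma sigma_finite_product (R : realType) (d1 d2 : measure_display)
    (T1 : measurableType d1) (T2 : measurableType d2)
    (m1 : {sigma_finite_measure set T1 -> \bar R})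
    (m2 : {sigma_finite_measure set T2 -> \bar R}) :
  sigma_finite setT (m1 \x m2)%E.
Proof.
have /sigma_finiteP[F [FT ndF Foo]] := sigma_finiteT m1.
have /sigma_finiteP[G [GT ndG Goo]] := sigma_finiteT m2.
exists (fun k => F k `*` G k).
  rewrite -setXTT FT GT predeqE => -[x y]; split.
    move=> [/= [k _ Fkx] [l _ Gly]]; exists (maxn k l) => //; split.
    - by move: x Fkx; exact/subsetPset/ndF/leq_maxl.
    - by move: y Gly; exact/subsetPset/ndG/leq_maxr.
  by move=> [k _ []/= ? ?]; split; exists k.
move=> k; have [? ?] := Foo k; have [? ?] := Goo k.
split; first exact: measurableX.
by rewrite product_measure1E// lte_mul_pinfty// ge0_fin_numE.
Qed.

Section power_measure.
Variables (R : realType) (disp : measure_display) (T : measurableType disp).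
Variable m : {sigma_finite_measure set T -> \bar R}.

Definition tuple_cons n (p : T * n.-tuple T) : n.+1.-tuple T :=
  [tuple of p.1 :: p.2].

Lemma measurable_tuple_cons n : measurable_fun setT (@tuple_cons n).
Proof. exact: measurable_cons. Qed.

Section cons_measure.
Variables (n : nat) (mu : {sigma_finite_measure set (n.-tuple T) -> \bar R}).
Local Open Scope ereal_scope.

Definition cons_measure : set (n.+1.-tuple T) -> \bar R :=
  pushforward (m \x mu) (@tuple_cons n).

Let nu : {measure set (n.+1.-tuple T) -> \bar R} :=
  measure_function_pushforward__canonical__measure_function_Measure
    (m \x mu) (@measurable_tuple_cons n).

HB.instance Definition _ := isMeasure.Build _ _ _ cons_measure
  (measure0 nu) (measure_ge0 nu) (@measure_semi_sigma_additive _ _ _ nu).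

Let cons_measure_sigma_finite : sigma_finite setT cons_measure.
Proof.
have [F FT Ffin] := sigma_finite_product m mu.
pose uncons (t : n.+1.-tuple T) := (thead t, [tuple of behead t]).
have consK : cancel (@tuple_cons n) uncons.
  by case=> x t; congr pair; apply/val_inj.
have munc : measurable_fun setT uncons.
  apply/measurable_fun_pairP; split.
    exact: (measurable_tnth ord0).
  exact: measurable_behead.
exists (fun i => uncons @^-1` (F i)).
  by rewrite -preimage_bigcup -FT preimage_setT.
move=> i; have [mFi Fi] := Ffin i; split.
  by rewrite -[X in measurable X]setTI; exact: munc.
rewrite /cons_measure /pushforward -comp_preimage.
by rewrite (_ : uncons \o _ = id)//; apply/funext => p; exact: consK.
Qed.

HB.instance Definition _ := Measure_isSigmaFinite.Build _ _ _ cons_measure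
  cons_measure_sigma_finite.

End cons_measure.

Fixpoint power_measure n : {sigma_finite_measure set (n.-tuple T) -> \bar R} :=
  match n with
  | 0 => dirac ([tuple] : 0.-tuple T)
  | n'.+1 => cons_measure (power_measure n')
  end.

(* On boxes, [power_measure n] is the n-fold product of [m]; this characterizes
   it since boxes generate the sigma-algebra of [n.-tuple T]. *)
Lemma power_measure_box n (A : 'I_n -> set T) :
  (forall i, measurable (A i)) ->
  power_measure n [set t | forall i, A i (tnth t i)] =
    (\prod_(i < n) m (A i))%E.
Proof.
elim: n A => [|n IHn] A mA.
  by rewrite big_ord0 /= diracE mem_set// => -[].
rewrite big_ord_recl -IHn; last by move=> i; exact: mA.
have mtail : measurable
    [set t : n.-tuple T | forall i, A (lift ord0 i) (tnth t i)].
  rewrite (_ : [set t | _] = \bigcap_(i in setT)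
      ((fun t : n.-tuple T => tnth t i) @^-1` A (lift ord0 i))).
    apply: fin_bigcap_measurable => // i _.
    by rewrite -[X in measurable X]setTI; exact: measurable_tnth.
  by apply/seteqP; split => [t H i _|t H i]; [exact: H|exact: (H i I)].
rewrite -(product_measure1E _ (power_measure n))//.
rewrite /= /cons_measure /pushforward; congr (_ _).
apply/seteqP; split=> [[x t] /= H|[x t] /= [Ax At] i].
  split; first exact: (H ord0).
  by move=> i; have := H (lift ord0 i); rewrite tnthS.
case: (unliftP ord0 i) => [j ->|->//].
by rewrite tnthS; exact: At.
Qed.

End power_measure.

Definition lebesgue_Rn (R : realType) (d : nat) :
    {sigma_finite_measure set (d.-tuple (measurableTypeR R)) -> \bar R} :=
  power_measure (@lebesgue_measure R) d.

Section extremal_problem.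
Variables (R : realType) (d : nat).
Implicit Types (x y t : d.-tuple R) (z : 'rV[R[i]]_d).
Implicit Types (F : 'rV[R[i]]_d -> R[i]) (a b delta : R).

Definition eucl_norm t : R := Num.sqrt (\sum_(i < d) tnth t i ^+ 2).

Definition cn_norm z : R :=
  sup [set normc (\sum_(i < d) z 0 i * (tnth t i)%:C)
      | t in [set t : d.-tuple R | eucl_norm t <= 1]].

Definition real_point x : 'rV[R[i]]_d := \row_i (tnth x i)%:C.

(* Differentiability over the scalar field R[i], i.e. complex differentiability
   in all d variables jointly. *)
Definition entire F :=
  forall p, differentiable (F : 'rV[R[i]]_d -> R[i]^o) p.

Definition cn_infty : set_system 'rV[R[i]]_d :=
  filter_from setT (fun M : R => [set z | M < cn_norm z]).

(* [lne 0 = -oo], so zeros of F do not contribute to the limit superior. *)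
Definition exp_type F : \bar R :=
  @limf_esup _ 'rV[R[i]^o]_d R
    (fun z => ((cn_norm z)^-1%R)%:E * lne (normc (F z))%:E)%E cn_infty.

(* The value of the weight at the origin, where [0 `^ r] is [(r == 0)%:R], is
   irrelevant for d >= 1. *)
Definition energy a F : \bar R :=
  (\int[lebesgue_Rn R d]_x
    (normc (F (real_point x)) ^+ 2 * eucl_norm x `^ (2 * a + 2 - d%:R))%:E)%E.

Definition in_H a delta F :=
  [/\ entire F, F = cst 0 \/ (exp_type F <= delta%:E)%E & (energy a F < +oo)%E].

Definition EP1 a b delta : \bar R :=
  ereal_inf [set (energy a F / energy b F)%E
            | F in [set F | in_H a delta F /\ F <> cst 0]].

Definition extremizer a b delta F :=
  [/\ in_H a delta F, F <> cst 0 & (energy a F / energy b F)%E = EP1 a b delta].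

Definition radial F :=
  forall x y, eucl_norm x = eucl_norm y -> F (real_point x) = F (real_point y).

End extremal_problem.

(* Main.v *)
(* A function F in H_alpha(d; delta) restricts on every real line through the
   origin to an entire function of one variable of exponential type at most
   delta, and polar coordinates express both energies of F as averages, with
   the same weight, of the one-dimensional energies of these slices with
   weights |x|^(2 alpha + 1) and |x|^(2 beta + 1).  So the infimum lambda of
   the one-dimensional problem bounds the quotient from below in every
   dimension.  If c is an even minimizer in dimension one, then
   z |-> c(sqrt(z_1^2 + ... + z_d^2)) is a radial function in H_alpha(d; delta)
   all of whose slices are c, hence an extremizer.

   In dimension one, f is the sum of its even part and of x times an even
   function k, and the two do not interact; the inequality for x k follows from
   the one for k since (x^(2p) - lambda) (x^2 - lambda^(1/p)) >= 0 with
   p = alpha - beta.  An even minimizer is obtained by compactness: for T > delta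
   the Taylor coefficients of f satisfy |f_n| n! <= K T^n with K depending only
   on a bound for the weighted norm.  This uniform bound comes from the Laplace
   transform \sum_n f_n n! s^(-n-1) of f, which is O(1 / |Re s|) by the
   Cauchy-Schwarz inequality: on the circle |s| = T one has
   |s^2 + T^2| = 2 T |Re s|, so (s^2 + T^2) times the transform is bounded there,
   and the Cauchy estimates apply. *)

(* In dimension one the exponential type enters through Taylor coefficients: [egrow delta c] says
   that [c n * n!] is O(T^n) for every T > delta. This form survives parity splitting,
   multiplication by x and, when the constants are uniform, coefficientwise limits. The obstacle is
   exactly that uniformity: a bound on the type gives every function its own constant, whereas
   compactness needs one depending on the weighted norm alone. The passage through the Laplace
   transform removes the individual constant, but its estimate with dual weight |x|^(-e) works only
   in a window: e < 1 gives integrability at 0 and -1 <= e controls the growth. Larger exponents are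
   brought into the window by multiplying the function by powers of x. Limits of minimizing
   sequences are taken along an ultrafilter, which treats all coefficients at once. Polar
   coordinates use no surface measure: dilations are averaged over the shell 1 < |y| < 2, which
   multiplies every energy by the same finite positive constant and so leaves quotients
   unchanged. *)
Require Import Defs.
From mathcomp Require Import all_boot all_order all_algebra complex.
From mathcomp Require Import all_classical all_reals all_analysis.
From mathcomp Require Import ring lra measurable_realfun.
Set Implicit Arguments.
Unset Strict Implicit.
Unset Printing Implicit Defensive.
Import Order.TTheory GRing.Theory Num.Theory.
Import numFieldNormedType.Exports.
Import ComplexField.Normc.
Local Open Scope classical_set_scope.
Local Open Scope ring_scope.
Local Open Scope complex_scope.
Local Notation Re := complex.Re.
Local Notation Im := complex.Im.

(** * Complex differentiability over R[i] *)

Section complex_norm.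
Variable R : realType.
Implicit Types (z w p l : R[i]).

Lemma normc_ge0 z : 0 <= normc z.
Proof. by case: z => a b; exact: sqrtr_ge0. Qed.

Lemma normE z : `|z| = (normc z)%:C.
Proof. by case: z. Qed.

Lemma normcR (x : R) : normc x%:C = `|x|.
Proof. by rewrite /normc /= expr0n addr0 sqrtr_sqr. Qed.

Lemma normcB z w : normc (z - w) = normc (w - z).
Proof. by rewrite -normcN opprB. Qed.

Lemma normcX z n : normc (z ^+ n) = normc z ^+ n.
Proof.
elim: n => [|n IH]; first by rewrite !expr0 (normc1 R).
by rewrite !exprS normcM IH.
Qed.

Lemma le_normcB z w : normc (z - w) <= normc z + normc w.
Proof. by rewrite -(normcN w); exact: le_normcD. Qed.

Lemma lerB_normc z w : normc z - normc w <= normc (z - w).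
Proof. by rewrite lerBlDr; apply: le_trans (le_normcD _ _); rewrite subrK. Qed.

Lemma le_Re_normc z : `|Re z| <= normc z.
Proof.
by case: z => a b /=; rewrite -sqrtr_sqr ler_sqrt ?lerDl ?sqr_ge0// addr_ge0// sqr_ge0.
Qed.

Lemma le_Im_normc z : `|Im z| <= normc z.
Proof.
by case: z => a b /=; rewrite -sqrtr_sqr ler_sqrt ?lerDr ?sqr_ge0// addr_ge0// sqr_ge0.
Qed.

Lemma normc_le_ReIm z : normc z <= `|Re z| + `|Im z|.
Proof.
case: z => a b /=; rewrite -(ler_pXn2r (ltn0Sn 1)) ?nnegrE ?sqrtr_ge0 ?addr_ge0//.
rewrite sqr_sqrtr ?addr_ge0 ?sqr_ge0// sqrrD !real_normK ?num_real//.
by rewrite addrAC lerDl mulrn_wge0// mulr_ge0.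
Qed.

Lemma normc_eq0 z : (normc z == 0) = (z == 0).
Proof. by apply/eqP/eqP => [/eq0_normc//|->]; rewrite (normc0 R). Qed.

Lemma normc_gt0 z : (0 < normc z) = (z != 0).
Proof. by rewrite lt_neqAle normc_ge0 andbT eq_sym normc_eq0. Qed.

(** The derivative is stated as a linear approximation with real tolerances: no division by [h]
    occurs, so [h = 0] needs no exclusion, and remainders compose directly in the chain rule and in
    Goursat's argument. *)
Definition cderiv (f : R[i] -> R[i]) p l :=
  forall e : R, 0 < e -> exists2 r : R, 0 < r &
    forall h, normc h < r -> normc (f (p + h) - f p - l * h) <= e * normc h.

Lemma cderivP (f : R[i] -> R[i]) p l :
  cderiv f p l <-> is_derive (p : R[i]^o) 1 (f : R[i]^o -> R[i]^o) l.
Proof.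
split.
  move=> fl.
  have cvl : (fun h : R[i]^o => h^-1 *: ((f : R[i]^o -> R[i]^o) (h *: 1 + p) - f p))
      @ 0^' --> (l : R[i]^o).
    apply/cvgrPdist_le => e e0.
    (* In the partial order of [R[i]], positivity includes the vanishing of the imaginary part, so a
       complex tolerance is a real one. *)
    have [e' ee' e'0] : exists2 e' : R, e = e'%:C & 0 < e'.
      by case: e e0 => a b; rewrite ltcE /= => /andP[/eqP -> a0]; exists a.
    have [r r0 H] := fl _ e'0.
    near=> h.
    have h0 : h != 0 by near: h; exact: nbhs_dnbhs_neq.
    have hr : normc h < r.
      have : `|h| < r%:C :> R[i].
        near: h; apply: dnbhs0_lt; by rewrite ltcR.
      by rewrite normE ltcR.
    have -> : l - h^-1 *: ((f : R[i]^o -> R[i]^o) (h *: 1 + p) - f p) =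
       - (h^-1 * (f (p + h) - f p - l * h)).
      have E : forall a b : R[i], l - h^-1 * (a - b) = - (h^-1 * (a - b - l * h)).
        by move=> a b; field.
      by rewrite -E (addrC p h) /GRing.scale /= mulr1.
    rewrite normrN ee' normE lecR normcM normcV ler_pdivrMl ?normc_gt0//.
    by rewrite [leRHS]mulrC; exact: H.
  split; first by apply/cvg_ex; exists l.
  exact/cvg_lim.
move=> [] /cvg_ex[l' H] <- e e0.
rewrite /derive.
have : (fun h : R[i]^o => h^-1 *: ((f : R[i]^o -> R[i]^o) (h *: 1 + p) - f p))
      @ 0^' --> (l' : R[i]^o) by [].
move=> cvl; rewrite (cvg_lim _ cvl)//.
move/cvgrPdist_le : cvl => /(_ e%:C); rewrite ltcR => /(_ e0).
rewrite /dnbhs near_withinE /= => /nbhs_ballP[r /= r0 Hr].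
have [r' rr' r'0] : exists2 r' : R, r = r'%:C & 0 < r'.
  by case: r r0 {Hr} => a b; rewrite ltcE /= => /andP[/eqP -> a0]; exists a.
exists r' => // h hr.
have [->|h0] := eqVneq h 0.
  by rewrite addr0 subrr mulr0 subrr (normc0 R) mulr0.
have := Hr h; rewrite /ball /= sub0r normrN normE rr' ltcR => /(_ hr h0).
rewrite /GRing.scale /= mulr1 normE lecR => /(ler_wpM2r (normc_ge0 h)).
apply: le_trans; rewrite -normcM -normcN.
rewrite mulrBl mulrAC mulVf// mul1r opprB (addrC p h).
by [].
Unshelve. all: by end_near.
Qed.

Lemma cderiv_cont f p l : cderiv f p l -> forall e : R, 0 < e -> exists2 r : R, 0 < r &
    forall h, normc h < r -> normc (f (p + h) - f p) <= e.
Proof.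
move=> fl e e0; have [r r0 H] := fl 1 ltr01.
have n0 : 0 < 1 + normc l by rewrite ltr_wpDr ?normc_ge0.
exists (Num.min r (e / (1 + normc l))).
  by rewrite lt_min r0 divr_gt0.
move=> h; rewrite lt_min => /andP[hr he].
rewrite -[_ - _](subrK (l * h)).
apply: le_trans (le_normcD _ _) _.
apply: le_trans (lerD (H _ hr) (lexx _)) _.
rewrite normcM -mulrDl mulrC -ler_pdivlMr//; exact: ltW.
Qed.

Lemma cderiv_cst (a : R[i]) p : cderiv (fun=> a) p 0.
Proof.
move=> e e0; exists 1 => // h _.
by rewrite subrr mul0r subrr (normc0 R) mulr_ge0 ?normc_ge0 ?ltW.
Qed.

Lemma cderiv_id p : cderiv id p 1.
Proof.
move=> e e0; exists 1 => // h _.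
rewrite (_ : _ - _ = 0); last by rewrite /=; ring.
by rewrite (normc0 R) mulr_ge0 ?normc_ge0 ?ltW.
Qed.

Lemma cderivD f g p l k : cderiv f p l -> cderiv g p k ->
  cderiv (fun z => f z + g z) p (l + k).
Proof. by move=> /cderivP ? /cderivP ?; apply/cderivP; exact: is_deriveD. Qed.

Lemma cderivB f g p l k : cderiv f p l -> cderiv g p k ->
  cderiv (fun z => f z - g z) p (l - k).
Proof. by move=> /cderivP ? /cderivP ?; apply/cderivP; exact: is_deriveB. Qed.

Lemma cderivM f g p l k : cderiv f p l -> cderiv g p k ->
  cderiv (fun z => f z * g z) p (f p * k + g p * l).
Proof. by move=> /cderivP ? /cderivP ?; apply/cderivP; exact: is_deriveM. Qed.

Lemma cderivV f p l : f p != 0 -> cderiv f p l ->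
  cderiv (fun z => (f z)^-1) p (- (f p) ^- 2 * l).
Proof.
move=> fp0 /cderivP [df dfE]; apply/cderivP; split; first exact: derivableV.
by rewrite deriveV// dfE.
Qed.

Lemma cderiv_comp f g p l k : cderiv g p k -> cderiv f (g p) l ->
  cderiv (f \o g) p (l * k).
Proof.
move=> gk fl e e0.
pose M := 1 + normc k.
have M0 : 0 < M by rewrite ltr_wpDr ?normc_ge0.
(* The bound by 1 keeps the increment of [g] below [(1 + normc k) * normc h]; the other bound pays
   for the factor [l]. *)
pose e1 := Num.min 1 (e / 2 / (1 + normc l)).
have l0 : 0 < 1 + normc l by rewrite ltr_wpDr ?normc_ge0.
have e10 : 0 < e1 by rewrite lt_min ltr01 !divr_gt0.
pose e2 := e / 2 / M.
have e20 : 0 < e2 by rewrite !divr_gt0.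
have [r1 r10 H1] := gk _ e10.
have [r2 r20 H2] := fl _ e20.
exists (Num.min r1 (r2 / M)); first by rewrite lt_min r10 divr_gt0.
move=> h; rewrite lt_min => /andP[h1 h2].
pose u := g (p + h) - g p.
have uE : normc (u - k * h) <= e1 * normc h by exact: H1.
have uM : normc u <= M * normc h.
  rewrite -[u](subrK (k * h)); apply: le_trans (le_normcD _ _) _.
  rewrite normcM /M mulrDl lerD2r mul1r; apply: le_trans uE _.
  by rewrite ler_piMl ?normc_ge0// ge_min lexx.
have ur : normc u < r2.
  by apply: le_lt_trans uM _; rewrite mulrC -ltr_pdivlMr.
have := H2 _ ur; rewrite /u subrKC -/u => H3.
have -> : (f \o g) (p + h) - (f \o g) p - l * k * h =
   (f (g (p + h)) - f (g p) - l * u) + l * (u - k * h) by rewrite /=; ring.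
apply: le_trans (le_normcD _ _) _.
rewrite [leRHS](_ : _ = e / 2 * normc h + e / 2 * normc h); last by field.
apply: lerD.
  apply: le_trans H3 _; rewrite /e2 -mulrA ler_wpM2l ?divr_ge0 ?(ltW e0)//.
  by rewrite ler_pdivrMl.
rewrite normcM; apply: le_trans (ler_wpM2l (normc_ge0 _) uE) _.
rewrite mulrA ler_wpM2r ?normc_ge0//.
apply: (@le_trans _ _ (normc l * (e / 2 / (1 + normc l)))).
  by rewrite ler_wpM2l ?normc_ge0// ge_min lexx orbT.
rewrite mulrA ler_pdivrMr// mulrC ler_wpM2l ?divr_ge0 ?(ltW e0)//.
by rewrite lerDr.
Qed.

Lemma cderiv_eq f p l k : l = k -> cderiv f p l -> cderiv f p k.
Proof. by move=> ->. Qed.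

Lemma cderiv_ext f g p l : f =1 g -> cderiv f p l -> cderiv g p l.
Proof. by move=> /funext ->. Qed.

Lemma cderiv_near f g p l r : 0 < r -> (forall h, normc h < r -> f (p + h) = g (p + h)) ->
  cderiv f p l -> cderiv g p l.
Proof.
move=> r0 fg fl e e0; have [r1 r10 H] := fl _ e0.
exists (Num.min r r1); first by rewrite lt_min r0.
move=> h; rewrite lt_min => /andP[h1 h2].
have fgp : f p = g p by have := fg 0; rewrite addr0; apply; rewrite (normc0 R).
rewrite -fg// -fgp; exact: H.
Qed.

Lemma cderiv_shift f a p l : cderiv f (a + p) l -> cderiv (fun z => f (a + z)) p l.
Proof. by move=> fl e e0; have [r r0 H] := fl e e0; exists r => // h /H; rewrite addrA. Qed.

Lemma cderivX n p : cderiv (fun z => z ^+ n) p (n%:R * p ^+ n.-1).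
Proof.
elim: n => [|n IH].
  by rewrite mul0r; apply: cderiv_ext (cderiv_cst 1 p) => z; rewrite expr0.
apply: (@cderiv_ext (fun z => z * z ^+ n)); first by move=> z; rewrite exprS.
apply: cderiv_eq (cderivM (cderiv_id p) IH).
rewrite /= mulr1; case: n {IH} => [|n]; first by rewrite !(mul0r, mulr0, expr0) add0r mulr1.
by rewrite /= mulrCA -exprS -[n.+2]addn1 natrD mulrDl mul1r.
Qed.

Definition entire1 f := forall p, exists l, cderiv f p l.

Lemma entire1P f :
  entire1 f <-> forall p, differentiable (f : R[i]^o -> R[i]^o) (p : R[i]^o).
Proof.
split => H p.
  by have [l /cderivP[/derivable1_diffP]] := H p.
have /derivable1_diffP/= h := H p.
by exists ('D_1 (f : R[i]^o -> R[i]^o) p); apply/cderivP; split.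
Qed.

End complex_norm.

(** * Series and power series *)

Section complex_series.
Variable R : realType.
Implicit Types (u v : nat -> R[i]) (z w : R[i]).

Lemma Re_sum (I : Type) (r : seq I) (P : pred I) (F : I -> R[i]) :
  Re (\sum_(i <- r | P i) F i) = \sum_(i <- r | P i) Re (F i).
Proof. by elim/big_rec2: _ => //= i y x _ <-; case: (F i) x => a b [c d]. Qed.

Lemma Im_sum (I : Type) (r : seq I) (P : pred I) (F : I -> R[i]) :
  Im (\sum_(i <- r | P i) F i) = \sum_(i <- r | P i) Im (F i).
Proof. by elim/big_rec2: _ => //= i y x _ <-; case: (F i) x => a b [c d]. Qed.

Lemma cReB z w : Re (z - w) = Re z - Re w.
Proof. by case: z w => a b [c d]. Qed.

Lemma cImB z w : Im (z - w) = Im z - Im w.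
Proof. by case: z w => a b [c d]. Qed.

Lemma normc_sum (I : Type) (r : seq I) (P : pred I) (F : I -> R[i]) :
  normc (\sum_(i <- r | P i) F i) <= \sum_(i <- r | P i) normc (F i).
Proof.
elim/big_rec2: _ => [|i x z _ H]; first by rewrite (normc0 R).
by apply: le_trans (le_normcD _ _) _; rewrite lerD2l.
Qed.

(** Absolute convergence together with an explicit bound: the same hypothesis yields the convergence
    of [csum u] and the estimate of its modulus by [K]. *)
Definition bsum u K := forall n, \sum_(0 <= i < n) normc (u i) <= K.

Definition csum u : R[i] :=
  (limn (series (@complex.Re R \o u))) +i* (limn (series (@complex.Im R \o u))).

Lemma real_series_cvg (f : nat -> R) K :
  (forall n, \sum_(0 <= i < n) `|f i| <= K) -> cvgn (series f).
Proof.
move=> H; apply: normed_cvg; apply: nondecreasing_is_cvgn.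
  apply/nondecreasing_seqP => n /=; rewrite /normed_series_of /=.
  by rewrite [leRHS]/series/= big_nat_recr //= lerDl.
by exists K => _ [n _ <-]; exact: H.
Qed.

Lemma csum_cvg u K : bsum u K -> forall e : R, 0 < e ->
  exists N, forall n, (N <= n)%N -> normc (csum u - \sum_(0 <= i < n) u i) <= e.
Proof.
move=> uK e e0.
have c1 : cvgn (series (@complex.Re R \o u)).
  apply: (@real_series_cvg _ K) => n; apply: le_trans (uK n).
  by apply: ler_sum => i _; exact: le_Re_normc.
have c2 : cvgn (series (@complex.Im R \o u)).
  apply: (@real_series_cvg _ K) => n; apply: le_trans (uK n).
  by apply: ler_sum => i _; exact: le_Im_normc.
have e2 : 0 < e / 2 by rewrite divr_gt0.
have /cvgrPdist_le/(_ _ e2)[N1 _ H1] := c1.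
have /cvgrPdist_le/(_ _ e2)[N2 _ H2] := c2.
exists (maxn N1 N2) => n; rewrite geq_max => /andP[n1 n2].
apply: le_trans (normc_le_ReIm _) _.
rewrite cReB cImB Re_sum Im_sum /= [leRHS](splitr e).
by apply: lerD; [exact: H1|exact: H2].
Qed.

Lemma csum_unique u K l : bsum u K ->
  (forall e : R, 0 < e -> exists N, forall n, (N <= n)%N ->
    normc (l - \sum_(0 <= i < n) u i) <= e) -> l = csum u.
Proof.
move=> uK H; apply/eqP; rewrite -subr_eq0 -normc_eq0 eq_le normc_ge0 andbT.
apply/ler_addgt0Pl => e e0; rewrite addr0.
have e2 : 0 < e / 2 by rewrite divr_gt0.
have [N1 H1] := H _ e2; have [N2 H2] := csum_cvg uK e2.
have := lerD (H1 (maxn N1 N2) (leq_maxl _ _)) (H2 (maxn N1 N2) (leq_maxr _ _)).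
rewrite -splitr; apply: le_trans; rewrite [X in _ <= _ + X]normcB.
apply: le_trans (le_normcD _ _).
by rewrite addrA subrK.
Qed.

Lemma normc_csum u K : bsum u K -> normc (csum u) <= K.
Proof.
move=> uK; apply/ler_addgt0Pl => e e0.
have [N H] := csum_cvg uK e0.
rewrite -[csum u](subrK (\sum_(0 <= i < N) u i)).
apply: le_trans (le_normcD _ _) _; apply: lerD; first exact: H.
by apply: le_trans (normc_sum _ _ _) (uK N).
Qed.

Lemma bsumD u v K L : bsum u K -> bsum v L -> bsum (fun n => u n + v n) (K + L).
Proof.
move=> uK vL n; apply: le_trans (lerD (uK n) (vL n)); rewrite -big_split /=.
by apply: ler_sum => i _; exact: le_normcD.
Qed.

Lemma bsumZ u K a : bsum u K -> bsum (fun n => a * u n) (normc a * K).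
Proof.
move=> uK n; under eq_bigr do rewrite normcM.
by rewrite -mulr_sumr ler_wpM2l ?normc_ge0.
Qed.

Lemma csumD u v K L : bsum u K -> bsum v L ->
  csum (fun n => u n + v n) = csum u + csum v.
Proof.
move=> uK vL; apply/esym/(csum_unique (bsumD uK vL)) => e e0.
have e2 : 0 < e / 2 by rewrite divr_gt0.
have [N1 H1] := csum_cvg uK e2; have [N2 H2] := csum_cvg vL e2.
exists (maxn N1 N2) => n; rewrite geq_max => /andP[n1 n2].
rewrite big_split /= opprD addrACA (splitr e).
by apply: le_trans (le_normcD _ _) _; apply: lerD; [exact: H1|exact: H2].
Qed.

Lemma csumZ u K a : bsum u K -> csum (fun n => a * u n) = a * csum u.
Proof.
move=> uK; apply/esym/(csum_unique (bsumZ a uK)) => e e0.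
have a0 : 0 < 1 + normc a by rewrite ltr_wpDr ?normc_ge0.
have [N H] := csum_cvg uK (divr_gt0 e0 a0).
exists N => n /H{}H; rewrite -mulr_sumr -mulrBr normcM.
apply: le_trans (ler_wpM2l (normc_ge0 _) H) _.
rewrite mulrA ler_pdivrMr// mulrC ler_wpM2l ?(ltW e0)//.
by rewrite lerDr.
Qed.

Lemma csumB u v K L : bsum u K -> bsum v L ->
  csum (fun n => u n - v n) = csum u - csum v.
Proof.
move=> uK vL; rewrite -mulN1r -(csumZ _ vL) -(csumD uK (bsumZ (-1) vL)).
by congr csum; apply/funext => n; rewrite mulN1r.
Qed.

Lemma bsum_shift u K N : bsum u K -> bsum (fun n => u (n + N)%N) K.
Proof.
move=> uK n; apply: le_trans (uK (N + n)%N).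
rewrite (@big_cat_nat _ _ _ N 0 (N + n))//= ?leq_addr//.
rewrite [X in _ <= _ + X](_ : _ = \sum_(0 <= i < n) normc (u (i + N)%N)).
  by rewrite lerDr; apply: sumr_ge0 => i _; exact: normc_ge0.
by rewrite -{1}[N]add0n big_addn addKn.
Qed.

Lemma csum_split u K N : bsum u K ->
  csum u = \sum_(0 <= i < N) u i + csum (fun n => u (n + N)%N).
Proof.
move=> uK; apply/eqP; rewrite addrC -subr_eq; apply/eqP.
apply: (csum_unique (bsum_shift N uK)) => e e0.
have [N1 H1] := csum_cvg uK e0.
exists N1 => n n1; have := H1 (N + n)%N (leq_trans n1 (leq_addl _ _)).
rewrite (@big_cat_nat _ _ _ N 0 (N + n))//= ?leq_addr// opprD addrA.
rewrite [in X in X -> _](_ : \sum_(N <= i < N + n) _ = \sum_(0 <= i < n) u (i + N)%N)//.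
by rewrite -{1}[N]add0n big_addn addKn.
Qed.

Lemma csum_recl u K : bsum u K -> csum u = u 0%N + csum (fun n => u n.+1).
Proof.
move=> uK; rewrite (csum_split 1 uK) big_nat1; congr (_ + csum _).
by apply/funext => n; rewrite addn1.
Qed.

Lemma sum_geometric_le (q : R) n : 0 <= q -> q < 1 ->
  \sum_(0 <= i < n) q ^+ i <= (1 - q)^-1.
Proof.
move=> q0 q1; have d0 : 0 < 1 - q by rewrite subr_gt0.
rewrite -[leRHS]mul1r ler_pdivlMr// mulrC.
have -> : (1 - q) * (\sum_(0 <= i < n) q ^+ i) = 1 - q ^+ n.
  elim: n => [|n IH]; first by rewrite big_nil mulr0 expr0 subrr.
  by rewrite big_nat_recr//= mulrDr IH exprS; ring.
by rewrite gerBl exprn_ge0.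
Qed.

(** Each of the [n] powers [q ^+ i] with [i < n] is at least [q ^+ n]. This is the device by which a
    factor [n] is absorbed into a slightly larger geometric rate. *)
Lemma geometric_n_le (q : R) n : 0 <= q -> q < 1 -> n%:R * q ^+ n <= (1 - q)^-1.
Proof.
move=> q0 q1; apply: le_trans (sum_geometric_le n q0 q1).
rewrite mulr_natl -[in leLHS](subn0 n) -sumr_const_nat.
rewrite !big_nat; apply: ler_sum => i /andP[_ /ltnW iN].
by rewrite subn0 ler_wiXn2l// ltW.
Qed.

Lemma sum_exp_le (x : R) n : 0 <= x -> \sum_(0 <= i < n) (x ^+ i / i`!%:R) <= expR x.
Proof.
move=> x0; have : series (exp_coeff x) n <= expR x.
  apply: nondecreasing_cvgn_le; last exact: is_cvg_series_exp_coeff.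
  apply/nondecreasing_seqP => k.
  by rewrite /series /= big_nat_recr//= lerDl exp_coeff_ge0.
by [].
Qed.

Lemma exp_term_le (x : R) n : 0 <= x -> x ^+ n / n`!%:R <= expR x.
Proof.
move=> x0; apply: le_trans (sum_exp_le n.+1 x0); rewrite big_nat_recr//= lerDr.
by apply: sumr_ge0 => i _; rewrite divr_ge0 ?exprn_ge0 ?ler0n.
Qed.

Implicit Types (c : nat -> R[i]).

Definition pser c z := csum (fun n => c n * z ^+ n).

(** The shape of Cauchy's estimates: it forces convergence on the open disc of radius [r] while
    keeping the constant visible, which the uniform coefficient bound requires. *)
Definition prad c (r K : R) := forall n, normc (c n) * r ^+ n <= K.

Lemma prad_ge0 c r K : prad c r K -> 0 <= K.
Proof. by move=> /(_ 0%N); apply: le_trans; rewrite expr0 mulr1 normc_ge0. Qed.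

Lemma bsum_pser c r K z rho : 0 < r -> prad c r K -> normc z <= rho -> rho < r ->
  bsum (fun n => c n * z ^+ n) (K / (1 - rho / r)).
Proof.
move=> r0 cK zr rr n.
have rho0 : 0 <= rho := le_trans (normc_ge0 _) zr.
apply: (@le_trans _ _ (\sum_(0 <= i < n) K * (rho / r) ^+ i)).
  apply: ler_sum => i _; rewrite normcM normcX expr_div_n mulrA ler_pdivlMr ?exprn_gt0//.
  rewrite mulrAC ler_pM ?mulr_ge0 ?normc_ge0 ?exprn_ge0 ?normc_ge0 ?(ltW r0) ?cK//.
  by rewrite lerXn2r ?nnegrE ?normc_ge0.
rewrite -mulr_sumr ler_wpM2l ?(prad_ge0 cK)// sum_geometric_le//.
  by rewrite divr_ge0 ?(ltW r0).
by rewrite ltr_pdivrMr// mul1r.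
Qed.

Lemma prad_natmul c r K rho : 0 < r -> prad c r K -> 0 <= rho -> rho < r ->
  prad (fun n => n%:R * c n) rho (K / (1 - rho / r)).
Proof.
move=> r0 cK p0 pr n.
have q0 : 0 <= rho / r by rewrite divr_ge0 ?(ltW r0).
have q1 : rho / r < 1 by rewrite ltr_pdivrMr// mul1r.
have -> : normc (n%:R * c n) * rho ^+ n = (normc (c n) * r ^+ n) * (n%:R * (rho / r) ^+ n).
  rewrite normcM exprMn exprVn.
  have -> : normc (n%:R : R[i]) = n%:R :> R.
    by rewrite -(rmorph_nat (real_complex R)) normcR normr_nat.
  by field; rewrite expf_neq0// gt_eqF.
apply: ler_pM; rewrite ?mulr_ge0 ?normc_ge0 ?exprn_ge0 ?ler0n ?(ltW r0)//.
exact: geometric_n_le.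
Qed.

Lemma prad_le c r K rho : 0 <= rho <= r -> prad c r K -> prad c rho K.
Proof.
move=> /andP[p0 pr] cK n; apply: le_trans (cK n).
by rewrite ler_wpM2l ?normc_ge0// lerXn2r ?nnegrE// (le_trans p0).
Qed.

Lemma prad_shift c r K : 0 < r -> prad c r K -> prad (fun n => c n.+1) r (K / r).
Proof.
move=> r0 cK n; rewrite ler_pdivlMr// -mulrA -exprSr; exact: cK.
Qed.

Definition dcoef c := fun n => n.+1%:R * c n.+1.

(** Induction: the remainder of order n + 1 is [p + h] times that of order n, plus [n p^(n-1) h^2],
    and [n^2 + n <= (n + 1)^2]. Dividing by [rho ^+ 2] avoids a truncated exponent n - 2. *)
Lemma expr_taylor (p h : R[i]) (rho : R) n : 0 < rho -> normc p <= rho ->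
  normc (p + h) <= rho ->
  normc ((p + h) ^+ n - p ^+ n - n%:R * p ^+ n.-1 * h) <=
    n%:R ^+ 2 * (rho ^+ n / rho ^+ 2) * normc h ^+ 2.
Proof.
move=> r0 pr phr; elim: n => [|n IH].
  by rewrite !expr0 subrr !mul0r subrr (normc0 R) expr0n /= !mul0r.
have -> : (p + h) ^+ n.+1 - p ^+ n.+1 - n.+1%:R * p ^+ n.+1.-1 * h =
  (p + h) * ((p + h) ^+ n - p ^+ n - n%:R * p ^+ n.-1 * h) + n%:R * p ^+ n.-1 * h ^+ 2.
  case: n {IH} => [|n]; first by rewrite !expr0 !expr1 /=; ring.
  by rewrite /= -natr1 !exprS; ring.
apply: le_trans (le_normcD _ _) _.
apply: (@le_trans _ _ ((n%:R ^+ 2 * rho ^+ n.+1 / rho ^+ 2 + n%:R * (rho ^+ n.+1 / rho ^+ 2)) * normc h ^+ 2)).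
  rewrite [leRHS]mulrDl; apply: lerD.
    rewrite normcM [leRHS](_ : _ = rho * (n%:R ^+ 2 * (rho ^+ n / rho ^+ 2) * normc h ^+ 2)).
      by rewrite ler_pM ?normc_ge0.
    by rewrite [rho ^+ n.+1]exprS; ring.
  rewrite !normcM -expr2 ler_wpM2r ?sqr_ge0//.
  have -> : normc (n%:R : R[i]) = n%:R :> R.
    by rewrite -(rmorph_nat (real_complex R)) normcR normr_nat.
  case: n {IH} => [|n]; first by rewrite !mul0r.
  rewrite ler_wpM2l ?ler0n//= normcX [leRHS](_ : _ = rho ^+ n).
    by rewrite lerXn2r ?nnegrE ?normc_ge0// ltW.
  by rewrite -addn2 exprD mulfK ?expf_neq0 ?gt_eqF.
rewrite ler_wpM2r ?sqr_ge0// -mulrA -mulrDl ler_wpM2r ?divr_ge0 ?exprn_ge0 ?(ltW r0)//.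
by rewrite -natr1; have := ler0n R n; nra.
Qed.

Lemma pser_quadratic c r K p : prad c r K -> normc p < r ->
  exists M r1 : R, [/\ 0 <= M, normc p < r1 & forall h, normc (p + h) <= r1 ->
    normc (pser c (p + h) - pser c p - pser (dcoef c) p * h) <= M * normc h ^+ 2].
Proof.
move=> cK pr.
have r0 : 0 < r := le_lt_trans (normc_ge0 _) pr.
(* Three radii between [normc p] and [r]: the quadratic remainder carries a factor n^2, so each step
   from [r] to [r3] and from [r3] to [r2] absorbs one factor n, and the series is then summed at
   [r1]. *)
pose r1 := (normc p + r) / 2.
pose r2 := (r1 + r) / 2.
pose r3 := (r2 + r) / 2.
have pr1 : normc p < r1 by rewrite /r1; lra.
have r12 : r1 < r2 by rewrite /r2 /r1; lra.
have r23 : r2 < r3 by rewrite /r3 /r2 /r1; lra.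
have r3r : r3 < r by rewrite /r3 /r2 /r1; lra.
have r10 : 0 < r1 := le_lt_trans (normc_ge0 _) pr1.
have r20 : 0 < r2 := lt_trans r10 r12.
have r30 : 0 < r3 := lt_trans r20 r23.
have cK3 := prad_natmul r0 cK (ltW r30) r3r.
have cK2 := prad_natmul r30 cK3 (ltW r20) r23.
set K2 := _ / (1 - _) in cK2.
pose M := K2 / (1 - r1 / r2) / r1 ^+ 2.
have r1n : normc (r1%:C) <= r1 by rewrite normcR ger0_norm// ltW.
have bs := bsum_pser r20 cK2 r1n r12.
have M0 : 0 <= M.
  by rewrite divr_ge0 ?exprn_ge0 ?(ltW r10)//; apply: le_trans (bs 0%N); rewrite big_nil.
have nC n : normc (n%:R : R[i]) = n%:R :> R.
  by rewrite -(rmorph_nat (real_complex R)) normcR normr_nat.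
exists M, r1; split=> // h ph.
  have b1 := bsum_pser r0 cK ph (lt_trans r12 (lt_trans r23 r3r)).
  have b2 := bsum_pser r0 cK (ltW pr1) (lt_trans r12 (lt_trans r23 r3r)).
  have b3 : bsum (fun n => n%:R * c n * p ^+ n.-1) ((K / (1 - r3 / r)) / r3 / (1 - r1 / r3)).
    move=> n.
    have := bsum_pser r30 (prad_shift r30 cK3) (ltW pr1) (lt_trans r12 r23) => bb.
    case: n => [|n].
      by rewrite big_nil; apply: le_trans (bb 0%N); rewrite big_nil.
    rewrite big_nat_recl//= !mul0r (normc0 R) add0r; exact: bb.
  have b4 : bsum (fun n => h * (n%:R * c n * p ^+ n.-1)) _ := bsumZ h b3.
  have -> : pser (dcoef c) p = csum (fun n => n%:R * c n * p ^+ n.-1).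
    by rewrite (csum_recl b3) !mul0r add0r.
  rewrite [_ * h]mulrC -(csumZ _ b3) /pser -(csumB b1 b2).
  have b12 : bsum (fun n => c n * (p + h) ^+ n - c n * p ^+ n) (K / (1 - r1 / r) + normc (-1 : R[i]) * (K / (1 - r1 / r))).
    move=> n; rewrite (eq_bigr (fun i => normc (c i * (p + h) ^+ i + (-1) * (c i * p ^+ i)))).
      exact: (bsumD b1 (bsumZ (-1) b2)).
    by move=> i _; rewrite mulN1r.
  rewrite -(csumB b12 b4); apply: normc_csum.
  have -> : (fun n => c n * (p + h) ^+ n - c n * p ^+ n - h * (n%:R * c n * p ^+ n.-1)) =
     (fun n => c n * ((p + h) ^+ n - p ^+ n - n%:R * p ^+ n.-1 * h)).
    by apply/funext => n; ring.
  move=> n; apply: (@le_trans _ _ (\sum_(0 <= i < n) normc (i%:R * (i%:R * c i) * r1%:C ^+ i) * (normc h ^+ 2 / r1 ^+ 2))).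
    apply: ler_sum => i _; rewrite !normcM !nC normcX normcR ger0_norm ?(ltW r10)//.
    apply: le_trans (ler_wpM2l (normc_ge0 _) (expr_taylor i r10 (ltW pr1) ph)) _.
    by rewrite le_eqVlt; apply/orP; left; apply/eqP; ring.
  rewrite -mulr_suml mulrA /M [leRHS]mulrAC ler_wpM2r ?invr_ge0 ?sqr_ge0//.
  rewrite ler_wpM2r ?sqr_ge0//; exact: bs.
Qed.

Lemma cderiv_pser c r K p : prad c r K -> normc p < r ->
  cderiv (pser c) p (pser (dcoef c) p).
Proof.
move=> cK pr; have [M [r1 [M0 pr1 key]]] := pser_quadratic cK pr.
move=> e e0; exists (Num.min (r1 - normc p) (e / (1 + M))).
  by rewrite lt_min subr_gt0 pr1 divr_gt0// ltr_wpDr.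
move=> h; rewrite lt_min => /andP[h1 h2].
apply: le_trans (key _ _) _.
  by apply: le_trans (le_normcD _ _) _; rewrite addrC -lerBrDr ltW.
rewrite expr2 mulrA ler_wpM2r ?normc_ge0//.
move: h2; rewrite ltr_pdivlMr ?ltr_wpDr// => /ltW; apply: le_trans.
by rewrite mulrC ler_wpM2l ?normc_ge0// lerDr.
Qed.

Lemma pser0 c : pser c 0 = c 0%N.
Proof.
have b : bsum (fun n => c n * 0 ^+ n) (normc (c 0%N)).
  case=> [|n]; first by rewrite big_nil normc_ge0.
  rewrite big_nat_recl//= expr0 mulr1 big1 ?addr0// => i _.
  by rewrite expr0n mulr0 (normc0 R).
rewrite /pser (csum_recl b) expr0 mulr1.
have b0 : bsum (fun n => c n.+1 * 0 ^+ n.+1) 0.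
  by move=> n; rewrite big1// => i _; rewrite expr0n mulr0 (normc0 R).
have := normc_csum b0; rewrite le_eqVlt ltNge normc_ge0 orbF normc_eq0.
by move=> /eqP ->; rewrite addr0.
Qed.

Lemma pser_recl c r K z : prad c r K -> normc z < r ->
  pser c z = c 0%N + z * pser (fun n => c n.+1) z.
Proof.
move=> cK zr; have r0 : 0 < r := le_lt_trans (normc_ge0 _) zr.
have b1 := bsum_pser r0 cK (lexx _) zr.
have b2 := bsum_pser r0 (prad_shift r0 cK) (lexx _) zr.
rewrite /pser (csum_recl b1) expr0 mulr1 -(csumZ _ b2); congr (_ + csum _).
by apply/funext => n; rewrite exprS mulrCA.
Qed.

(** Continuity at 0 gives the vanishing of the constant term; division by x then replaces [c] by its
    shift, and induction reaches every coefficient. *)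
Lemma pser_eq0 c r K r0 : 0 < r -> 0 < r0 -> prad c r K ->
  (forall x : R, 0 < x -> x < r0 -> pser c x%:C = 0) -> forall n, c n = 0.
Proof.
move=> rr r00 cK.
pose r1 := Num.min r0 r.
have r10 : 0 < r1 by rewrite lt_min r00.
move=> c0; have {c0} : forall x : R, 0 < x -> x < r1 -> pser c x%:C = 0.
  by move=> x x0; rewrite lt_min => /andP[xr _]; exact: c0.
have c00 d L : prad d r L -> (forall x : R, 0 < x -> x < r1 -> pser d x%:C = 0) ->
    d 0%N = 0.
  move=> dL d0; have n0 : normc (0 : R[i]) < r by rewrite (normc0 R).
  have H := cderiv_cont (cderiv_pser dL n0).
  apply/eqP; rewrite -normc_eq0 eq_le normc_ge0 andbT.
  apply/ler_addgt0Pl => e e0; rewrite addr0.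
  have [q q0 Hq] := H e e0.
  pose x := Num.min q r1 / 2.
  have x0 : 0 < x by rewrite divr_gt0// lt_min q0.
  have xm : x < Num.min q r1 by rewrite /x ltr_pdivrMr// mulr_natr mulr2n ltrDl lt_min q0.
  move: xm; rewrite lt_min => /andP[xq xr].
  have := Hq x%:C; rewrite normcR (gtr0_norm x0) => /(_ xq).
  by rewrite add0r d0// pser0 sub0r normcN.
move=> c0 n; elim: n c K cK c0 => [|n IH] d L dL d0; first exact: (c00 d L).
apply: (IH (fun n => d n.+1) (L / r)); first exact: prad_shift.
move=> x x0 xr; have := d0 _ x0 xr.
rewrite (pser_recl dL); last first.
  by rewrite normcR gtr0_norm//; move: xr; rewrite lt_min => /andP[].
rewrite (c00 d L dL d0) add0r => /eqP; rewrite mulf_eq0 => /orP[|/eqP//].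
by rewrite -normc_eq0 normcR normr_eq0 gt_eqF.
Qed.

End complex_series.

(** * Integrals of complex-valued functions over real segments *)

Section segment_integral.
Variable R : realType.
Notation mu := (@lebesgue_measure R).
Implicit Types (g h : R -> R[i]) (a b c d x y : R) (z k : R[i]).

Definition rderiv (f : R -> R) x l := forall e : R, 0 < e -> exists2 r : R, 0 < r &
  forall u, `|u| < r -> `|f (x + u) - f x - l * u| <= e * `|u|.

Lemma rderivP (f : R -> R) x l : rderiv f x l <-> is_derive x 1 f l.
Proof.
split.
  move=> fl.
  have cvl : (fun h : R => h^-1 *: (f (h *: 1 + x) - f x)) @ 0^' --> l.
    apply/cvgrPdist_le => e e0; have [r r0 H] := fl _ e0.
    near=> u.
    have u0 : u != 0 by near: u; exact: nbhs_dnbhs_neq.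
    have ur : `|u| < r by near: u; exact: dnbhs0_lt.
    have -> : l - u^-1 *: (f (u *: 1 + x) - f x) = - (u^-1 * (f (x + u) - f x - l * u)).
      by rewrite /GRing.scale /= mulr1 (addrC u x); field.
    rewrite normrN normrM normfV ler_pdivrMl ?normr_gt0// [leRHS]mulrC.
    exact: H.
  split; first by apply/cvg_ex; exists l.
  exact/cvg_lim.
move=> [] /cvg_ex[l' cvl] <- e e0; rewrite /derive (cvg_lim _ cvl)//.
move/cvgrPdist_le : cvl => /(_ _ e0).
rewrite /dnbhs near_withinE /= => /nbhs_ballP[r /= r0 Hr].
exists r => // u ur.
have [->|u0] := eqVneq u 0; first by rewrite addr0 subrr mulr0 subrr normr0 mulr0.
have := Hr u; rewrite /ball /= sub0r normrN => /(_ ur u0).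
rewrite /GRing.scale /= mulr1 (addrC u x) => /(ler_wpM2r (normr_ge0 u)).
apply: le_trans; rewrite -normrM -normrN.
by rewrite le_eqVlt; apply/orP; left; apply/eqP; congr (`| _ |); field.
Unshelve. all: by end_near.
Qed.

Definition ccont g x := forall e : R, 0 < e -> exists2 r : R, 0 < r &
  forall u, `|u| < r -> normc (g (x + u) - g x) <= e.

Lemma ccont_near (f : R -> R) x :
  (forall e : R, 0 < e -> exists2 r : R, 0 < r & forall u, `|u| < r -> `|f (x + u) - f x| <= e) ->
  {for x, continuous f}.
Proof.
move=> H; apply/cvgrPdist_le => e e0; have [r r0 Hr] := H _ e0.
apply/nbhs_ballP; exists r => //= y; rewrite /ball /= => xy.
have := Hr (y - x); rewrite subrKC distrC => /(_ xy); by rewrite distrC.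
Qed.

Lemma ccont_Re g x : ccont g x -> {for x, continuous (fun t => Re (g t))}.
Proof.
move=> gx; apply: ccont_near => e e0; have [r r0 H] := gx _ e0.
by exists r => // u /H; apply: le_trans; rewrite -cReB le_Re_normc.
Qed.

Lemma ccont_Im g x : ccont g x -> {for x, continuous (fun t => Im (g t))}.
Proof.
move=> gx; apply: ccont_near => e e0; have [r r0 H] := gx _ e0.
by exists r => // u /H; apply: le_trans; rewrite -cImB le_Im_normc.
Qed.

Lemma ccont_normc g x : ccont g x -> {for x, continuous (fun t => normc (g t))}.
Proof.
move=> gx; apply: ccont_near => e e0; have [r r0 H] := gx _ e0.
exists r => // u /H; apply: le_trans; rewrite ler_norml lerB_normc andbT.
by rewrite lerNl opprB (le_trans (lerB_normc _ _))// normcB.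
Qed.

Lemma ccontD g h x : ccont g x -> ccont h x -> ccont (fun t => g t + h t) x.
Proof.
move=> gx hx e e0; have e2 : 0 < e / 2 by rewrite divr_gt0.
have [r1 r10 H1] := gx _ e2; have [r2 r20 H2] := hx _ e2.
exists (Num.min r1 r2); first by rewrite lt_min r10.
move=> u; rewrite lt_min => /andP[u1 u2].
rewrite opprD addrACA (splitr e); apply: le_trans (le_normcD _ _) _.
by apply: lerD; [exact: H1|exact: H2].
Qed.

Lemma ccontZ g k x : ccont g x -> ccont (fun t => k * g t) x.
Proof.
move=> gx e e0; have k0 : 0 < 1 + normc k by rewrite ltr_wpDr ?normc_ge0.
have [r r0 H] := gx _ (divr_gt0 e0 k0).
exists r => // u /H{}H; rewrite -mulrBr normcM.
apply: le_trans (ler_wpM2l (normc_ge0 _) H) _.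
by rewrite mulrA ler_pdivrMr// mulrC ler_wpM2l ?(ltW e0)// lerDr.
Qed.

Lemma ccontB g h x : ccont g x -> ccont h x -> ccont (fun t => g t - h t) x.
Proof.
move=> gx hx; have := ccontD gx (ccontZ (-1) hx).
by under eq_fun do rewrite mulN1r.
Qed.

Lemma ccont_cst k x : ccont (fun=> k) x.
Proof. by move=> e e0; exists 1 => // u _; rewrite subrr (normc0 R) ltW. Qed.

Definition ccontI a b g := forall x, a <= x <= b -> ccont g x.

Lemma integrable_segment (f : R -> R) a b :
  (forall x, a <= x <= b -> {for x, continuous f}) ->
  mu.-integrable `[a, b] (EFin \o f).
Proof.
move=> H; apply: continuous_compact_integrable; first exact: segment_compact.
by apply: continuous_in_subspaceT => x; rewrite inE /= in_itv /=; exact: H.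
Qed.

Lemma ccontI_Re a b g : ccontI a b g -> mu.-integrable `[a, b] (EFin \o (fun t => Re (g t))).
Proof. by move=> gI; apply: integrable_segment => x /gI/ccont_Re. Qed.

Lemma ccontI_Im a b g : ccontI a b g -> mu.-integrable `[a, b] (EFin \o (fun t => Im (g t))).
Proof. by move=> gI; apply: integrable_segment => x /gI/ccont_Im. Qed.

Lemma ccontI_bounded a b g : a <= b -> ccontI a b g ->
  exists2 M : R, 0 <= M & forall x, a <= x <= b -> normc (g x) <= M.
Proof.
move=> ab gI; have [||c cab H] := @EVT_max R (fun t => normc (g t)) a b => //.
  apply: continuous_in_subspaceT => x; rewrite inE /= in_itv /= => /gI.
  exact: ccont_normc.
by exists (normc (g c)); [exact: normc_ge0|move=> x xab; apply: H; rewrite in_itv].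
Qed.

Definition cint a b g : R[i] :=
  (\int[mu]_(x in `[a, b]) Re (g x))%R +i* (\int[mu]_(x in `[a, b]) Im (g x))%R.

Lemma eq_cint a b g h : (forall x, a <= x <= b -> g x = h x) -> cint a b g = cint a b h.
Proof.
by move=> gh; congr (_ +i* _); apply: eq_Rintegral => x;
  rewrite inE /= in_itv /= => /gh ->.
Qed.

Lemma cReD z k : Re (z + k) = Re z + Re k. Proof. by case: z k => ? ? []. Qed.
Lemma cImD z k : Im (z + k) = Im z + Im k. Proof. by case: z k => ? ? []. Qed.
Lemma cReM z k : Re (z * k) = Re z * Re k - Im z * Im k. Proof. by case: z k => ? ? []. Qed.
Lemma cImM z k : Im (z * k) = Re z * Im k + Im z * Re k. Proof. by case: z k => ? ? []. Qed.

Lemma cintD a b g h : ccontI a b g -> ccontI a b h ->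
  cint a b (fun t => g t + h t) = cint a b g + cint a b h.
Proof.
move=> gI hI; apply/eqP; rewrite eq_complex /=; apply/andP; split; apply/eqP.
  by rewrite -RintegralD//; [apply: eq_Rintegral => x _; rewrite cReD|exact: ccontI_Re..].
by rewrite -RintegralD//; [apply: eq_Rintegral => x _; rewrite cImD|exact: ccontI_Im..].
Qed.

Lemma integrable_scale (f : R -> R) a b (k : R) :
  mu.-integrable `[a, b] (EFin \o f) -> mu.-integrable `[a, b] (EFin \o (fun x => k * f x)).
Proof.
move=> fI; rewrite (_ : _ \o _ = (fun x => (k%:E * (EFin \o f) x)%E)); first exact: integrableZl.
by apply/funext => x /=; rewrite EFinM.
Qed.

Lemma cintZ a b g k : ccontI a b g -> cint a b (fun t => k * g t) = k * cint a b g.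
Proof.
move=> gI; have iR := ccontI_Re gI; have iI := ccontI_Im gI; case: k => p q.
apply/eqP; rewrite eq_complex /=; apply/andP; split; apply/eqP.
  rewrite -!RintegralZl// -RintegralB//; [|exact: integrable_scale..].
  by apply: eq_Rintegral => x _; rewrite cReM.
rewrite -!RintegralZl// -RintegralD//; [|exact: integrable_scale..].
by apply: eq_Rintegral => x _; rewrite cImM.
Qed.

Lemma ccontID a b g h : ccontI a b g -> ccontI a b h -> ccontI a b (fun t => g t + h t).
Proof. by move=> gI hI x xab; apply: ccontD; [exact: gI|exact: hI]. Qed.

Lemma ccontIZ a b g k : ccontI a b g -> ccontI a b (fun t => k * g t).
Proof. by move=> gI x xab; apply: ccontZ; exact: gI. Qed.

Lemma ccontIB a b g h : ccontI a b g -> ccontI a b h -> ccontI a b (fun t => g t - h t).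
Proof. by move=> gI hI x xab; apply: ccontB; [exact: gI|exact: hI]. Qed.

Lemma cintB a b g h : ccontI a b g -> ccontI a b h ->
  cint a b (fun t => g t - h t) = cint a b g - cint a b h.
Proof.
move=> gI hI; rewrite -mulN1r -cintZ// -cintD//; last exact: ccontIZ.
by apply: eq_cint => x _; rewrite mulN1r.
Qed.

Lemma fine_segment a b : a <= b -> fine (mu `[a, b]%classic) = b - a.
Proof.
move=> ab; rewrite lebesgue_measure_itv/= lte_fin.
by case: ltgtP ab => //= -> _; rewrite subrr.
Qed.

Lemma cint_cst a b k : a <= b -> cint a b (fun=> k) = k * (b - a)%:C.
Proof.
move=> ab; rewrite /cint !Rintegral_cst// fine_segment//.
by case: k => p q; apply/eqP; rewrite eq_complex /= !mulr0 subr0 add0r !eqxx.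
Qed.

Lemma Rintegral_le_bound (f : R -> R) a b M : a <= b ->
  mu.-integrable `[a, b] (EFin \o f) -> (forall x, a <= x <= b -> `|f x| <= M) ->
  `|\int[mu]_(x in `[a, b]) f x| <= M * (b - a).
Proof.
move=> ab fI fM; apply: le_trans (le_normr_Rintegral _ fI) _ => //.
rewrite -(fine_segment ab) -Rintegral_cst//; apply: le_Rintegral => //.
- exact: integrable_norm fI.
- apply: integrable_segment => x _; exact: cvg_cst.
Qed.

(** Real and imaginary parts are estimated separately, whence the factor 2, which reappears in all
    the Cauchy estimates below. *)
Lemma normc_cint a b g M : a <= b -> ccontI a b g ->
  (forall x, a <= x <= b -> normc (g x) <= M) -> normc (cint a b g) <= 2 * M * (b - a).
Proof.
move=> ab gI gM; apply: le_trans (normc_le_ReIm _) _ => /=.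
rewrite -mulrA mulr_natl mulr2n; apply: lerD; apply: Rintegral_le_bound => //.
- exact: ccontI_Re.
- by move=> x /gM; apply: le_trans; exact: le_Re_normc.
- exact: ccontI_Im.
- by move=> x /gM; apply: le_trans; exact: le_Im_normc.
Qed.

Lemma cint_near_cst a b g k M : a <= b -> ccontI a b g ->
  (forall x, a <= x <= b -> normc (g x - k) <= M) ->
  normc (cint a b g - k * (b - a)%:C) <= 2 * M * (b - a).
Proof.
move=> ab gI gM; rewrite -cint_cst// -cintB//; last by move=> x _; exact: ccont_cst.
apply: normc_cint => //; apply: ccontIB => // x _; exact: ccont_cst.
Qed.

Lemma Rintegral_split (f : R -> R) a m b : a <= m -> m <= b ->
  mu.-integrable `[a, b] (EFin \o f) ->
  (\int[mu]_(x in `[a, b]) f x = \int[mu]_(x in `[a, m]) f x + \int[mu]_(x in `[m, b]) f x)%R.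
Proof.
move=> am mb fI; have := @Rintegral_itvB R f (BLeft a) (BRight b) m fI.
rewrite !bnd_simp => /(_ am mb).
rewrite Rintegral_itv_obnd_cbnd; last first.
  by apply: integrableS fI => // x /=; rewrite !in_itv/= => /andP[/ltW mx ->]; rewrite (le_trans am).
by move=> <-; rewrite addrC subrK.
Qed.

Lemma cint_split a m b g : a <= m -> m <= b -> ccontI a b g ->
  cint a b g = cint a m g + cint m b g.
Proof.
move=> am mb gI; rewrite /cint (Rintegral_split am mb); last exact: ccontI_Re.
by rewrite (Rintegral_split am mb)//; exact: ccontI_Im.
Qed.

Lemma cint_sum a b n (G : nat -> R -> R[i]) : (forall i, ccontI a b (G i)) ->
  cint a b (fun t => \sum_(0 <= i < n) G i t) = \sum_(0 <= i < n) cint a b (G i) /\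
  ccontI a b (fun t => \sum_(0 <= i < n) G i t).
Proof.
move=> GI; elim: n => [|n [IH IHc]].
  under eq_fun do rewrite big_nil; rewrite big_nil; split; last by move=> x _; exact: ccont_cst.
  rewrite /cint [X in X +i* _](_ : _ = 0) 1?[X in _ +i* X](_ : _ = 0)//.
    by rewrite Rintegral_cst// mul0r.
  by rewrite Rintegral_cst// mul0r.
have E : (fun t => \sum_(0 <= i < n.+1) G i t) = (fun t => \sum_(0 <= i < n) G i t + G n t).
  by apply/funext => t; rewrite big_nat_recr.
by rewrite E big_nat_recr//= -IH; split; [exact: cintD|exact: ccontID].
Qed.

End segment_integral.

(** * Cauchy and Taylor theorems *)

Section goursat.
Variable R : realType.
Implicit Types (H f : R[i] -> R[i]) (a b c d x y m : R).

Lemma nested_intervals (a b : nat -> R) : nondecreasing_seq a -> nonincreasing_seq b ->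
  (forall n, a n <= b n) -> exists x, forall n, a n <= x <= b n.
Proof.
move=> ia db ab.
have abm (m n : nat) : a m <= b n.
  apply: le_trans (ia _ _ (leq_maxl m n)) _; apply: le_trans (ab _) _.
  exact/db/leq_maxr.
exists (sup (range a)) => n; apply/andP; split.
  by apply: ub_le_sup; [exists (b 0%N) => _ [m _ <-]|exists n].
by apply: ge_sup; [exists (a 0%N), 0%N|move=> _ [m _ <-]].
Qed.

Lemma expr2_bound (L r : R) : 0 <= L -> 0 < r -> exists n, L / 2 ^+ n < r.
Proof.
move=> L0 r0; have Lr : 0 <= L / r by rewrite divr_ge0 ?(ltW r0).
exists (Num.bound (L / r)); rewrite ltr_pdivrMr ?exprn_gt0// mulrC -ltr_pdivrMr//.
apply: lt_le_trans (archi_boundP Lr) _.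
by rewrite -natrX ler_nat ltnW// ltn_expl.
Qed.

(** Goursat's bisection, separated from contour integrals. Among four quarters one carries at least
    a fourth of [|J|]; the squared size of the rectangles also drops by 4 at each step, so smallness
    relative to the squared size near the limit point contradicts a nonzero [J]. *)
Lemma rect_additive_eq0 (J : R -> R -> R -> R -> R[i]) (A B C D : R) :
  A <= B -> C <= D ->
  (forall a m b c d, A <= a -> a <= m -> m <= b -> b <= B -> C <= c -> c <= d -> d <= D ->
    J a b c d = J a m c d + J m b c d) ->
  (forall a b c m d, A <= a -> a <= b -> b <= B -> C <= c -> c <= m -> m <= d -> d <= D ->
    J a b c d = J a b c m + J a b m d) ->
  (forall x y, A <= x <= B -> C <= y <= D -> forall e : R, 0 < e -> exists2 r : R, 0 < r &
    forall a b c d, A <= a -> a <= x -> x <= b -> b <= B ->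
      C <= c -> c <= y -> y <= d -> d <= D -> b - a < r -> d - c < r ->
      normc (J a b c d) <= e * ((b - a) + (d - c)) ^+ 2) ->
  J A B C D = 0.
Proof.
move=> AB CD Jx Jy Jloc.
pose rect : Type := (R * R * R * R)%type.
pose N (q : rect) := let: (a, b, c, d) := q in normc (J a b c d).
pose P (q : rect) := let: (a, b, c, d) := q in
  [/\ A <= a, a <= b & b <= B] /\ [/\ C <= c, c <= d & d <= D].
pose Q (q q' : rect) := let: (a, b, c, d) := q in let: (a', b', c', d') := q' in
  [/\ a <= a', b' <= b, c <= c' & d' <= d] /\
  [/\ b' - a' = (b - a) / 2, d' - c' = (d - c) / 2 & N q <= 4 * N q'].
(* With [P q] inside the existential the successor is a total function of [q], as [choice]
   requires. *)
have step (q : rect) : exists q', P q -> P q' /\ Q q q'.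
  case: q => [[[a b] c] d].
  have [Pq|nP] := pselect (P (a, b, c, d)); last by exists (a, b, c, d).
  case: (Pq) => -[Aa ab bB] [Cc cd dD].
  pose m := (a + b) / 2; pose n := (c + d) / 2.
  have am : a <= m by rewrite /m; lra.
  have mb : m <= b by rewrite /m; lra.
  have cn : c <= n by rewrite /n; lra.
  have nd : n <= d by rewrite /n; lra.
  have JE : J a b c d = J a m c n + J a m n d + (J m b c n + J m b n d).
    rewrite (Jx a m b c d)//; congr (_ + _); apply: Jy => //.
      exact: le_trans mb bB.
    exact: le_trans Aa am.
  have Nle : normc (J a b c d) <= normc (J a m c n) + normc (J a m n d) +
      (normc (J m b c n) + normc (J m b n d)).
    rewrite JE; apply: le_trans (le_normcD _ _) _; apply: lerD; exact: le_normcD.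
  have [h1|h1] := leP (normc (J a b c d)) (4 * normc (J a m c n)).
    by exists (a, m, c, n) => _; rewrite /P /Q /N; repeat split => //; rewrite /m /n; lra.
  have [h2|h2] := leP (normc (J a b c d)) (4 * normc (J a m n d)).
    by exists (a, m, n, d) => _; rewrite /P /Q /N; repeat split => //; rewrite /m /n; lra.
  have [h3|h3] := leP (normc (J a b c d)) (4 * normc (J m b c n)).
    by exists (m, b, c, n) => _; rewrite /P /Q /N; repeat split => //; rewrite /m /n; lra.
  have h4 : normc (J a b c d) <= 4 * normc (J m b n d) by lra.
  by exists (m, b, n, d) => _; rewrite /P /Q /N; repeat split => //; rewrite /m /n; lra.
have [next nextP] := choice step.
pose q k := iter k next (A, B, C, D).
have Pq k : P (q k).
  elim: k => [|k IH]; last exact: (nextP (q k) IH).1.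
  by rewrite /q /P /=; split; split; rewrite ?lexx.
have Qq k : Q (q k) (q k.+1) by have [] := nextP _ (Pq k).
pose a k := (q k).1.1.1; pose b k := (q k).1.1.2; pose c k := (q k).1.2; pose d k := (q k).2.
have qE k : q k = (a k, b k, c k, d k) by rewrite /a /b /c /d; case: (q k) => [[[]]].
have Pk k : [/\ A <= a k, a k <= b k & b k <= B] /\ [/\ C <= c k, c k <= d k & d k <= D].
  by have := Pq k; rewrite qE.
have Qk k : [/\ a k <= a k.+1, b k.+1 <= b k, c k <= c k.+1 & d k.+1 <= d k] /\
  [/\ b k.+1 - a k.+1 = (b k - a k) / 2, d k.+1 - c k.+1 = (d k - c k) / 2 & N (q k) <= 4 * N (q k.+1)].
  by have := Qq k; rewrite /Q {1}(qE k) {1}(qE k.+1).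
have [x xab] : exists x, forall n, a n <= x <= b n.
  apply: nested_intervals.
  - by apply/nondecreasing_seqP => n; have [[]] := Qk n.
  - by apply/nonincreasing_seqP => n; have [[]] := Qk n.
  - by move=> n; have [[]] := Pk n.
have [y ycd] : exists x, forall n, c n <= x <= d n.
  apply: nested_intervals.
  - by apply/nondecreasing_seqP => n; have [[]] := Qk n.
  - by apply/nonincreasing_seqP => n; have [[]] := Qk n.
  - by move=> n; have [_ []] := Pk n.
have ab2 k : b k - a k = (B - A) / 2 ^+ k.
  elim: k => [|k IH]; first by rewrite expr0 divr1.
  by have [_ [-> _ _]] := Qk k; rewrite IH exprSr invfM mulrA.
have cd2 k : d k - c k = (D - C) / 2 ^+ k.
  elim: k => [|k IH]; first by rewrite expr0 divr1.
  by have [_ [_ -> _]] := Qk k; rewrite IH exprSr invfM mulrA.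
have N4 k : normc (J A B C D) <= 4 ^+ k * N (q k).
  elim: k => [|k IH]; first by rewrite expr0 mul1r.
  apply: le_trans IH _; rewrite exprSr -mulrA ler_wpM2l ?exprn_ge0//.
  by have [_ []] := Qk k.
apply/eqP; rewrite -normc_eq0; apply/negP => /negP J0.
have eta0 : 0 < normc (J A B C D) by rewrite lt_neqAle eq_sym J0 normc_ge0.
set eta := normc _ in eta0 N4.
pose L := (B - A) + (D - C).
have L0 : 0 <= L by rewrite addr_ge0// subr_ge0.
(* This makes [e * L ^+ 2] smaller than [eta]; the summand 1 covers a degenerate rectangle with
   [L = 0]. *)
pose e := eta / (2 * (L ^+ 2 + 1)).
have L1 : 0 < L ^+ 2 + 1 by rewrite ltr_wpDl ?sqr_ge0.
have e0 : 0 < e by rewrite divr_gt0// mulr_gt0.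
have Ax : A <= x <= B by have := xab 0%N.
have Cy : C <= y <= D by have := ycd 0%N.
have [r r0 Hr] := Jloc x y Ax Cy e e0.
have [k kr] := expr2_bound L0 r0.
have p2 : 0 < (2 ^+ k : R) by rewrite exprn_gt0.
have := Hr (a k) (b k) (c k) (d k).
have [[Aa _ bB] [Cc _ dD]] := Pk k.
have /andP[ax xb] := xab k; have /andP[cy yd] := ycd k.
move=> /(_ Aa ax xb bB Cc cy yd dD).
have : b k - a k < r.
  rewrite ab2; apply: le_lt_trans kr; rewrite ler_pM2r ?invr_gt0// /L lerDl subr_ge0//.
move=> h1 /(_ h1).
have : d k - c k < r.
  rewrite cd2; apply: le_lt_trans kr; rewrite ler_pM2r ?invr_gt0// /L lerDr subr_ge0//.
move=> h2 /(_ h2).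
rewrite ab2 cd2 -mulrDl -/L => h3.
have := N4 k; rewrite qE /N => h4.
have : eta <= 4 ^+ k * (e * (L / 2 ^+ k) ^+ 2).
  by apply: le_trans h4 _; rewrite ler_wpM2l ?exprn_ge0.
have -> : (4 : R) ^+ k = (2 ^+ k) ^+ 2.
  by rewrite -exprM mulnC exprM; congr (_ ^+ _); rewrite expr2; ring.
have -> : (2 ^+ k) ^+ 2 * (e * (L / 2 ^+ k) ^+ 2) = e * L ^+ 2.
  by field; rewrite gt_eqF.
rewrite /e mulrAC ler_pdivlMr ?mulr_gt0// leNgt => /negP; apply.
by rewrite ltr_pM2l//; have := sqr_ge0 L; lra.
Qed.

Lemma complexBE (x y u v : R) : (x +i* y) - (u +i* v) = (x - u) +i* (y - v).
Proof. by []. Qed.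

Lemma normc_complex_le (x y : R) : normc (x +i* y) <= `|x| + `|y|.
Proof. exact: (normc_le_ReIm (x +i* y)). Qed.

Definition chol H x y := exists l, cderiv H (x +i* y) l.

Lemma chol_ccontx H x y : chol H x y -> ccont (fun t => H (t +i* y)) x.
Proof.
move=> [l Hl] e e0; have [r r0 Hr] := cderiv_cont Hl e0.
exists r => // u ur; have := Hr (u +i* 0).
by rewrite normcR => /(_ ur); rewrite /GRing.add /= addr0.
Qed.

Lemma chol_cconty H x y : chol H x y -> ccont (fun t => H (x +i* t)) y.
Proof.
move=> [l Hl] e e0; have [r r0 Hr] := cderiv_cont Hl e0.
exists r => // u ur; have := Hr (0 +i* u).
have -> : normc (0 +i* u) = `|u| by rewrite /= expr0n add0r sqrtr_sqr.
by move=> /(_ ur); rewrite /GRing.add /= addr0.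
Qed.

(* The contour integral of [H] over the boundary of [a, b] x [c, d]. *)
Definition rectI H a b c d : R[i] :=
  cint a b (fun x => H (x +i* c) - H (x +i* d)) +
  'i * cint c d (fun y => H (b +i* y) - H (a +i* y)).

(** Continuity is asked along horizontal and vertical lines separately, since the integrals over the
    sides of rectangles see only these. *)
Definition ccontR H A B C D := (forall x y, A <= x <= B -> C <= y <= D ->
   ccont (fun t => H (t +i* y)) x /\ ccont (fun t => H (x +i* t)) y).

Lemma ccontR_x H A B C D y : C <= y <= D -> ccontR H A B C D ->
  ccontI A B (fun t => H (t +i* y)).
Proof. by move=> yD cR x xA; have [] := cR x y xA yD. Qed.

Lemma ccontR_y H A B C D x : A <= x <= B -> ccontR H A B C D ->
  ccontI C D (fun t => H (x +i* t)).
Proof. by move=> xA cR y yD; have [] := cR x y xA yD. Qed.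

Lemma ccontR_sub H A B C D a b c d : A <= a -> b <= B -> C <= c -> d <= D ->
  ccontR H A B C D -> ccontR H a b c d.
Proof.
move=> Aa bB Cc dD cR x y /andP[ax xb] /andP[cy yd]; apply: cR.
  by rewrite (le_trans Aa)// (le_trans xb).
by rewrite (le_trans Cc)// (le_trans yd).
Qed.

Lemma rectI_splitx H a m b c d : a <= m -> m <= b -> c <= d -> ccontR H a b c d ->
  rectI H a b c d = rectI H a m c d + rectI H m b c d.
Proof.
move=> am mb cd cR.
have ab := le_trans am mb.
rewrite /rectI (cint_split am mb); last first.
  by apply: ccontIB; apply: (ccontR_x _ cR); rewrite lexx ?cd.
rewrite addrACA; congr (_ + _).
have ya : ccontI c d (fun t => H (a +i* t)) by apply: (ccontR_y _ cR); rewrite ?lexx ?ab ?am ?mb.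
have yb : ccontI c d (fun t => H (b +i* t)) by apply: (ccontR_y _ cR); rewrite ?lexx ?ab ?am ?mb.
have ym : ccontI c d (fun t => H (m +i* t)) by apply: (ccontR_y _ cR); rewrite ?lexx ?ab ?am ?mb.
by rewrite !cintB//; ring.
Qed.

Lemma rectI_splity H a b c m d : a <= b -> c <= m -> m <= d -> ccontR H a b c d ->
  rectI H a b c d = rectI H a b c m + rectI H a b m d.
Proof.
move=> ab cm md cR.
have cd := le_trans cm md.
rewrite /rectI (cint_split cm md); last first.
  by apply: ccontIB; apply: (ccontR_y _ cR); rewrite lexx ?ab.
rewrite mulrDr addrACA; congr (_ + _).
have yc : ccontI a b (fun t => H (t +i* c)) by apply: (ccontR_x _ cR); rewrite ?lexx ?cd ?cm ?md.
have yd : ccontI a b (fun t => H (t +i* d)) by apply: (ccontR_x _ cR); rewrite ?lexx ?cd ?cm ?md.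
have ym : ccontI a b (fun t => H (t +i* m)) by apply: (ccontR_x _ cR); rewrite ?lexx ?cd ?cm ?md.
by rewrite !cintB//; ring.
Qed.

Lemma chol_ccontR H a b c d :
  (forall x y, a <= x <= b -> c <= y <= d -> chol H x y) -> ccontR H a b c d.
Proof. by move=> h x y xa yc; have := h x y xa yc; split; [exact: chol_ccontx|exact: chol_cconty]. Qed.

Lemma rectI_le H a b c d M : a <= b -> c <= d -> ccontR H a b c d ->
  (forall x y, a <= x <= b -> c <= y <= d -> normc (H (x +i* y)) <= M) ->
  normc (rectI H a b c d) <= 4 * M * ((b - a) + (d - c)).
Proof.
move=> ab cd cR HM.
have n1 : normc ('i%C : R[i]) = 1 by rewrite /= expr0n expr1n add0r sqrtr1.
apply: le_trans (le_normcD _ _) _; rewrite normcM n1 mul1r mulrDr.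
rewrite (_ : 4 * M = 2 * (M + M)); last by ring.
apply: lerD; apply: normc_cint => //.
- by apply: ccontIB; apply: (ccontR_x _ cR); rewrite lexx ?cd.
- by move=> x xa; apply: le_trans (le_normcB _ _) _; apply: lerD; apply: HM; rewrite ?lexx ?cd.
- by apply: ccontIB; apply: (ccontR_y _ cR); rewrite lexx ?ab.
- by move=> y yc; apply: le_trans (le_normcB _ _) _; apply: lerD; apply: HM; rewrite ?lexx ?ab.
Qed.

Lemma goursat H A B C D : A <= B -> C <= D ->
  (forall x y, A <= x <= B -> C <= y <= D -> chol H x y) -> rectI H A B C D = 0.
Proof.
move=> AB CD h; have cR := chol_ccontR h.
apply: (@rect_additive_eq0 (rectI H)) => //.
- move=> a m b c d Aa am mb bB Cc cd dD; apply: rectI_splitx => //.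
  exact: ccontR_sub cR.
- move=> a b c m d Aa ab bB Cc cm md dD; apply: rectI_splity => //.
  exact: ccontR_sub cR.
move=> x0 y0 xA yC e e0; have [l Hl] := h _ _ xA yC.
(* The factor 4 is lost as 2 for the pair of opposite sides and 2 in [cint_near_cst]. *)
have e4 : 0 < e / 4 by rewrite divr_gt0.
have [r r0 Hr] := Hl _ e4.
exists (r / 2) => [|a b c d Aa ax xb bB Cc cy yd dD bar dcr]; first by rewrite divr_gt0.
have ab := le_trans ax xb; have cd := le_trans cy yd.
pose s := (b - a) + (d - c).
have est x y : a <= x <= b -> c <= y <= d ->
    normc (H (x +i* y) - H (x0 +i* y0) - l * ((x +i* y) - (x0 +i* y0))) <= e / 4 * s.
  move=> xab ycd.
  have ns : normc ((x +i* y) - (x0 +i* y0)) <= s.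
    rewrite complexBE; apply: le_trans (normc_complex_le _ _) _; rewrite /s.
    by apply: lerD; rewrite ler_norml; lra.
  have nr : normc ((x +i* y) - (x0 +i* y0)) < r.
    by apply: le_lt_trans ns _; rewrite /s; lra.
  have := Hr _ nr; rewrite subrKC => /le_trans; apply.
  by rewrite ler_wpM2l// ltW.
(* For the affine approximation of [H] the difference between opposite sides is constant, namely
   [k1] or [k2]; the two contributions to the contour integral cancel, so only the remainders are
   left. *)
pose k1 := l * (0 +i* (c - d)); pose k2 := l * (b - a)%:C.
have I1 : normc (cint a b (fun x => H (x +i* c) - H (x +i* d)) - k1 * (b - a)%:C) <=
   2 * (e / 4 * s + e / 4 * s) * (b - a).
  apply: cint_near_cst => //.
    have cR' := ccontR_sub Aa bB Cc dD cR.
    by apply: ccontIB; apply: (ccontR_x _ cR'); rewrite lexx ?cd.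
  move=> x xab.
  have -> : H (x +i* c) - H (x +i* d) - k1 =
    (H (x +i* c) - H (x0 +i* y0) - l * ((x +i* c) - (x0 +i* y0))) -
    (H (x +i* d) - H (x0 +i* y0) - l * ((x +i* d) - (x0 +i* y0))).
    rewrite /k1 (_ : 0 +i* (c - d) = (x +i* c) - (x +i* d)); last by rewrite complexBE subrr.
    by ring.
  by apply: le_trans (le_normcB _ _) _; apply: lerD; apply: est; rewrite ?lexx ?cd.
have I2 : normc (cint c d (fun y => H (b +i* y) - H (a +i* y)) - k2 * (d - c)%:C) <=
   2 * (e / 4 * s + e / 4 * s) * (d - c).
  apply: cint_near_cst => //.
    have cR' := ccontR_sub Aa bB Cc dD cR.
    by apply: ccontIB; apply: (ccontR_y _ cR'); rewrite lexx ?ab.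
  move=> y ycd.
  have -> : H (b +i* y) - H (a +i* y) - k2 =
    (H (b +i* y) - H (x0 +i* y0) - l * ((b +i* y) - (x0 +i* y0))) -
    (H (a +i* y) - H (x0 +i* y0) - l * ((a +i* y) - (x0 +i* y0))).
    rewrite /k2 (_ : (b - a)%:C = (b +i* y) - (a +i* y)); last by rewrite complexBE subrr.
    by ring.
  by apply: le_trans (le_normcB _ _) _; apply: lerD; apply: est; rewrite ?lexx ?ab.
have n1 : normc ('i%C : R[i]) = 1 by rewrite /= expr0n expr1n add0r sqrtr1.
have kE : k1 * (b - a)%:C + 'i * (k2 * (d - c)%:C) = 0.
  have -> : k1 = - ('i * l * (d - c)%:C).
    rewrite /k1 -mulrA mulrCA -mulrN; congr (_ * _).
    by apply/eqP; rewrite eq_complex /=; apply/andP; split; apply/eqP; ring.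
  by rewrite /k2; ring.
rewrite -[rectI _ _ _ _ _]subr0 -kE /rectI.
rewrite opprD addrACA -mulrBr.
apply: le_trans (le_normcD _ _) _; rewrite normcM n1 mul1r.
apply: le_trans (lerD I1 I2) _.
by rewrite -/s le_eqVlt; apply/orP; left; apply/eqP; rewrite /s; field.
Qed.

(** Cutting off four rectangles by [goursat] leaves a square of half-side t around the exceptional
    point, whose contour integral is at most 16 K t. The intended exception is the point where a
    difference quotient is known only to be continuous. *)
Lemma goursat_exceptional H A B C D x0 y0 K r : A < x0 < B -> C < y0 < D -> 0 < r ->
  ccontR H A B C D ->
  (forall x y, A <= x <= B -> C <= y <= D -> (x, y) <> (x0, y0) -> chol H x y) ->
  (forall x y, `|x - x0| <= r -> `|y - y0| <= r -> normc (H (x +i* y)) <= K) ->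
  rectI H A B C D = 0.
Proof.
move=> /andP[Ax xB] /andP[Cy yD] r0 cR h HK.
have K0 : 0 <= K.
  by apply: le_trans (HK x0 y0 _ _); rewrite ?normc_ge0 ?subrr ?normr0 ?(ltW r0).
apply/eqP; rewrite -normc_eq0 eq_le normc_ge0 andbT.
apply/ler_addgt0Pl => e e0; rewrite addr0.
have K1 : 0 < 16 * (K + 1) by rewrite mulr_gt0// ltr_wpDl.
pose m := Num.min (Num.min (x0 - A) (B - x0)) (Num.min (y0 - C) (D - y0)).
pose t := Num.min (Num.min m r) (e / (16 * (K + 1))).
have m0 : 0 < m by rewrite !lt_min !subr_gt0 Ax xB Cy.
have t0 : 0 < t by rewrite /t lt_min lt_min m0 r0 divr_gt0.
(* Unfolding only the right-hand [t] turns this triviality into the list of all upper bounds on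
   [t]. *)
have : t <= t by [].
rewrite {2}/t !le_min => /andP[/andP[/andP[/andP[t1 t2] /andP[t3 t4]] t5] t6].
have AB : A <= B by lra.
have CD : C <= D by lra.
rewrite (@rectI_splitx H A (x0 - t) B); [|lra|lra|lra|exact: cR].
rewrite goursat; [|lra|lra|]; last first.
  by move=> x y xA yC; apply: h; [lra|lra|move=> [xE _]; lra].
rewrite add0r (@rectI_splitx H (x0 - t) (x0 + t) B); [|lra|lra|lra|]; last first.
  by apply: ccontR_sub cR; lra.
rewrite [X in _ + X]goursat; [|lra|lra|]; last first.
  by move=> x y xA yC; apply: h; [lra|lra|move=> [xE _]; lra].
rewrite addr0 (@rectI_splity H _ _ C (y0 - t) D); [|lra|lra|lra|]; last first.
  by apply: ccontR_sub cR; lra.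
rewrite goursat; [|lra|lra|]; last first.
  by move=> x y xA yC; apply: h; [lra|lra|move=> [_ yE]; lra].
rewrite add0r (@rectI_splity H _ _ (y0 - t) (y0 + t) D); [|lra|lra|lra|]; last first.
  by apply: ccontR_sub cR; lra.
rewrite [X in _ + X]goursat; [|lra|lra|]; last first.
  by move=> x y xA yC; apply: h; [lra|lra|move=> [_ yE]; lra].
rewrite addr0; apply: le_trans (@rectI_le _ _ _ _ _ K _ _ _ _) _; [lra|lra| | |].
- by apply: ccontR_sub cR; lra.
- by move=> x y xA yC; apply: HK; rewrite ler_norml; lra.
move: t6; rewrite ler_pdivlMr// => t6.
by apply: le_trans t6; nra.
Qed.

End goursat.

(** * The complex exponential and integrals over circles *)

Section complex_exponential.
Variable R : realType.
Implicit Types (f g H : R[i] -> R[i]) (a p z w : R[i]).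

Definition cexp z : R[i] :=
  (expR (Re z) * cos (Im z)) +i* (expR (Re z) * sin (Im z)).

Lemma cexpD z w : cexp (z + w) = cexp z * cexp w.
Proof.
case: z w => [a b] [c d]; apply/eqP; rewrite eq_complex /= expRD cosD sinD.
by apply/andP; split; apply/eqP; ring.
Qed.

Lemma cexp0 : cexp 0 = 1.
Proof. by rewrite /cexp /= expR0 cos0 sin0 mulr1 mulr0. Qed.

Lemma normc_cexp z : normc (cexp z) = expR (Re z).
Proof.
rewrite /cexp /= !exprMn -mulrDr cos2Dsin2 mulr1 sqrtr_sqr.
by rewrite gtr0_norm// expR_gt0.
Qed.

Lemma cexp_neq0 z : cexp z != 0.
Proof. by rewrite -normc_eq0 normc_cexp gt_eqF ?expR_gt0. Qed.

Lemma cexp_periodic (x y : R) : cexp (x +i* (y + pi *+ 2)) = cexp (x +i* y).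
Proof. by rewrite /cexp /= cosD2pi sinD2pi. Qed.

Lemma cderiv_cexp0 : cderiv cexp 0 1.
Proof.
move=> e e0.
(* With [N] the modulus of the increment, the error consists of three terms below [e / 16 * N] and
   of products below [6 * N ^+ 2]; since [N < e / 16], at most nine sixteenths are used. *)
pose e1 := Num.min 1 (e / 16).
have e10 : 0 < e1 by rewrite lt_min ltr01 divr_gt0.
have /rderivP H1 := is_derive_expR (0 : R).
have /rderivP H2 := is_derive_cos (0 : R).
have /rderivP H3 := is_derive_sin (0 : R).
have [r1 r10 {}H1] := H1 _ e10.
have [r2 r20 {}H2] := H2 _ e10.
have [r3 r30 {}H3] := H3 _ e10.
exists (Num.min (Num.min r1 r2) (Num.min r3 e1)).
  by rewrite !lt_min r10 r20 r30 ltr01 divr_gt0.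
case=> u v; set N := normc _.
have uN : `|u| <= N := le_Re_normc (u +i* v).
have vN : `|v| <= N := le_Im_normc (u +i* v).
rewrite !lt_min => /andP[/andP[N1 N2] /andP[N3 /andP[N4 N5]]].
have := H1 u (le_lt_trans uN N1); have := H2 v (le_lt_trans vN N2).
have := H3 v (le_lt_trans vN N3); rewrite !add0r expR0 cos0 sin0 oppr0 mul0r !subr0 !mul1r ?addr0.
move=> {H1 H2 H3} H3 H2 H1.
have e11 : e1 <= 1 by rewrite ge_min lexx.
have e18 : e1 <= e / 16 by rewrite ge_min lexx orbT.
have -> : cexp (u +i* v) - cexp 0 - (u +i* v) =
   ((expR u - 1 - u) + (expR u - 1) * (cos v - 1) + (cos v - 1)) +i*
   ((expR u - 1) * sin v + (sin v - v)).
  apply/eqP; rewrite cexp0 eq_complex /=.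
  by apply/andP; split; apply/eqP; ring.
have N0 : 0 <= N := normc_ge0 _.
have H1' : `|expR u - 1 - u| <= e / 16 * N by apply: le_trans H1 _; rewrite ler_pM// ltW.
have H2' : `|cos v - 1| <= e / 16 * N by apply: le_trans H2 _; rewrite ler_pM// ltW.
have H3' : `|sin v - v| <= e / 16 * N by apply: le_trans H3 _; rewrite ler_pM// ltW.
have E1 : `|expR u - 1| <= 2 * N.
  rewrite -[expR u - 1](subrK u); apply: le_trans (ler_normD _ _) _.
  rewrite mulr_natl mulr2n; apply: lerD => //; apply: le_trans H1 _.
  by rewrite -[leRHS]mul1r ler_pM// ltW.
have E3 : `|sin v| <= 2 * N.
  rewrite -[sin v](subrK v); apply: le_trans (ler_normD _ _) _.
  rewrite mulr_natl mulr2n; apply: lerD => //; apply: le_trans H3 _.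
  by rewrite -[leRHS]mul1r ler_pM// ltW.
have C2 : `|cos v - 1| <= N.
  by apply: le_trans H2 _; rewrite -[leRHS]mul1r ler_pM// ltW.
have NN : N * N <= e / 16 * N by rewrite ler_wpM2r// ltW.
apply: le_trans (normc_complex_le _ _) _.
have T1 : `|(expR u - 1) * (cos v - 1)| <= 2 * (N * N).
  by rewrite normrM mulrA ler_pM.
have T2 : `|(expR u - 1) * sin v| <= 4 * (N * N).
  by rewrite normrM (_ : 4 * (N * N) = 2 * N * (2 * N)); [rewrite ler_pM|ring].
apply: (@le_trans _ _ ((`|expR u - 1 - u| + `|(expR u - 1) * (cos v - 1)| + `|cos v - 1|) +
   (`|(expR u - 1) * sin v| + `|sin v - v|))).
  apply: lerD; last exact: ler_normD.
  by apply: le_trans (ler_normD _ _) _; rewrite lerD2r; exact: ler_normD.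
move: H1' H2' H3' T1 T2 NN; set t1 := `|_ - u|; set t2 := `|_ - 1|.
set t3 := `|_ - v|; set t4 := `|_ * _|; set t5 := `|_ * sin v|.
set NN := N * N; set eN := e / 16 * N => k1 k2 k3 k4 k5 k6.
have -> : e * N = 16 * eN by rewrite /eN; field.
have eN0 : 0 <= eN by rewrite /eN mulr_ge0// divr_ge0// ltW.
lra.
Qed.

Lemma cderiv_cexp p : cderiv cexp p (cexp p).
Proof.
move=> e e0; have n0 : 0 < normc (cexp p) by rewrite normc_gt0 cexp_neq0.
have [r r0 H] := cderiv_cexp0 (divr_gt0 e0 n0).
exists r => // h hr; rewrite cexpD.
have -> : cexp p * cexp h - cexp p - cexp p * h = cexp p * (cexp (0 + h) - cexp 0 - 1 * h).
  by rewrite add0r cexp0; ring.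
rewrite normcM mulrC -ler_pdivlMr// mulrAC; exact: H.
Qed.

(** The arc cosine gives the angle in the upper half plane and its reflection in the lower one. An
    angle strictly between 0 and 2 pi puts the point in the interior of a logarithmic rectangle,
    where [goursat_exceptional] allows an exception. *)
Lemma cexp_polar z : Im z != 0 -> exists rho theta : R,
  0 < theta < pi *+ 2 /\ z = cexp (rho +i* theta).
Proof.
move=> z0; have n0 : 0 < normc z.
  rewrite normc_gt0; apply: contraNneq z0 => ->; exact: eqxx.
pose t := Re z / normc z.
have t1 : -1 <= t <= 1.
  by rewrite -ler_norml normrM normfV (gtr0_norm n0) ler_pdivrMr// mul1r le_Re_normc.
have n2 : normc z ^+ 2 = Re z ^+ 2 + Im z ^+ 2.
  by case: (z) => a b /=; rewrite sqr_sqrtr// addr_ge0// sqr_ge0.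
have st : Num.sqrt (1 - t ^+ 2) = `|Im z| / normc z.
  rewrite (_ : 1 - t ^+ 2 = (Im z / normc z) ^+ 2).
    by rewrite sqrtr_sqr normrM normfV (gtr0_norm n0).
  have -> : (Im z / normc z) ^+ 2 = (normc z ^+ 2 - Re z ^+ 2) / normc z ^+ 2.
    by rewrite n2 expr_div_n n2; congr (_ / _); ring.
  by rewrite /t; field; rewrite gt_eqF.
have at0 : 0 < acos t.
  apply: acos_gt0; move: (t1) => /andP[-> /=]; rewrite le_eqVlt => /orP[/eqP t1'|//].
  move: st; rewrite t1' expr1n subrr sqrtr0 => /esym/eqP.
  by rewrite mulf_eq0 invr_eq0 (gt_eqF n0) orbF normr_eq0 (negbTE z0).
have atp : acos t < pi.
  apply: acos_ltpi; move: (t1) => /andP[+ -> ]; rewrite andbT le_eqVlt => /orP[/eqP t1'|//].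
  move: st; rewrite -t1' sqrrN expr1n subrr sqrtr0 => /esym/eqP.
  by rewrite mulf_eq0 invr_eq0 (gt_eqF n0) orbF normr_eq0 (negbTE z0).
have nK (w : R) : normc z * (w / normc z) = w by rewrite mulrC divfK ?gt_eqF.
have ReE : normc z * t = Re z by rewrite /t nK.
have [i0|i0] := leP 0 (Im z).
  exists (ln (normc z)), (acos t); split.
    by rewrite at0 (lt_trans atp)// mulr2n ltrDl pi_gt0.
  rewrite /cexp /= lnK ?posrE// acosK ?in_itv//= sin_acos// st ger0_norm// ReE nK.
  by case: (z).
exists (ln (normc z)), (pi *+ 2 - acos t); split.
  by rewrite mulr2n; have := pi_gt0 R; lra.
rewrite /cexp /= lnK ?posrE// addrC cosD2pi sinD2pi cosN sinN.
rewrite acosK ?in_itv//= sin_acos// st ltr0_norm// mulNr opprK ReE nK.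
by case: (z).
Qed.

(** The sine of half the difference of the angles vanishes, and this half difference lies strictly
    between -pi and pi. The first angle may be an endpoint, so that the exceptional point has a
    single preimage in a closed rectangle. *)
Lemma cexp_inj (x y x' y' : R) : 0 <= y <= pi *+ 2 -> 0 < y' < pi *+ 2 ->
  cexp (x +i* y) = cexp (x' +i* y') -> x = x' /\ y = y'.
Proof.
move=> y0 y'0 E.
have xE : x = x'.
  by apply: (@expR_inj R); have := congr1 (@normc R) E; rewrite !normc_cexp.
split=> //; move: E; rewrite xE /cexp /= => -[].
move=> /(mulfI (lt0r_neq0 (expR_gt0 _))) c /(mulfI (lt0r_neq0 (expR_gt0 _))) s.
have cd : cos (y - y') = 1 by rewrite cosB c s -!expr2 cos2Dsin2.
pose t := (y - y') / 2.
have : sin t ^+ 2 = 0.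
  have := cos_mulr2n t; rewrite (_ : t *+ 2 = y - y'); last by rewrite /t; field.
  by rewrite cd sin2cos2 mulr2n => ?; lra.
move/eqP; rewrite sqrf_eq0 => /eqP st.
have [t0|t0] := eqVneq t 0; first by move: t0; rewrite /t; lra.
suff : 0 < sin `|t|.
  have [tp|tn] := leP 0 t; first by rewrite ger0_norm// st ltxx.
  by rewrite ltr0_norm// sinN st oppr0 ltxx.
apply: sin_gt0_pi; rewrite normr_gt0 t0 /= ltr_norml /t.
by move: y0 y'0; rewrite mulr2n; lra.
Qed.

Definition zcont f p := forall e : R, 0 < e -> exists2 r : R, 0 < r &
  forall h, normc h < r -> normc (f (p + h) - f p) <= e.

Lemma zcont_comp f g p : zcont g p -> zcont f (g p) -> zcont (f \o g) p.
Proof.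
move=> gp fgp e e0; have [r r0 Hr] := fgp _ e0.
have r2 : 0 < r / 2 by rewrite divr_gt0.
have [s s0 Hs] := gp _ r2; exists s => // h /Hs hs.
have := Hr (g (p + h) - g p); rewrite subrKC; apply.
by apply: le_lt_trans hs _; rewrite ltr_pdivrMr// ltr_pMr// ltr1n.
Qed.

Lemma zcont_x H (x y : R) : zcont H (x +i* y) -> ccont (fun t => H (t +i* y)) x.
Proof.
move=> h e e0; have [r r0 Hr] := h _ e0.
exists r => // u ur; have := Hr (u +i* 0).
by rewrite normcR => /(_ ur); rewrite /GRing.add /= addr0.
Qed.

Lemma zcont_y H (x y : R) : zcont H (x +i* y) -> ccont (fun t => H (x +i* t)) y.
Proof.
move=> h e e0; have [r r0 Hr] := h _ e0.
exists r => // u ur; have := Hr (0 +i* u).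
have -> : normc (0 +i* u) = `|u| by rewrite /= expr0n add0r sqrtr_sqr.
by move=> /(_ ur); rewrite /GRing.add /= addr0.
Qed.

Lemma zcontD f g p : zcont f p -> zcont g p -> zcont (fun z => f z + g z) p.
Proof.
move=> gx hx e e0; have e2 : 0 < e / 2 by rewrite divr_gt0.
have [r1 r10 H1] := gx _ e2; have [r2 r20 H2] := hx _ e2.
exists (Num.min r1 r2); first by rewrite lt_min r10.
move=> u; rewrite lt_min => /andP[u1 u2].
rewrite opprD addrACA (splitr e); apply: le_trans (le_normcD _ _) _.
by apply: lerD; [exact: H1|exact: H2].
Qed.

Lemma zcontZ f a p : zcont f p -> zcont (fun z => a * f z) p.
Proof.
move=> gx e e0; have k0 : 0 < 1 + normc a by rewrite ltr_wpDr ?normc_ge0.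
have [r r0 H] := gx _ (divr_gt0 e0 k0).
exists r => // u /H{}H; rewrite -mulrBr normcM.
apply: le_trans (ler_wpM2l (normc_ge0 _) H) _.
by rewrite mulrA ler_pdivrMr// mulrC ler_wpM2l ?(ltW e0)// lerDr.
Qed.

Lemma zcont_bounded f p : zcont f p -> exists2 r : R, 0 < r &
  forall z, normc (z - p) < r -> normc (f z) <= normc (f p) + 1.
Proof.
move=> /(_ _ ltr01)[r r0 H]; exists r => // z /H; rewrite subrKC => fz.
by rewrite -[f z](subrK (f p)) addrC (le_trans (le_normcD _ _))// lerD2l.
Qed.

(* [rho] is the logarithm of the radius, and the integral is with respect to
   the angle: it is the contour integral of [f z / (i z)]. *)
Definition cI f (rho : R) := cint 0 (pi *+ 2) (fun t => f (cexp (rho +i* t))).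

Lemma pi2_ge0 : 0 <= pi *+ 2 :> R.
Proof. by rewrite mulrn_wge0// pi_ge0. Qed.

Lemma cexp_cc f (rho : R) : (forall z, normc z = expR rho -> zcont f z) ->
  ccontI 0 (pi *+ 2) (fun t => f (cexp (rho +i* t))).
Proof.
move=> H x _; apply: (@zcont_y (f \o cexp)); apply: zcont_comp.
  exact: cderiv_cont (cderiv_cexp _).
by apply: H; rewrite normc_cexp.
Qed.

(** The substitution z = exp w turns an annulus into a rectangle: the horizontal sides cancel by
    periodicity and the vertical ones become the two circles. Cauchy's theorem for circles is
    thereby reduced to rectangles. *)
Lemma rectI_circle f (a b : R) : a <= b ->
  (forall z, expR a <= normc z -> normc z <= expR b -> zcont f z) ->
  rectI (f \o cexp) a b 0 (pi *+ 2) = 'i * (cI f b - cI f a).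
Proof.
move=> ab Hf; rewrite /rectI (@eq_cint _ a b _ (fun=> 0)); last first.
  by move=> x _ /=; rewrite -[pi *+ 2]add0r cexp_periodic subrr.
rewrite cint_cst// mul0r add0r cintB//; apply: cexp_cc => z zE; apply: Hf;
  by rewrite zE ?ler_expR.
Qed.

Lemma mulI_eq0 (z w : R[i]) : 'i * (z - w) = 0 -> z = w.
Proof.
move=> /eqP; rewrite mulf_eq0 => /orP[|]; last by rewrite subr_eq0 => /eqP.
by rewrite eq_complex /= oner_eq0 andbF.
Qed.

Lemma circle_const f (a b : R) : a <= b ->
  (forall z, expR a <= normc z -> normc z <= expR b -> exists l, cderiv f z l) ->
  cI f a = cI f b.
Proof.
move=> ab Hf; apply/esym/mulI_eq0; rewrite -rectI_circle//; last first.
  by move=> z z1 z2; have [l /cderiv_cont] := Hf z z1 z2.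
apply: goursat => //; first exact: pi2_ge0.
move=> x y /andP[ax xb] _.
have [||l Hl] := Hf (cexp (x +i* y)); rewrite ?normc_cexp ?ler_expR//.
by exists (l * cexp (x +i* y)); apply: cderiv_comp => //; exact: cderiv_cexp.
Qed.

Lemma circle_const_exceptional f (a b rho theta : R) : a < rho < b -> 0 < theta < pi *+ 2 ->
  (forall z, expR a <= normc z -> normc z <= expR b -> zcont f z) ->
  (forall z, expR a <= normc z -> normc z <= expR b -> z <> cexp (rho +i* theta) ->
    exists l, cderiv f z l) ->
  cI f a = cI f b.
Proof.
move=> arb t2 fc fd; have ab : a <= b by move: arb; lra.
apply/esym/mulI_eq0; rewrite -rectI_circle//.
have fz0 : zcont (f \o cexp) (rho +i* theta).
  apply: zcont_comp; first exact: cderiv_cont (cderiv_cexp _).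
  by apply: fc; rewrite normc_cexp ler_expR /=; move: arb; lra.
have [r r0 Hr] := zcont_bounded fz0.
apply: (@goursat_exceptional _ _ _ _ _ _ rho theta _ (r / 4)) => //.
- by rewrite divr_gt0.
- move=> x y /andP[ax xb] _.
  suff : zcont (f \o cexp) (x +i* y) by move=> h; split; [exact: zcont_x|exact: zcont_y].
  apply: zcont_comp; first exact: cderiv_cont (cderiv_cexp _).
  by apply: fc; rewrite normc_cexp ler_expR.
- move=> x y /andP[ax xb] y2 xy.
  have [|||l Hl] := fd (cexp (x +i* y)); rewrite ?normc_cexp ?ler_expR//.
    by move=> /(cexp_inj y2 t2)[? ?]; apply: xy; congr pair.
  by exists (l * cexp (x +i* y)); apply: cderiv_comp => //; exact: cderiv_cexp.
- move=> x y xr yr; apply: Hr; rewrite complexBE.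
  apply: le_lt_trans (normc_complex_le _ _) _.
  by apply: le_lt_trans (lerD xr yr) _; lra.
Qed.

End complex_exponential.

(** * Cauchy's formula and Taylor expansion on a disc *)

Section taylor.
Variable R : realType.
Variables (f : R[i] -> R[i]) (R0 : R).
Hypothesis R00 : 0 < R0.
Hypothesis fd : forall z, normc z < R0 -> exists l, cderiv f z l.

Let fc z : normc z < R0 -> zcont f z.
Proof. by move=> /fd[l /cderiv_cont]. Qed.

Lemma expRlnK (r : R) : 0 < r -> expR (ln r) = r.
Proof. by move=> r0; rewrite lnK. Qed.

Let rho0 := ln (R0 / 2).

Let pi2 : 0 < pi *+ 2 :> R.
Proof. by rewrite mulrn_wgt0// pi_gt0. Qed.

(** Cauchy's coefficient integral on the circle of radius [R0 / 2]; [tcoefE] shows that the radius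
    does not matter. *)
Definition tcoef n := ((pi *+ 2)^-1)%:C * cI (fun z => f z * z ^- n) rho0.

Lemma pi2K : ((pi *+ 2)^-1)%:C * (pi *+ 2)%:C = 1 :> R[i].
Proof. by rewrite -rmorphM /= mulVf// gt_eqF. Qed.

Let term_deriv n z : z != 0 -> normc z < R0 -> exists l, cderiv (fun z => f z * z ^- n) z l.
Proof.
move=> z0 /fd[l Hl]; eexists; apply: cderivM Hl _; apply: cderivV; last exact: cderivX.
by rewrite expf_neq0.
Qed.

Let normc_gt0_exp z (a : R) : expR a <= normc z -> z != 0.
Proof. by move=> h; rewrite -normc_gt0 (lt_le_trans _ h)// expR_gt0. Qed.

Lemma tcoefE n rho : expR rho < R0 ->
  cI (fun z => f z * z ^- n) rho = (pi *+ 2)%:C * tcoef n.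
Proof.
move=> rR; rewrite /tcoef mulrA [X in X * _]mulrC pi2K mul1r.
have r0R : expR rho0 < R0 by rewrite /rho0 expRlnK ?divr_gt0// ltr_pdivrMr// ltr_pMr// ltr1n.
have [h|/ltW h] := leP rho rho0.
  by apply: circle_const => // z z1 z2; apply: term_deriv; [exact: normc_gt0_exp z1|exact: le_lt_trans r0R].
by apply/esym/circle_const => // z z1 z2; apply: term_deriv; [exact: normc_gt0_exp z1|exact: le_lt_trans rR].
Qed.

Let circ_cc n rho : expR rho < R0 ->
  ccontI 0 (pi *+ 2) (fun t => f (cexp (rho +i* t)) * cexp (rho +i* t) ^- n).
Proof.
move=> rR; apply: (@cexp_cc _ (fun z => f z * z ^- n)) => z zE.
have z0 : z != 0 by apply: (@normc_gt0_exp _ rho); rewrite zE.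
have zR : normc z < R0 by rewrite zE.
by have [l /cderiv_cont] := term_deriv n z0 zR.
Qed.

Lemma tcoef_bound (r M : R) : 0 < r -> r < R0 ->
  (forall t, 0 <= t <= pi *+ 2 -> normc (f (cexp (ln r +i* t))) <= M) -> prad tcoef r (2 * M).
Proof.
move=> r0 rR fM n.
have eR : expR (ln r) < R0 by rewrite expRlnK.
have -> : tcoef n = ((pi *+ 2)^-1)%:C * cI (fun z => f z * z ^- n) (ln r).
  by rewrite tcoefE// mulrA pi2K mul1r.
rewrite normcM normcR gtr0_norm ?invr_gt0// -mulrA ler_pdivrMl//.
have := @normc_cint _ 0 (pi *+ 2) (fun t => f (cexp (ln r +i* t)) * cexp (ln r +i* t) ^- n) (M / r ^+ n) (ltW pi2) (circ_cc n eR).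
rewrite subr0 => H; rewrite -ler_pdivlMr ?exprn_gt0//.
rewrite (_ : _ / _ = 2 * (M / r ^+ n) * (pi *+ 2)); last by ring.
apply: H => t t2.
rewrite normcM normcV normcX normc_cexp /= expRlnK// ler_wpM2r ?invr_ge0 ?exprn_ge0 ?(ltW r0)//.
exact: fM.
Qed.

Lemma circle_bound (r : R) : 0 < r -> r < R0 -> exists2 M : R, 0 <= M &
  (forall t, 0 <= t <= pi *+ 2 -> normc (f (cexp (ln r +i* t))) <= M).
Proof.
move=> r0 rR; have cc : ccontI 0 (pi *+ 2) (fun t => f (cexp (ln r +i* t))).
  by apply: cexp_cc => z zE; apply: fc; rewrite zE expRlnK.
by have [M M0 H] := ccontI_bounded (ltW pi2) cc; exists M.
Qed.

(** The integral does not change when the radius grows, and the integrand tends to 1 at infinity. *)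
Lemma circle_kernel z0 (rho : R) : normc z0 < expR rho ->
  cI (fun z => z / (z - z0)) rho = (pi *+ 2)%:C.
Proof.
move=> z0r.
have kd z : expR rho <= normc z -> exists l, cderiv (fun z => z / (z - z0)) z l.
  move=> h; eexists; apply: cderivM; first exact: cderiv_id.
  apply: cderivV; last by apply: cderivB; [exact: cderiv_id|exact: cderiv_cst].
  by rewrite subr_eq0; apply: contraTneq h => ->; rewrite -ltNge.
apply/eqP; rewrite -subr_eq0 -normc_eq0 eq_le normc_ge0 andbT.
apply/ler_addgt0Pl => e e0; rewrite addr0.
pose K := 2 * (pi *+ 2) / e.
have K0 : 0 < K by rewrite divr_gt0// mulr_gt0.
(* On the circle of radius [r] the distance to [z0] exceeds [normc z0 * K], so the integrand differs
   from 1 by at most [K^-1]. *)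
pose r := expR rho + normc z0 + normc z0 * K.
have rr : expR rho <= r.
  rewrite /r -addrA lerDl; apply: addr_ge0; first exact: normc_ge0.
  by apply: mulr_ge0; [exact: normc_ge0|exact: ltW].
have r0 : 0 < r := lt_le_trans (expR_gt0 _) rr.
rewrite (@circle_const _ _ rho (ln r)); last 2 first.
  by rewrite -ler_expR expRlnK.
  by move=> z z1 _; exact: kd.
have cc : ccontI 0 (pi *+ 2) (fun t => cexp (ln r +i* t) / (cexp (ln r +i* t) - z0)).
  apply: (@cexp_cc _ (fun z => z / (z - z0))) => z zE.
  have zr : expR rho <= normc z by rewrite zE expRlnK.
  by have [l /cderiv_cont] := kd z zr.
have := @cint_near_cst _ 0 (pi *+ 2) (fun t => cexp (ln r +i* t) / (cexp (ln r +i* t) - z0)) 1 (K^-1) (ltW pi2) cc.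
rewrite mul1r subr0; move=> H; apply: le_trans (H _) _; last first.
  by rewrite /K invf_div mulrAC mulrCA mulfV ?mulr1// gt_eqF// mulr_gt0.
move=> t _; set w := cexp _.
have wr : normc w = r by rewrite normc_cexp /= expRlnK.
have wz : 0 < normc (w - z0).
  by apply: lt_le_trans (lerB_normc _ _); rewrite wr subr_gt0 (lt_le_trans z0r).
have wz0 : w - z0 != 0 by rewrite -normc_gt0.
have -> : w / (w - z0) - 1 = z0 / (w - z0) by field.
rewrite normcM normcV ler_pdivrMr// ler_pdivlMl//.
apply: le_trans (lerB_normc _ _); rewrite wr /r.
by have := expR_ge0 rho; lra.
Qed.

(** The integral of z (f z - f a) / (z - a) over circles about 0 is independent of the radius, [a]
    being a removable singularity, and tends to 0 with the radius because the integrand vanishes at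
    0. The part carrying [f a] is then evaluated by [circle_kernel]. *)
Lemma cauchy_formula (rho' theta rho : R) : 0 < theta < pi *+ 2 -> rho' < rho -> expR rho < R0 ->
  cI (fun z => f z * (z / (z - cexp (rho' +i* theta)))) rho =
  (pi *+ 2)%:C * f (cexp (rho' +i* theta)).
Proof.
move=> t2 rr rR; set a := cexp _.
have na : normc a = expR rho' by rewrite normc_cexp.
have na0 : 0 < normc a by rewrite na expR_gt0.
have aR : normc a < expR rho by rewrite na ltr_expR.
have [l Hl] := fd (lt_trans aR rR).
pose g z := if z == a then l else (f z - f a) / (z - a).
(* This is z (f z - f a) / (z - a), arranged so that only the difference quotient [g] has to be
   extended across [a]. *)
pose Psi z := (f z - f a) + a * g z.
have gc : zcont g a.
  move=> e e0; have [r r0 Hr] := Hl _ e0; exists r => // h hr.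
  rewrite /g eqxx; have [hE|hn] := eqVneq (a + h) a.
    by rewrite subrr (normc0 R) ltW.
  have h0 : h != 0 by apply: contraNneq hn => ->; rewrite addr0.
  have -> : (f (a + h) - f a) / (a + h - a) - l = (f (a + h) - f a - l * h) / h.
    have -> : a + h - a = h by ring.
    by field.
  by rewrite normcM normcV ler_pdivrMr ?normc_gt0//; exact: Hr.
have gd z : normc z < R0 -> z <> a -> exists k, cderiv g z k.
  move=> zR za; have [k Hk] := fd zR.
  have za0 : z - a != 0 by rewrite subr_eq0; apply/eqP.
  eexists; apply: (@cderiv_near _ (fun z => (f z - f a) / (z - a)) g z _ (normc (z - a))).
  - by rewrite normc_gt0.
  - move=> h hz; rewrite /g; case: eqP => // zh.
    by move: hz; rewrite -zh opprD addrA subrr add0r normcN ltxx.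
  - apply: cderivM; first by apply: cderivB; [exact: Hk|exact: cderiv_cst].
    apply: cderivV => //; apply: cderivB; [exact: cderiv_id|exact: cderiv_cst].
have gcont z : normc z < R0 -> zcont g z.
  move=> zR; have [->//|/eqP za] := eqVneq z a.
  by have [k /cderiv_cont] := gd z zR za.
have Pc z : normc z < R0 -> zcont Psi z.
  move=> zR; apply: zcontD; last by apply: zcontZ; exact: gcont.
  by apply: zcontD; [exact: fc|exact: cderiv_cont (cderiv_cst _ _)].
have Pd z : normc z < R0 -> z <> a -> exists k, cderiv Psi z k.
  move=> zR za; have [k Hk] := fd zR; have [k' Hk'] := gd z zR za; eexists.
  apply: cderivD; first by apply: cderivB; [exact: Hk|exact: cderiv_cst].
  by apply: cderivM; [exact: cderiv_cst|exact: Hk'].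
have PE z : z <> a -> Psi z = f z * (z / (z - a)) - f a * (z / (z - a)).
  move=> za; have za0 : z - a != 0 by rewrite subr_eq0; apply/eqP.
  by rewrite /Psi /g; case: eqP => // _; field.
have P0 : cI Psi rho = 0.
  apply/eqP; rewrite -normc_eq0 eq_le normc_ge0 andbT.
  apply/ler_addgt0Pl => e e0; rewrite addr0.
  have n0R : normc (0 : R[i]) < R0 by rewrite (normc0 R).
  have [r r0 Hr] := zcont_bounded (Pc 0 n0R).
  have Pc0 := Pc 0 n0R.
  have P00 : Psi 0 = 0.
    by rewrite PE ?mul0r ?mulr0 ?subrr// => a0; move: na0; rewrite -a0 (normc0 R) ltxx.
  have e4 : 0 < e / (2 * (pi *+ 2)) by rewrite divr_gt0// mulr_gt0.
  have [s s0 Hs] := Pc0 _ e4.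
  pose q := Num.min (s / 2) (normc a / 2).
  have q0 : 0 < q by rewrite lt_min !divr_gt0.
  have qs : q < s by rewrite /q gt_min ltr_pdivrMr// ltr_pMr// ltr1n.
  have qa : q < normc a by rewrite /q gt_min orbC ltr_pdivrMr// ltr_pMr// ltr1n.
  rewrite -(@circle_const_exceptional _ Psi (ln q) rho rho' theta) => //; last 3 first.
  - by rewrite rr andbT -ltr_expR expRlnK// -na.
  - by move=> z _ zr; apply: Pc; exact: le_lt_trans rR.
  - by move=> z _ zr za; apply: Pd => //; exact: le_lt_trans rR.
  apply: le_trans (@normc_cint _ _ _ _ (e / (2 * (pi *+ 2))) (ltW pi2) _ _) _.
  - apply: cexp_cc => z; rewrite expRlnK// => zq; apply: Pc; rewrite zq.
    exact: lt_trans qa (lt_trans aR rR).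
  - move=> t _; have := Hs (cexp (ln q +i* t)); rewrite add0r P00 subr0; apply.
    by rewrite normc_cexp /= expRlnK.
  - have key (P : R) : P != 0 -> 2 * (e / (2 * P)) * P = e by move=> ?; field.
    by rewrite subr0 key// gt_eqF.
have kc z : normc z = expR rho -> zcont (fun z => z / (z - a)) z.
  move=> zE; apply: cderiv_cont; apply: cderivM; first exact: cderiv_id.
  apply: cderivV; last by apply: cderivB; [exact: cderiv_id|exact: cderiv_cst].
  by rewrite subr_eq0; apply: contraTneq aR => <-; rewrite zE ltxx.
have fkc z : normc z = expR rho -> zcont (fun z => f z * (z / (z - a))) z.
  move=> zE; have zR : normc z < R0 by rewrite zE.
  have [k Hk] := fd zR; apply: cderiv_cont; apply: cderivM; first exact: Hk.
  apply: cderivM; first exact: cderiv_id.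
  apply: cderivV; last by apply: cderivB; [exact: cderiv_id|exact: cderiv_cst].
  by rewrite subr_eq0; apply: contraTneq aR => <-; rewrite zE ltxx.
rewrite -(circle_kernel aR) [RHS]mulrC /cI -cintZ; last exact: (@cexp_cc _ (fun z => z / (z - a))).
apply/eqP; rewrite -subr_eq0 -cintB.
- rewrite -P0; apply/eqP; apply: eq_cint => t _; rewrite PE//.
  by move=> E; move: aR; rewrite -E normc_cexp ltxx.
- exact: (@cexp_cc _ (fun z => f z * (z / (z - a)))).
- by apply: ccontIZ; exact: (@cexp_cc _ (fun z => z / (z - a))).
Qed.

Lemma geometric_small (q K e : R) : 0 <= q -> q < 1 -> 0 <= K -> 0 < e ->
  exists N, forall n, (N <= n)%N -> K * q ^+ n <= e.
Proof.
move=> q0 q1 K0 e0; have q1' : 0 < 1 - q by rewrite subr_gt0.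
pose N := Num.bound (K / (1 - q) / e).
have x0 : 0 <= K / (1 - q) / e by rewrite !divr_ge0 ?(ltW e0) ?(ltW q1').
have NP : K / (1 - q) / e < N%:R := archi_boundP x0.
exists N.+1 => n Nn.
have n0 : 0 < n%:R :> R by rewrite ltr0n (leq_trans _ Nn).
have h := geometric_n_le n q0 q1.
apply: (@le_trans _ _ (K * ((1 - q)^-1 / n%:R))).
  by rewrite ler_wpM2l// ler_pdivlMr// mulrC.
rewrite mulrA ler_pdivrMr// [leRHS]mulrC -ler_pdivrMr//.
by apply: le_trans (ltW NP) _; rewrite ler_nat ltnW.
Qed.

Lemma geometric_kernel (z a : R[i]) n : z != 0 -> z - a != 0 ->
  z / (z - a) = \sum_(0 <= i < n) a ^+ i * z ^- i + (a / z) ^+ n * (z / (z - a)).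
Proof.
move=> z0 za; elim: n => [|n IH]; first by rewrite big_nil expr0; ring.
rewrite {1}IH big_nat_recr//= -addrA; congr (_ + _).
rewrite exprS -exprVn -exprMn; field.
by rewrite za z0.
Qed.

(** The geometric expansion of the kernel is inserted in Cauchy's formula on a circle of radius [r]
    strictly between the point and [R0]; the remainder decays like (|a| / r)^n uniformly on that
    circle. *)
Lemma taylor_cexp (rho' theta : R) : 0 < theta < pi *+ 2 -> expR rho' < R0 ->
  f (cexp (rho' +i* theta)) = pser tcoef (cexp (rho' +i* theta)).
Proof.
move=> t2 rR; pose r := (expR rho' + R0) / 2.
have r0 : 0 < r by rewrite /r divr_gt0// addr_gt0// expR_gt0.
have er : expR rho' < r by rewrite /r; lra.
have rR0 : r < R0 by rewrite /r; lra.
have [M M0 HM] := circle_bound r0 rR0.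
have elr : expR (ln r) = r by rewrite expRlnK.
have rl : rho' < ln r by rewrite -ltr_expR elr.
have cf := @cauchy_formula rho' theta (ln r) t2 rl (_ : expR (ln r) < R0).
rewrite elr in cf; have {}cf := cf rR0.
set a := cexp _ in cf *.
have na : normc a = expR rho' by rewrite normc_cexp.
have pr := tcoef_bound r0 rR0 HM.
have bs := bsum_pser r0 pr (lexx (normc a)) (_ : normc a < r).
apply: csum_unique (bs _) _; first by rewrite na.
move=> e e0.
pose q := normc a / r.
have q0 : 0 <= q by rewrite divr_ge0 ?normc_ge0 ?(ltW r0).
have q1 : q < 1 by rewrite ltr_pdivrMr// mul1r na.
have ra : 0 < r - normc a by rewrite subr_gt0 na.
have K0 : 0 <= 2 * (M * (r / (r - normc a))) := mulr_ge0 (ler0n _ 2) (mulr_ge0 M0 (divr_ge0 (ltW r0) (ltW ra))).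
have [N HN] := geometric_small q0 q1 K0 e0.
exists N => n /HN; apply: le_trans.
have eR : expR (ln r) < R0 by rewrite elr.
have ci i : ccontI 0 (pi *+ 2) (fun t => a ^+ i * (f (cexp (ln r +i* t)) * cexp (ln r +i* t) ^- i)).
  by apply: ccontIZ; exact: circ_cc.
have [sE sC] := cint_sum n ci.
have fa i : tcoef i * a ^+ i = ((pi *+ 2)^-1)%:C *
   cint 0 (pi *+ 2) (fun t => a ^+ i * (f (cexp (ln r +i* t)) * cexp (ln r +i* t) ^- i)).
  rewrite cintZ; last exact: circ_cc.
  have := tcoefE i eR; rewrite /cI => ->.
  by rewrite [RHS]mulrCA [in RHS](mulrA _ (pi *+ 2)%:C) pi2K mul1r mulrC.
have fE : f a = ((pi *+ 2)^-1)%:C * cI (fun z => f z * (z / (z - a))) (ln r).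
  by rewrite cf mulrA pi2K mul1r.
under eq_bigr do rewrite fa.
rewrite -mulr_sumr -sE fE -mulrBr.
have wn t : normc (cexp (ln r +i* t)) = r by rewrite normc_cexp.
have w0 t : cexp (ln r +i* t) != 0 by exact: cexp_neq0.
have wa t : cexp (ln r +i* t) - a != 0.
  rewrite subr_eq0; apply: contraTneq er => E.
  by rewrite -na -E wn ltxx.
have fkc : ccontI 0 (pi *+ 2) (fun t => f (cexp (ln r +i* t)) * (cexp (ln r +i* t) / (cexp (ln r +i* t) - a))).
  apply: (@cexp_cc _ (fun z => f z * (z / (z - a)))) => z zE.
  have zR : normc z < R0 by rewrite zE.
  have [k Hk] := fd zR; apply: cderiv_cont; apply: cderivM; first exact: Hk.
  apply: cderivM; first exact: cderiv_id.
  apply: cderivV; last by apply: cderivB; [exact: cderiv_id|exact: cderiv_cst].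
  by rewrite subr_eq0; apply: contraTneq er => za; rewrite -na -za zE elr ltxx.
rewrite /cI -cintB// normcM normcR gtr0_norm ?invr_gt0// ler_pdivrMl//.
have := @normc_cint _ 0 (pi *+ 2) _ (M * (r / (r - normc a)) * q ^+ n) (ltW pi2) (ccontIB fkc sC).
rewrite subr0 => H.
rewrite [leRHS](_ : _ = 2 * (M * (r / (r - normc a)) * q ^+ n) * (pi *+ 2)); last by ring.
apply: H => t t02.
rewrite (geometric_kernel n (w0 t) (wa t)).
have := HM t t02; have := wn t; have := w0 t; have := wa t.
move: (cexp (ln r +i* t)) => w wa' w0' wn' HMw.
have -> : f w * (\sum_(0 <= i < n) a ^+ i * w ^- i + (a / w) ^+ n * (w / (w - a))) -
   \sum_(0 <= i < n) a ^+ i * (f w * w ^- i) = f w * ((a / w) ^+ n * (w / (w - a))).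
  rewrite mulrDr addrAC mulr_sumr -sumrB big1 ?add0r// => i _; ring.
rewrite !normcM normcX normcM !normcV wn'.
rewrite -/q -mulrA; apply: ler_pM; [exact: normc_ge0| |exact: HMw|].
  apply: mulr_ge0; first exact: exprn_ge0.
  by apply: mulr_ge0; [exact: ltW|rewrite invr_ge0 normc_ge0].
rewrite mulrC ler_wpM2r ?exprn_ge0// ler_wpM2l ?(ltW r0)//.
rewrite lef_pV2 ?posrE ?normc_gt0//.
by apply: le_trans (lerB_normc _ _); rewrite wn'.
Qed.

Lemma taylor : exists c : nat -> R[i],
  [/\ forall z, normc z < R0 -> f z = pser c z,
  forall r M, 0 < r -> r < R0 -> (forall z, normc z = r -> normc (f z) <= M) ->
    prad c r (2 * M) &
  forall r, 0 < r -> r < R0 -> exists K, prad c r K].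
Proof.
exists tcoef; split; last 2 first.
- move=> r M r0 rR H; apply: tcoef_bound => // t _; apply: H.
  by rewrite normc_cexp /= expRlnK.
- move=> r r0 rR; have [M _ HM] := circle_bound r0 rR.
  by exists (2 * M); exact: tcoef_bound.
have im z : Im z != 0 -> normc z < R0 -> f z = pser tcoef z.
  move=> /cexp_polar[x [y [y2 ->]]] zR; apply: taylor_cexp => //.
  by move: zR; rewrite normc_cexp.
move=> z zR.
pose r := (normc z + R0) / 2.
have n0 := normc_ge0 z.
have r0 : 0 < r by rewrite /r; lra.
have zr : normc z < r by rewrite /r; lra.
have rR0 : r < R0 by rewrite /r; lra.
have [M M0 HM] := circle_bound r0 rR0.
have pr := tcoef_bound r0 rR0 HM.
have [|zi] := eqVneq (Im z) 0; last exact: im.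
move=> zi.
(* [cexp_polar] supplies only non-real points; a real [z] is approached by z + i t, both sides being
   continuous. *)
have pc : zcont (pser tcoef) z := cderiv_cont (cderiv_pser pr zr).
have Dc : zcont (fun w => f w + (-1) * pser tcoef w) z.
  by apply: zcontD; [exact: fc|exact: zcontZ].
apply/eqP; rewrite -subr_eq0 -normc_eq0 eq_le normc_ge0 andbT.
apply/ler_addgt0Pl => e e0; rewrite addr0.
have [s s0 Hs] := Dc _ e0.
pose t := Num.min s (R0 - normc z) / 2.
have t0 : 0 < t by rewrite divr_gt0// lt_min s0 subr_gt0.
have : t < Num.min s (R0 - normc z).
  by rewrite /t ltr_pdivrMr// ltr_pMr ?ltr1n// lt_min s0 subr_gt0.
rewrite lt_min => /andP[ts tR].
have nt : normc (0 +i* t) = t by rewrite /= expr0n add0r sqrtr_sqr gtr0_norm.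
have := Hs (0 +i* t); rewrite nt => /(_ ts).
have zt : normc (z + (0 +i* t)) < R0.
  by apply: le_lt_trans (le_normcD _ _) _; rewrite nt -ltrBrDl.
rewrite im//; last first.
  by rewrite cImD zi add0r /= gt_eqF.
by rewrite !mulN1r (subrr (pser tcoef _)) sub0r normcN.
Qed.

End taylor.

(** * Entire functions of exponential type *)

Section entire_series.
Variable R : realType.
Implicit Types (c d : nat -> R[i]) (f : R[i] -> R[i]) (z : R[i]).

Lemma normc_nat n : normc (n%:R : R[i]) = n%:R :> R.
Proof. by rewrite -(rmorph_nat (real_complex R)) normcR normr_nat. Qed.

Lemma bsum_pser_lt c (r K : R) z : prad c r K -> normc z < r ->
  exists L, bsum (fun n => c n * z ^+ n) L.
Proof.
move=> cK zr; have r0 : 0 < r := le_lt_trans (normc_ge0 _) zr.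
by eexists; exact: bsum_pser r0 cK (lexx _) zr.
Qed.

Lemma pserB c d (r K L : R) z : prad c r K -> prad d r L -> normc z < r ->
  pser (fun n => c n - d n) z = pser c z - pser d z.
Proof.
move=> cK dL zr; have [M1 b1] := bsum_pser_lt cK zr; have [M2 b2] := bsum_pser_lt dL zr.
by rewrite -(csumB b1 b2); congr csum; apply/funext => n; rewrite mulrBl.
Qed.

Lemma pserD c d (r K L : R) z : prad c r K -> prad d r L -> normc z < r ->
  pser (fun n => c n + d n) z = pser c z + pser d z.
Proof.
move=> cK dL zr; have [M1 b1] := bsum_pser_lt cK zr; have [M2 b2] := bsum_pser_lt dL zr.
by rewrite -(csumD b1 b2); congr csum; apply/funext => n; rewrite mulrDl.
Qed.

Lemma pserZ c (r K : R) a z : prad c r K -> normc z < r ->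
  pser (fun n => a * c n) z = a * pser c z.
Proof.
move=> cK zr; have [M1 b1] := bsum_pser_lt cK zr.
by rewrite -(csumZ a b1); congr csum; apply/funext => n; rewrite mulrA.
Qed.

Lemma pradZ c (r K : R) a : prad c r K -> prad (fun n => a * c n) r (normc a * K).
Proof. by move=> cK n; rewrite normcM -mulrA ler_wpM2l ?normc_ge0. Qed.

Lemma pradB c d (r K L : R) : 0 <= r -> prad c r K -> prad d r L ->
  prad (fun n => c n - d n) r (K + L).
Proof.
move=> r0 cK dL n; apply: le_trans (lerD (cK n) (dL n)); rewrite -mulrDl.
by rewrite ler_wpM2r ?exprn_ge0// le_normcB.
Qed.

Lemma pser_inj c d (r K L r0 : R) : 0 < r -> 0 < r0 -> prad c r K -> prad d r L ->
  (forall x : R, 0 < x -> x < r0 -> pser c x%:C = pser d x%:C) -> forall n, c n = d n.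
Proof.
move=> rr r00 cK dL cd n; apply/eqP; rewrite -subr_eq0; apply/eqP.
apply: (@pser_eq0 _ (fun n => c n - d n) r (K + L) (Num.min r r0)) => //.
- by rewrite lt_min rr.
- exact: pradB (ltW rr) cK dL.
move=> x x0; rewrite lt_min => /andP[xr xr0].
by rewrite (pserB cK dL) ?cd ?subrr// normcR gtr0_norm.
Qed.

Lemma entire_taylor f : entire1 f -> exists c,
  [/\ forall z, f z = pser c z,
  forall r M, 0 < r -> (forall z, normc z = r -> normc (f z) <= M) -> prad c r (2 * M) &
  forall r, 0 < r -> exists K, prad c r K].
Proof.
move=> fe.
have [c [fc cb ck]] := taylor ltr01 (fun z _ => fe z).
have h0 : 0 < 2^-1 :> R by rewrite invr_gt0.
have h1 : 2^-1 < 1 :> R by rewrite invf_lt1// ltr1n.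
have [K cK] := ck _ h0 h1.
have cE (R0 : R) : 1 < R0 ->
    [/\ forall z, normc z < R0 -> f z = pser c z,
    forall r M, 0 < r -> r < R0 -> (forall z, normc z = r -> normc (f z) <= M) ->
      prad c r (2 * M) &
    forall r, 0 < r -> r < R0 -> exists K, prad c r K].
  move=> R1; have [c' [fc' cb' ck']] := taylor (lt_trans ltr01 R1) (fun z _ => fe z).
  have [K' cK'] := ck' _ h0 (lt_trans h1 R1).
  have -> // : c = c'.
  apply/funext/(pser_inj h0 h0 cK cK') => x x0 x2.
  have x1 : normc x%:C < 1 by rewrite normcR gtr0_norm//; exact: lt_trans h1.
  by rewrite -fc// -fc'//; exact: lt_trans R1.
exists c; split.
- move=> z; have [|+ _ _] := cE (normc z + 2); last by apply; rewrite ltrDl.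
  by rewrite ltr_wpDl ?normc_ge0// ltr1n.
- move=> r M r0 H; have [|_ + _] := cE (r + 2); last by apply => //; rewrite ltrDl.
  by rewrite ltr_wpDl ?(ltW r0)// ltr1n.
- move=> r r0; have [|_ _ +] := cE (r + 2); last by apply => //; rewrite ltrDl.
  by rewrite ltr_wpDl ?(ltW r0)// ltr1n.
Qed.

(** A weak form of Stirling's bound. The induction step is e <= ((n + 2) / (n + 1))^(n + 2), which
    follows from 1 - x <= exp (- x) at x = 1 / (n + 2). *)
Lemma fact_expR_le n : n.+1`!%:R * expR n.+1%:R <= expR 1 * (n.+1%:R * n.+1%:R ^+ n.+1) :> R.
Proof.
elim: n => [|n IH]; first by rewrite (_ : 1`! = 1%N)// expr1 !mulr1 mul1r.
have n0 : 0 < n.+1%:R :> R by rewrite ltr0n.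
have n1 : 0 < n.+2%:R :> R by rewrite ltr0n.
rewrite factS natrM -[in expR _]natr1 expRD.
apply: (@le_trans _ _ (n.+2%:R * expR 1 * (expR 1 * (n.+1%:R * n.+1%:R ^+ n.+1)))).
  rewrite (_ : _ * (_ * expR 1) = n.+2%:R * expR 1 * (n.+1`!%:R * expR n.+1%:R)); last by ring.
  by rewrite ler_wpM2l// mulr_ge0// ?expR_ge0.
rewrite -exprS (_ : n.+2%:R * _ * _ = expR 1 * n.+2%:R * (expR 1 * n.+1%:R ^+ n.+2)); last by ring.
rewrite [leRHS]mulrA ler_wpM2l ?mulr_ge0 ?expR_ge0// ?ler0n//.
have e1 : expR (n.+2%:R^-1) <= n.+2%:R / n.+1%:R :> R.
  have -> : n.+2%:R / n.+1%:R = (1 - n.+2%:R^-1)^-1 :> R.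
    rewrite -[n.+2%:R]natr1; move: n0; move: (n.+1%:R : R) => A A0.
    by field; rewrite addrK !gt_eqF// addr_gt0.
  rewrite -[expR _]invrK -expRN lef_pV2 ?posrE ?expR_gt0//; last first.
    by rewrite subr_gt0 invf_lt1// ltr1n.
  exact: expR_ge1Dx.
have : expR (n.+2%:R^-1) ^+ n.+2 <= (n.+2%:R / n.+1%:R) ^+ n.+2 :> R.
  by rewrite lerXn2r ?nnegrE ?expR_ge0 ?divr_ge0.
by rewrite -expRM_natl mulfV ?gt_eqF// expr_div_n ler_pdivlMr ?exprn_gt0.
Qed.

Definition etype (a : R) f := entire1 f /\
  forall T, a < T -> exists C, forall z, normc (f z) <= C * expR (T * normc z).

(** Here [c n * n!] is the n-th derivative at 0; for positive [a], [etype_coef] and [egrow_etype]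
    show that this is [etype a] read off the coefficients. *)
Definition egrow (a : R) c := forall T, a < T -> exists C : R,
  forall n, normc (c n) * n`!%:R <= C * T ^+ n.

(** Cauchy's estimate is taken at the radius n / T, which minimizes exp (T r) / r^n. By
    [fact_expR_le] a factor n remains, and it is absorbed in passing from [T] to the larger [T']. *)
Lemma etype_coef a f : 0 < a -> etype a f ->
  exists2 c, egrow a c & forall z, f z = pser c z.
Proof.
move=> a0 [fe fT]; have [c [fc cb ck]] := entire_taylor fe.
exists c => // T' aT'.
pose T := (a + T') / 2.
have aT : a < T by rewrite /T; lra.
have TT : T < T' by rewrite /T; lra.
have T0 : 0 < T := lt_trans a0 aT.
have T'0 : 0 < T' := lt_trans T0 TT.
have [C HC] := fT _ aT.
have C0 : 0 <= C.
  have := HC 0; rewrite (normc0 R) mulr0 expR0 mulr1; exact: le_trans (normc_ge0 _).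
pose q := T / T'.
have q0 : 0 <= q by rewrite divr_ge0 ?(ltW T0) ?(ltW T'0).
have q1 : q < 1 by rewrite ltr_pdivrMr// mul1r.
pose C' := Num.max (normc (c 0%N)) (2 * C * expR 1 * (1 - q)^-1).
exists C' => n; case: n => [|n].
  by rewrite fact0 expr0 !mulr1 le_max lexx.
pose r := n.+1%:R / T.
have r0 : 0 < r by rewrite divr_gt0// ltr0n.
have pr : prad c r (2 * (C * expR n.+1%:R)).
  apply: cb => // z zr; have := HC z; rewrite zr /r (mulrC T) divfK//.
  by rewrite gt_eqF.
have := pr n.+1; rewrite /r expr_div_n [leLHS]mulrA ler_pdivrMr ?exprn_gt0// => h.
have n0 : 0 < n.+1%:R ^+ n.+1 :> R by rewrite exprn_gt0// ltr0n.
rewrite -(ler_pM2r n0) mulrAC.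
apply: le_trans (ler_wpM2r (ler0n _ _) h) _.
have := ler_wpM2l (_ : 0 <= 2 * C * T ^+ n.+1) (fact_expR_le n).
move=> /(_ _)/le_trans h2.
rewrite (_ : _ * _ * _ = 2 * C * T ^+ n.+1 * (n.+1`!%:R * expR n.+1%:R)); last by ring.
apply: h2; first by rewrite !mulr_ge0// exprn_ge0// ltW.
rewrite [leLHS](_ : _ = 2 * C * expR 1 * (n.+1%:R * T ^+ n.+1) * n.+1%:R ^+ n.+1); last by ring.
rewrite ler_pM2r//.
have -> : T ^+ n.+1 = q ^+ n.+1 * T' ^+ n.+1.
  by rewrite -exprMn /q divfK// gt_eqF.
rewrite mulrA mulrA ler_wpM2r ?exprn_ge0 ?(ltW T'0)//.
apply: (@le_trans _ _ (2 * C * expR 1 * (1 - q)^-1)); last by rewrite le_max lexx orbT.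
rewrite ler_wpM2l ?mulr_ge0 ?expR_ge0//; exact: geometric_n_le.
Qed.

Lemma egrow_prad (c : nat -> R[i]) (C T r : R) : 0 <= T -> 0 <= r ->
  (forall n, normc (c n) * n`!%:R <= C * T ^+ n) -> prad c r (C * expR (T * r)).
Proof.
move=> T0 r0 H n.
have C0 : 0 <= C by have := H 0%N; rewrite expr0 mulr1; apply: le_trans; rewrite mulr_ge0 ?normc_ge0.
have f0 : 0 < n`!%:R :> R by rewrite ltr0n fact_gt0.
apply: (@le_trans _ _ (C * ((T * r) ^+ n / n`!%:R))).
  by rewrite mulrA ler_pdivlMr// mulrAC exprMn mulrA ler_wpM2r ?exprn_ge0.
by rewrite ler_wpM2l// exp_term_le// mulr_ge0.
Qed.

Lemma normc_pser_exp (c : nat -> R[i]) (C T : R) z : 0 <= T ->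
  (forall n, normc (c n) * n`!%:R <= C * T ^+ n) ->
  bsum (fun n => c n * z ^+ n) (C * expR (T * normc z)).
Proof.
move=> T0 H n.
have C0 : 0 <= C by have := H 0%N; rewrite expr0 mulr1; apply: le_trans; rewrite mulr_ge0 ?normc_ge0.
apply: (@le_trans _ _ (C * \sum_(0 <= i < n) ((T * normc z) ^+ i / i`!%:R))).
  rewrite mulr_sumr; apply: ler_sum => i _.
  have f0 : 0 < i`!%:R :> R by rewrite ltr0n fact_gt0.
  rewrite normcM normcX mulrA ler_pdivlMr// mulrAC exprMn mulrA.
  by rewrite ler_wpM2r ?exprn_ge0 ?normc_ge0.
by rewrite ler_wpM2l// sum_exp_le// mulr_ge0 ?normc_ge0.
Qed.

Lemma egrow_cderiv a c z : 0 <= a -> egrow a c -> cderiv (pser c) z (pser (dcoef c) z).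
Proof.
move=> a0 cg; have [|C HC] := cg (a + 1); first by rewrite ltrDl.
have a1 : 0 <= a + 1 by rewrite addr_ge0.
apply: (@cderiv_pser _ _ (normc z + 1)); last by rewrite ltrDl.
by apply: egrow_prad HC => //; rewrite addr_ge0 ?normc_ge0.
Qed.

Lemma egrow_etype a c : 0 <= a -> egrow a c -> etype a (pser c).
Proof.
move=> a0 cg; split; first by move=> z; exists (pser (dcoef c) z); exact: egrow_cderiv cg.
move=> T aT; have [C HC] := cg T aT; exists C => z; apply: normc_csum.
by apply: normc_pser_exp HC; exact: ltW (le_lt_trans a0 aT).
Qed.

End entire_series.

(** * Laplace transform and the coefficient bound *)

Section set_integral.
Variable R : realType.
Notation mu := (@lebesgue_measure R).
Implicit Types (g h : R -> R[i]) (D : set R) (K L : R) (z k : R[i]).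

Lemma cont_measurable g : (forall x, ccont g x) ->
  [/\ measurable_fun setT (fun x => Re (g x)), measurable_fun setT (fun x => Im (g x)) &
      measurable_fun setT (fun x => normc (g x))].
Proof.
move=> gc; split; apply: continuous_measurable_fun => x.
- exact: ccont_Re.
- exact: ccont_Im.
- exact: ccont_normc.
Qed.

Lemma cont_measurableE D g : (forall x, ccont g x) ->
  measurable_fun D (fun x => (normc (g x))%:E).
Proof.
move=> gc; have [_ _ m] := cont_measurable gc.
by apply/measurable_EFinP; exact: measurable_funTS m.
Qed.

(** Integrability with an explicit bound. Continuity on the whole line settles every measurability
    question, and [K] feeds the estimates for the derivative and for the tail of the Laplace
    integral. *)
Definition cabs D g K := (forall x, ccont g x) /\
  (\int[mu]_(x in D) (normc (g x))%:E <= K%:E)%E.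

Lemma cabs_normc D g K : measurable D -> cabs D g K ->
  mu.-integrable D (EFin \o (fun x => normc (g x))).
Proof.
move=> mD [gc gK]; apply/integrableP; split.
  apply/measurable_EFinP; apply: measurable_funTS.
  by have [] := cont_measurable gc.
apply: (le_lt_trans _ (ltry K)); apply: le_trans gK; rewrite le_eqVlt.
apply/orP; left; apply/eqP; apply: eq_integral => x _ /=.
by rewrite ger0_norm ?normc_ge0.
Qed.

Lemma cabs_Re D g K : measurable D -> cabs D g K ->
  mu.-integrable D (EFin \o (fun x => Re (g x))).
Proof.
move=> mD gK; apply: le_integrable (cabs_normc mD gK) => //.
  apply/measurable_EFinP; apply: measurable_funTS.
  by have [] := cont_measurable gK.1.
by move=> x _ /=; rewrite lee_fin [leRHS]ger0_norm ?normc_ge0 ?le_Re_normc.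
Qed.

Lemma cabs_Im D g K : measurable D -> cabs D g K ->
  mu.-integrable D (EFin \o (fun x => Im (g x))).
Proof.
move=> mD gK; apply: le_integrable (cabs_normc mD gK) => //.
  apply/measurable_EFinP; apply: measurable_funTS.
  by have [] := cont_measurable gK.1.
by move=> x _ /=; rewrite lee_fin [leRHS]ger0_norm ?normc_ge0 ?le_Im_normc.
Qed.

Definition CI D g : R[i] :=
  (\int[mu]_(x in D) Re (g x))%R +i* (\int[mu]_(x in D) Im (g x))%R.

Lemma normc_CI D g K : measurable D -> cabs D g K -> normc (CI D g) <= 2 * K.
Proof.
move=> mD gK; apply: le_trans (normc_le_ReIm _) _ => /=.
have nK : \int[mu]_(x in D) (normc (g x)) <= K.
  rewrite -lee_fin; apply: le_trans gK.2.
  rewrite /Rintegral fineK//; apply: integrable_fin_num => //.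
  exact: cabs_normc gK.
rewrite mulr_natl mulr2n; apply: lerD.
  apply: le_trans (le_normr_Rintegral _ (cabs_Re mD gK)) _ => //; apply: le_trans nK.
  apply: le_Rintegral => //; [exact: integrable_norm (cabs_Re mD gK)|exact: cabs_normc gK|].
  by move=> x _; exact: le_Re_normc.
apply: le_trans (le_normr_Rintegral _ (cabs_Im mD gK)) _ => //; apply: le_trans nK.
apply: le_Rintegral => //; [exact: integrable_norm (cabs_Im mD gK)|exact: cabs_normc gK|].
by move=> x _; exact: le_Im_normc.
Qed.

Lemma CID D g h K L : measurable D -> cabs D g K -> cabs D h L ->
  CI D (fun x => g x + h x) = CI D g + CI D h.
Proof.
move=> mD gK hL; apply/eqP; rewrite eq_complex /=; apply/andP; split; apply/eqP.
  rewrite -RintegralD//; [|exact: cabs_Re gK|exact: cabs_Re hL].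
  by apply: eq_Rintegral => x _; rewrite cReD.
rewrite -RintegralD//; [|exact: cabs_Im gK|exact: cabs_Im hL].
by apply: eq_Rintegral => x _; rewrite cImD.
Qed.

Lemma integrable_scaleD D (f : R -> R) (k : R) : measurable D ->
  mu.-integrable D (EFin \o f) -> mu.-integrable D (EFin \o (fun x => k * f x)).
Proof.
move=> mD fI; rewrite (_ : _ \o _ = (fun x => (k%:E * (EFin \o f) x)%E)); first exact: integrableZl.
by apply/funext => x /=; rewrite EFinM.
Qed.

Lemma CIZ D g K k : measurable D -> cabs D g K -> CI D (fun x => k * g x) = k * CI D g.
Proof.
move=> mD gK; have iR := cabs_Re mD gK; have iI := cabs_Im mD gK; case: k => p q.
apply/eqP; rewrite eq_complex /=; apply/andP; split; apply/eqP.
  rewrite -!RintegralZl// -RintegralB//; [|exact: integrable_scaleD..].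
  by apply: eq_Rintegral => x _; rewrite cReM.
rewrite -!RintegralZl// -RintegralD//; [|exact: integrable_scaleD..].
by apply: eq_Rintegral => x _; rewrite cImM.
Qed.

Lemma cabs_le D g h K : measurable D -> (forall x, ccont g x) -> (forall x, ccont h x) ->
  (forall x, D x -> normc (g x) <= normc (h x)) -> cabs D h K -> cabs D g K.
Proof.
move=> mD gc hc gh [_ hK]; split=> //; apply: le_trans hK.
apply: ge0_le_integral => //.
- by move=> x _; rewrite lee_fin normc_ge0.
- exact: cont_measurableE gc.
- exact: cont_measurableE hc.
Qed.

Lemma cabsZ D g K k : measurable D -> cabs D g K -> cabs D (fun x => k * g x) (normc k * K).
Proof.
move=> mD [gc gK]; split; first by move=> x; exact: ccontZ.
under eq_integral do rewrite normcM EFinM.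
rewrite ge0_integralZl//.
- by rewrite EFinM; apply: lee_wpmul2l => //; rewrite lee_fin normc_ge0.
- exact: cont_measurableE gc.
- by move=> x _; rewrite lee_fin normc_ge0.
- by rewrite lee_fin normc_ge0.
Qed.

Lemma cabsD D g h K L : measurable D -> cabs D g K -> cabs D h L ->
  cabs D (fun x => g x + h x) (K + L).
Proof.
move=> mD [gc gK] [hc hL]; split; first by move=> x; exact: ccontD.
apply: (@le_trans _ _ (\int[mu]_(x in D) ((normc (g x))%:E + (normc (h x))%:E))%E).
  apply: ge0_le_integral => //.
  - by move=> x _; rewrite lee_fin normc_ge0.
  - exact: cont_measurableE (fun x => ccontD (gc x) (hc x)).
  - by apply: emeasurable_funD; [exact: cont_measurableE gc|exact: cont_measurableE hc].
  - by move=> x _; rewrite -EFinD lee_fin le_normcD.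
rewrite ge0_integralD//.
- by rewrite EFinD leeD.
- by move=> x _; rewrite lee_fin normc_ge0.
- exact: cont_measurableE gc.
- by move=> x _; rewrite lee_fin normc_ge0.
- exact: cont_measurableE hc.
Qed.

Lemma cabs_sub D D' g K : measurable D -> measurable D' -> D `<=` D' -> cabs D' g K -> cabs D g K.
Proof.
move=> mD mD' DD' [gc gK]; split=> //; apply: le_trans gK.
apply: ge0_subset_integral => //.
- exact: cont_measurableE gc.
- by move=> x _; rewrite lee_fin normc_ge0.
Qed.

Lemma CI_split (X : R) g K : 0 <= X -> cabs `[0, +oo[ g K ->
  CI `[0, +oo[ g = cint 0 X g + CI `]X, +oo[ g.
Proof.
move=> X0 gK; have mD : measurable (`[0, +oo[%classic : set R) by [].
have E (f : R -> R) : mu.-integrable `[0, +oo[ (EFin \o f) ->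
   (\int[mu]_(x in `[0, +oo[) f x = \int[mu]_(x in `[0, X]) f x + \int[mu]_(x in `]X, +oo[) f x)%R.
  move=> fi; have := @Rintegral_itvB R f (BLeft 0) +oo%O X fi.
  rewrite !bnd_simp => /(_ X0 isT) <-.
  by rewrite addrC subrK.
by rewrite /CI (E _ (cabs_Re mD gK)) (E _ (cabs_Im mD gK)).
Qed.

Lemma Re_rderiv (F : R[i] -> R[i]) (x : R) l : cderiv F x%:C l ->
  rderiv (fun t => Re (F t%:C)) x (Re l) /\ rderiv (fun t => Im (F t%:C)) x (Im l).
Proof.
move=> Fl; split=> e e0; have [r r0 H] := Fl _ e0; exists r => // u ur;
  have := H u%:C; rewrite normcR -rmorphD => /(_ ur); apply: le_trans.
  rewrite (_ : _ - _ = Re (F (x + u)%:C - F x%:C - l * u%:C)) ?le_Re_normc//.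
  by rewrite !cReB cReM /= mulr0 subr0.
rewrite (_ : _ - _ = Im (F (x + u)%:C - F x%:C - l * u%:C)) ?le_Im_normc//.
by rewrite !cImB cImM /= mulr0 add0r.
Qed.

Lemma real_FTC (F f : R -> R) (a b : R) : a < b -> (forall x, rderiv F x (f x)) ->
  (forall x, {for x, continuous f}) -> \int[mu]_(x in `[a, b]) f x = F b - F a.
Proof.
move=> ab dF cf.
have dF' x : derivable F x 1 by have /rderivP[] := dF x.
have cF x : {for x, continuous F}.
  exact/differentiable_continuous/derivable1_diffP/dF'.
rewrite /Rintegral (@continuous_FTC2 R f F a b)//.
- by apply: continuous_in_subspaceT => x _; exact: cf.
- by split; [move=> x _; exact: dF'|exact/cvg_at_right_filter/cF|exact/cvg_at_left_filter/cF].
- by move=> x _; rewrite derive1E; have /rderivP[_ ->] := dF x.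
Qed.

Lemma complex_FTC (F : R[i] -> R[i]) g (a b : R) : a < b ->
  (forall x : R, cderiv F x%:C (g x)) -> (forall x, ccont g x) ->
  cint a b g = F b%:C - F a%:C.
Proof.
move=> ab dF gc; apply/eqP; rewrite eq_complex cReB cImB /=.
rewrite (@real_FTC (fun t => Re (F t%:C)))//; last 2 first.
- by move=> x; have [] := Re_rderiv (dF x).
- by move=> x; exact: ccont_Re.
rewrite (@real_FTC (fun t => Im (F t%:C)))//; last 2 first.
- by move=> x; have [] := Re_rderiv (dF x).
- by move=> x; exact: ccont_Im.
by rewrite !eqxx.
Qed.

End set_integral.

Section laplace.
Variable R : realType.
Notation mu := (@lebesgue_measure R).
Implicit Types (z w s h l : R[i]) (x sigma : R).

Lemma cderiv_unique (f : R[i] -> R[i]) z l l' : cderiv f z l -> cderiv f z l' -> l = l'.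
Proof. by move=> /cderivP[_ <-] /cderivP[_ <-]. Qed.

Lemma expR_ge_id x : x <= expR x.
Proof. by apply: le_trans (expR_ge1Dx x); rewrite lerDr. Qed.

(** Small [h] are covered by the power series; beyond its radius [r] each of the three terms is at
    most exp |h|, and 1 <= |h|^2 / r^2. A bound valid for all [h] is required because it is applied
    to [h x] with x unbounded. *)
Lemma cexp_quadratic : exists2 K : R, 0 <= K & forall h : R[i],
  normc (cexp h - 1 - h) <= K * normc h ^+ 2 * expR (normc h).
Proof.
have ce : entire1 (@cexp R) by move=> z; exists (cexp z); exact: cderiv_cexp.
have [c [fc _ ck]] := entire_taylor ce.
have [L cL] := ck 1 ltr01.
have n01 : normc (0 : R[i]) < 1 by rewrite (normc0 R).
have [M [r [M0 r0 H]]] := pser_quadratic cL n01.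
rewrite (normc0 R) in r0.
have d1 : pser (dcoef c) 0 = 1.
  apply: cderiv_unique (cderiv_pser cL n01) _.
  by apply: cderiv_ext (@cderiv_cexp0 R) => z; rewrite fc.
exists (M + 3 / r ^+ 2); first by rewrite addr_ge0// divr_ge0// exprn_ge0// ltW.
move=> h; have nh := normc_ge0 h.
have e1 : 1 <= expR (normc h) by apply: le_trans (expR_ge1Dx _); rewrite lerDl.
have [hr|rh] := leP (normc h) r.
  have := H h; rewrite add0r -!fc cexp0 d1 mul1r => /(_ hr)/le_trans; apply.
  apply: (@le_trans _ _ ((M + 3 / r ^+ 2) * normc h ^+ 2)).
    by rewrite ler_wpM2r ?sqr_ge0// lerDl divr_ge0// exprn_ge0// ltW.
  by rewrite ler_peMr// mulr_ge0 ?sqr_ge0// addr_ge0// divr_ge0// exprn_ge0// ltW.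
apply: (@le_trans _ _ (3 * expR (normc h))).
  apply: le_trans (le_normcB _ _) _.
  apply: le_trans (lerD (le_normcB _ _) (lexx _)) _.
  rewrite normc_cexp (normc1 R).
  have h1 : expR (Re h) <= expR (normc h).
    by rewrite ler_expR (le_trans (ler_norm _))// le_Re_normc.
  have h2 := expR_ge_id (normc h).
  rewrite (_ : 3 * expR (normc h) = expR (normc h) + expR (normc h) + expR (normc h)); last by ring.
  by do 2 apply: lerD => //.
rewrite ler_wpM2r ?expR_ge0//.
apply: (@le_trans _ _ (3 / r ^+ 2 * normc h ^+ 2)); last first.
  by rewrite ler_wpM2r ?sqr_ge0// lerDr.
rewrite mulrAC ler_pdivlMr ?exprn_gt0// ler_pM2l//.
by rewrite lerXn2r ?nnegrE// ltW.
Qed.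

Lemma cderiv_ccont_real (G : R[i] -> R[i]) x l : cderiv G x%:C l -> ccont (fun t : R => G t%:C) x.
Proof. by move=> /cderiv_cont Gc; exact: (@zcont_x _ G x 0). Qed.

Lemma le_normc_Re s x : 0 <= Re s <= x -> normc s <= normc (x +i* Im s).
Proof.
case: s => p q /= /andP[p0 px]; rewrite ler_wsqrtr// lerD2r.
by rewrite lerXn2r ?nnegrE// (le_trans p0).
Qed.

Lemma exp_dom1 (t x : R) : 0 < t -> 0 <= x -> x <= t^-1 * expR (t * x).
Proof. by move=> t0 x0; rewrite ler_pdivlMl//; exact: expR_ge_id. Qed.

Lemma exp_dom2 (t x : R) : 0 < t -> 0 <= x -> x ^+ 2 <= 4 / t ^+ 2 * expR (t * x).
Proof.
move=> t0 x0; have t2 : 0 < t / 2 by rewrite divr_gt0.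
have := exp_dom1 t2 x0 => h.
have : x ^+ 2 <= ((t / 2)^-1 * expR (t / 2 * x)) ^+ 2.
  by rewrite lerXn2r ?nnegrE ?mulr_ge0 ?invr_ge0 ?expR_ge0// ltW.
rewrite exprMn -expRM_natl (_ : 2 * (t / 2 * x) = t * x); last by field.
by rewrite (_ : (t / 2)^-1 ^+ 2 = 4 / t ^+ 2)//; field; rewrite gt_eqF.
Qed.

Variables (a : nat -> R[i]) (C d : R).
Hypothesis d0 : 0 < d.
Hypothesis ha : forall n, normc (a n) <= C * d ^+ n.

Let f := pser (fun n => a n / n`!%:R).

Hypothesis fW : forall sigma, 0 < sigma -> exists K : R,
  (\int[mu]_(x in `[0%R, +oo[) (normc (f x%:C) * expR (- (sigma * x)))%:E <= K%:E)%E.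

Lemma egf_bound (u : nat -> R[i]) (D : R) : (forall n, normc (u n) <= D * d ^+ n) ->
  forall n, normc (u n / n`!%:R) * n`!%:R <= D * d ^+ n.
Proof.
move=> uD n; have f0 : 0 < n`!%:R :> R by rewrite ltr0n fact_gt0.
by rewrite normcM normcV normc_nat divfK ?gt_eqF.
Qed.

Lemma egf_cderiv (u : nat -> R[i]) (D : R) z : (forall n, normc (u n) <= D * d ^+ n) ->
  cderiv (pser (fun n => u n / n`!%:R)) z (pser (fun n => u n.+1 / n`!%:R) z).
Proof.
move=> uD; have dd : (fun n => u n.+1 / n`!%:R) = dcoef (fun n => u n / n`!%:R).
  apply/funext => n; rewrite /dcoef factS natrM mulrCA invfM mulVKf//.
rewrite dd; apply: (@cderiv_pser _ _ (normc z + 1)); last by rewrite ltrDl.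
apply: egrow_prad (egf_bound uD); first exact: ltW.
by rewrite addr_ge0 ?normc_ge0.
Qed.

Let fd z : exists l, cderiv f z l.
Proof. by eexists; exact: egf_cderiv ha. Qed.

(* The integrand of the Laplace transform [Phi] of [f]. *)
Definition lapker s x : R[i] := f x%:C * cexp (- (s * x%:C)).

Lemma cderiv_cexp_lin s z : cderiv (fun z => cexp (- (s * z))) z (- s * cexp (- (s * z))).
Proof.
apply: (@cderiv_ext _ (@cexp R \o (fun z => (- s) * z))) => [w|]; first by rewrite /= mulNr.
apply: cderiv_eq (cderiv_comp (cderivM (cderiv_cst (- s) z) (cderiv_id z)) (cderiv_cexp _)).
by rewrite -mulNr; ring.
Qed.

Lemma lapker_cont s x : ccont (lapker s) x.
Proof.
have [l fl] := fd x%:C.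
exact: (@cderiv_ccont_real (fun z => f z * cexp (- (s * z))) _ _ (cderivM fl (cderiv_cexp_lin _ _))).
Qed.

Lemma Re_real x : Re x%:C = x. Proof. by []. Qed.

Lemma Re_scale s x : Re (- (s * x%:C)) = - (Re s * x).
Proof. by case: s => p q; rewrite /= mulr0 subr0. Qed.

Lemma normc_lapker s x : normc (lapker s x) = normc (f x%:C) * expR (- (Re s * x)).
Proof. by rewrite normcM normc_cexp Re_scale. Qed.

Let D0 : set R := `[0, +oo[%classic.
Let mD0 : measurable D0. Proof. exact: measurable_itv. Qed.

Lemma lapker_abs s : 0 < Re s -> exists K, cabs D0 (lapker s) K.
Proof.
move=> s0; have [K HK] := fW s0; exists K; split; first exact: lapker_cont.
by under eq_integral do rewrite normc_lapker.
Qed.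

Definition Phi s := CI D0 (lapker s).

(** Differentiation under the integral with a quadratic remainder. The decay exp (- sigma x) is
    shared out: half of [sigma] absorbs x^2, a quarter absorbs exp (|h| x), and the last quarter
    keeps the integral finite. *)
Lemma Phi_cderiv s : 0 < Re s -> exists l, cderiv Phi s l.
Proof.
move=> s0; set sigma := Re s in s0.
have [K0 K00 HK0] := cexp_quadratic.
have s4 : 0 < Re (sigma / 4)%:C by rewrite divr_gt0.
have s2 : 0 < Re (sigma / 2)%:C by rewrite divr_gt0.
have [K4 HK4] := lapker_abs s4.
have [K2 HK2] := lapker_abs s2.
have [Ks HKs] := lapker_abs s0.
have xc x : ccont (fun t : R => t%:C) x by exact: (cderiv_ccont_real (cderiv_id x%:C)).
have xl_cont t x : ccont (fun x => x%:C * lapker t x) x.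
  have [l fl] := fd x%:C.
  by apply: (@cderiv_ccont_real (fun z => z * (f z * cexp (- (t * z)))));
    apply: cderivM (cderiv_id _) (cderivM fl (cderiv_cexp_lin _ _)).
have HX : cabs D0 (fun x => x%:C * lapker s x) (normc ((sigma / 2)^-1)%:C * K2).
  apply: cabs_le (cabsZ ((sigma / 2)^-1)%:C mD0 HK2) => //.
    by move=> x; exact: ccontZ (lapker_cont _ _).
  move=> x xD; have x0 : 0 <= x by move: xD; rewrite /D0 /= in_itv /= andbT.
  rewrite normcM [leRHS]normcM !normc_lapker !normcR -/sigma Re_real !ger0_norm ?invr_ge0 ?divr_ge0 ?(ltW s0)// mulrCA [leRHS]mulrCA.
  rewrite ler_wpM2l ?normc_ge0//.
  rewrite (_ : - (sigma / 2 * x) = - (sigma * x) + sigma / 2 * x); last by field.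
  rewrite expRD [leRHS]mulrCA mulrC ler_wpM2l ?expR_ge0//.
  exact: exp_dom1.
pose M := K0 * (4 / (sigma / 2) ^+ 2).
have M0 : 0 <= M by rewrite mulr_ge0// divr_ge0// sqr_ge0.
have key h : normc h <= sigma / 4 ->
    normc (Phi (s + h) - Phi s - (- CI D0 (fun x => x%:C * lapker s x)) * h) <= 2 * (M * K4) * normc h ^+ 2.
  move=> hs.
  have sh0 : 0 < Re (s + h).
    rewrite cReD; have := le_trans (le_Re_normc h) hs.
    by rewrite ler_norml => /andP[h1 _]; rewrite -/sigma; lra.
  have [Kh HKh] := lapker_abs sh0.
  have -> : Phi (s + h) - Phi s - (- CI D0 (fun x => x%:C * lapker s x)) * h =
     CI D0 (fun x => lapker (s + h) x + (-1) * lapker s x + h * (x%:C * lapker s x)).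
    have HB := cabsD mD0 HKh (cabsZ (-1) mD0 HKs).
    rewrite (CID mD0 HB (cabsZ h mD0 HX)) (CID mD0 HKh (cabsZ (-1) mD0 HKs)).
    by rewrite (CIZ _ mD0 HKs) (CIZ _ mD0 HX) /Phi; ring.
  rewrite -mulrA; apply: normc_CI => //.
  have Mh0 : 0 <= M * normc h ^+ 2 by apply: mulr_ge0 => //; exact: sqr_ge0.
  have -> : M * K4 * normc h ^+ 2 = normc (M * normc h ^+ 2)%:C * K4.
    by rewrite normcR ger0_norm// mulrAC.
  apply: cabs_le (cabsZ _ mD0 HK4) => //.
  - move=> x; apply: ccontD; last by apply: ccontZ; exact: xl_cont.
    by apply: ccontD; [exact: lapker_cont|apply: ccontZ; exact: lapker_cont].
  - by move=> x; apply: ccontZ; exact: lapker_cont.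
  move=> x xD; have x0 : 0 <= x by move: xD; rewrite /D0 /= in_itv /= andbT.
  have -> : lapker (s + h) x + -1 * lapker s x + h * (x%:C * lapker s x) =
     lapker s x * (cexp (- (h * x%:C)) - 1 - (- (h * x%:C))).
    by rewrite /lapker mulrDl opprD cexpD; ring.
  have n1 : normc (- (h * x%:C)) = normc h * x by rewrite normcN normcM normcR ger0_norm.
  rewrite normcM; apply: le_trans (ler_wpM2l (normc_ge0 _) (HK0 _)) _.
  rewrite n1 [leRHS]normcM normcR (ger0_norm Mh0) !normc_lapker -/sigma Re_real.
  rewrite -[leLHS]mulrA [leRHS]mulrCA; apply: ler_wpM2l; first exact: normc_ge0.
  apply: (@le_trans _ _ (expR (- (sigma * x)) * (K0 * (normc h ^+ 2 * (4 / (sigma / 2) ^+ 2 * expR (sigma / 2 * x))) * expR (sigma / 4 * x)))).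
    rewrite ler_wpM2l ?expR_ge0//; apply: ler_pM; last 2 first.
    - rewrite exprMn; apply: ler_wpM2l => //; apply: ler_wpM2l; first exact: sqr_ge0.
      by apply: exp_dom2 => //; rewrite divr_gt0.
    - by rewrite ler_expR; apply: ler_wpM2r.
    - by apply: mulr_ge0 => //; exact: sqr_ge0.
    - exact: expR_ge0.
  rewrite (_ : - (sigma / 4 * x) = - (sigma * x) + sigma / 2 * x + sigma / 4 * x); last by field.
  by rewrite /M !expRD le_eqVlt; apply/orP; left; apply/eqP; ring.
exists (- CI D0 (fun x => x%:C * lapker s x)) => e e0.
have [_ /(le_trans _) K40] := HK4.
have K4p : 0 <= K4.
  by rewrite -lee_fin; apply: K40; apply: integral_ge0 => x _; rewrite lee_fin normc_ge0.
pose N := 2 * (M * K4).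
have N0 : 0 <= N by apply: mulr_ge0 => //; exact: mulr_ge0.
exists (Num.min (sigma / 4) (e / (1 + N))); first by rewrite lt_min !divr_gt0// ltr_wpDr.
move=> h; rewrite lt_min => /andP[h1 h2]; apply: le_trans (key _ (ltW h1)) _.
rewrite -/N expr2 mulrA ler_wpM2r ?normc_ge0//.
move: h2; rewrite ltr_pdivlMr ?ltr_wpDr// => /ltW; apply: le_trans.
by rewrite mulrC ler_wpM2l ?normc_ge0// lerDr.
Qed.

(* Laplace transform of [\sum_k a k * x ^ k / k!], integrated term by term. *)
Definition lsum s := csum (fun k => a k * s ^- k.+1).

Let C0 : 0 <= C.
Proof. by have := ha 0%N; rewrite expr0 mulr1; apply: le_trans; rewrite normc_ge0. Qed.

Lemma lsum_bsum s n : d < normc s ->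
  bsum (fun k => a (n + k)%N * s ^- k.+1) (C / (normc s - d) * d ^+ n).
Proof.
move=> ds m; have s0 : 0 < normc s := lt_trans d0 ds.
pose q := d / normc s.
have q0 : 0 <= q by rewrite divr_ge0 ?(ltW d0) ?normc_ge0.
have q1 : q < 1 by rewrite ltr_pdivrMr// mul1r.
apply: (@le_trans _ _ (\sum_(0 <= k < m) C * d ^+ n / normc s * q ^+ k)).
  apply: ler_sum => k _; rewrite normcM normcV normcX.
  apply: (@le_trans _ _ (C * d ^+ (n + k) / normc s ^+ k.+1)).
    by rewrite ler_wpM2r ?invr_ge0 ?exprn_ge0 ?normc_ge0.
  rewrite /q exprS exprD expr_div_n le_eqVlt; apply/orP; left; apply/eqP; field.
  by rewrite expf_neq0 ?gt_eqF.
rewrite -mulr_sumr.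
apply: (@le_trans _ _ (C * d ^+ n / normc s * (1 - q)^-1)).
  by rewrite ler_wpM2l ?sum_geometric_le// divr_ge0 ?normc_ge0// mulr_ge0// exprn_ge0// ltW.
rewrite le_eqVlt; apply/orP; left; apply/eqP; rewrite /q; field.
by rewrite !gt_eqF ?subr_gt0.
Qed.

Lemma lsum_cderiv s : d < normc s -> exists l, cderiv lsum s l.
Proof.
move=> ds; have s0 : 0 < normc s := lt_trans d0 ds.
have sn0 : s != 0 by rewrite -normc_gt0.
have pr : prad a d^-1 C.
  by move=> n; rewrite exprVn ler_pdivrMr ?exprn_gt0.
have sd : normc s^-1 < d^-1 by rewrite normcV ltf_pV2 ?posrE.
have ca := cderiv_pser pr sd.
have ci := cderivV sn0 (cderiv_id s).
eexists; apply: (@cderiv_near _ (fun z => z^-1 * pser a z^-1) lsum s _ (normc s - d)).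
- by rewrite subr_gt0.
- move=> h hs; have dsh : d < normc (s + h).
    by have := lerB_normc s (- h); rewrite opprK normcN; lra.
  have sd' : normc (s + h)^-1 < d^-1 by rewrite normcV ltf_pV2 ?posrE// (lt_trans d0).
  have [K bK] := bsum_pser_lt pr sd'.
  rewrite /pser -(csumZ _ bK) /lsum; congr csum; apply/funext => n.
  by rewrite mulrCA -exprS exprVn.
- apply: cderivM; first exact: ci.
  exact: (cderiv_comp ci ca).
Qed.

Lemma exp_small (A t e : R) : 0 <= A -> 0 < t -> 0 < e -> exists X0 : R, 0 < X0 /\
  A * expR (- (t * X0)) <= e.
Proof.
move=> A0 t0 e0; have Ae : 0 <= A / e by rewrite divr_ge0// ltW.
exists ((A / e + 1) / t); split; first by rewrite divr_gt0// ltr_wpDl.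
rewrite [t * _]mulrC divfK ?gt_eqF// expRN ler_pdivrMr ?expR_gt0// mulrC -ler_pdivrMr//.
by apply: le_trans (expR_ge_id _); rewrite lerDl.
Qed.

(** An explicit primitive replaces the exchange of sum and integral. The tails [h n] of the series
    satisfy h (n + 1) = s h n - a n, so their exponential generating function [H] solves H' = s H -
    f, and - H exp (- s z) is a primitive of the kernel. At 0 it equals - [lsum s]; along the
    positive axis it decays because [H] grows at most like exp (d x). *)
Lemma Phi_lsum_large s : d < Re s -> Phi s = lsum s.
Proof.
move=> ds; set sigma := Re s in ds.
have s0 : 0 < sigma := lt_trans d0 ds.
have dns : d < normc s by apply: lt_le_trans ds (le_trans (ler_norm _) (le_Re_normc _)).
have sn0 : s != 0 by rewrite -normc_gt0 (lt_trans d0).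
pose h n := csum (fun k => a (n + k)%N * s ^- k.+1).
pose C' := C / (normc s - d).
have C'0 : 0 <= C' by rewrite divr_ge0// subr_ge0 ltW.
have hb n : normc (h n) <= C' * d ^+ n by apply: normc_csum; exact: lsum_bsum.
have hS n : h n.+1 = s * h n - a n.
  have bs := lsum_bsum n dns; have bs1 := lsum_bsum n.+1 dns.
  rewrite {2}/h (csum_recl bs) addn0 expr1 mulrDr mulrCA mulfV// mulr1 (addrC (a n)) addrK.
  have bs' : bsum (fun k => a (n + k.+1)%N * s ^- k.+2) (C / (normc s - d) * d ^+ n).
    by have := bsum_shift 1 bs; under [in X in X -> _]eq_fun do rewrite addn1.
  rewrite -(csumZ s bs') /h.
  congr csum; apply/funext => k; rewrite addnS addSn [s ^+ k.+2]exprS invfM.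
  by rewrite [RHS]mulrCA mulVKf.
pose H := pser (fun n => h n / n`!%:R).
have Hd z : cderiv H z (s * H z - f z).
  apply: cderiv_eq (egf_cderiv z hb).
  have r0 : 0 <= normc z + 1 by rewrite addr_ge0 ?normc_ge0.
  have zr : normc z < normc z + 1 by rewrite ltrDl.
  have p1 := egrow_prad (ltW d0) r0 (egf_bound hb).
  have p2 := egrow_prad (ltW d0) r0 (egf_bound ha).
  rewrite -(pserZ s p1 zr) -(pserB (pradZ s p1) p2 zr); congr (pser _ z).
  by apply/funext => n; rewrite hS mulrBl mulrA.
pose G z := (-1) * (H z * cexp (- (s * z))).
have Gd z : cderiv G z (f z * cexp (- (s * z))).
  apply: cderiv_eq (cderivM (cderiv_cst (-1) z) (cderivM (Hd z) (cderiv_cexp_lin s z))).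
  by ring.
have Gb x : 0 <= x -> normc (G x%:C) <= C' * expR (- ((sigma - d) * x)).
  move=> x0; rewrite !normcM normcN (normc1 R) mul1r normc_cexp.
  rewrite Re_scale -/sigma.
  rewrite (_ : - ((sigma - d) * x) = d * x + - (sigma * x)); last by ring.
  rewrite expRD mulrA ler_wpM2r ?expR_ge0//.
  apply: normc_csum; have := normc_pser_exp x%:C (ltW d0) (egf_bound hb).
  by rewrite normcR ger0_norm.
have G0 : G 0 = - lsum s.
  by rewrite /G mulr0 oppr0 cexp0 mulr1 mulN1r /H pser0 fact0 divr1 /h.
have [K HK] := @lapker_abs s s0.
have s2 : 0 < Re (sigma / 2)%:C by rewrite divr_gt0.
have [K2 HK2] := lapker_abs s2.
have K20 : 0 <= K2.
  rewrite -lee_fin; have [_] := HK2; apply: le_trans.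
  by apply: integral_ge0 => x _; rewrite lee_fin normc_ge0.
apply/eqP; rewrite -subr_eq0 -normc_eq0 eq_le normc_ge0 andbT.
apply/ler_addgt0Pl => e e0; rewrite addr0.
pose t := Num.min (sigma - d) (sigma / 2).
have t0 : 0 < t by rewrite lt_min subr_gt0 ds divr_gt0.
have A0 : 0 <= C' + 2 * K2 by rewrite addr_ge0// mulr_ge0.
have [X [X0 HX]] := exp_small A0 t0 e0.
have EX : Phi s - lsum s = G X%:C + CI `]X, +oo[ (lapker s).
  rewrite /Phi (CI_split (ltW X0) HK) (complex_FTC X0 (fun x => Gd x%:C)); last exact: lapker_cont.
  by rewrite G0; ring.
rewrite EX; apply: le_trans (le_normcD _ _) _; apply: le_trans HX; rewrite mulrDl.
apply: lerD.
  apply: le_trans (Gb _ (ltW X0)) _; rewrite ler_wpM2l// ler_expR lerN2 ler_wpM2r ?(ltW X0)//.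
  by rewrite ge_min lexx.
rewrite -mulrA; apply: normc_CI => //.
have sub : `]X, +oo[%classic `<=` D0.
  by move=> x; rewrite /D0 /= !in_itv /= !andbT => /(lt_trans X0)/ltW.
have HK2X := cabs_sub (measurable_itv _) mD0 sub HK2.
rewrite mulrC.
have -> : expR (- (t * X)) * K2 = normc (expR (- (t * X)))%:C * K2.
  by rewrite normcR ger0_norm// expR_ge0.
apply: cabs_le (cabsZ _ (measurable_itv _) HK2X) => //; [exact: lapker_cont| |].
  by move=> x; apply: ccontZ; exact: lapker_cont.
move=> x xD; have Xx : X < x by move: xD; rewrite /= in_itv /= andbT.
rewrite [leRHS]normcM normcR ger0_norm ?expR_ge0// !normc_lapker -/sigma Re_real mulrCA.
rewrite ler_wpM2l ?normc_ge0// -expRD ler_expR.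
have ts : t <= sigma / 2 by rewrite ge_min lexx orbT.
have : t * X <= sigma / 2 * x by apply: ler_pM; rewrite ?(ltW t0) ?(ltW X0) ?(ltW Xx).
lra.
Qed.

(* [Phi] and the series [lsum] agree for large [Re s]; discs centred on a
   horizontal line carry the identity down to every [s] outside the disc of
   radius [d]. *)
Lemma Phi_lsum s : 0 < Re s -> d < normc s -> Phi s = lsum s.
Proof.
move=> s0 ds; set sigma0 := Re s in s0; pose tau := Im s.
pose kappa z := Phi z + (-1) * lsum z.
suff : kappa s = 0 by rewrite /kappa mulN1r => /eqP; rewrite subr_eq0 => /eqP.
(* Points to the right of [s] on its horizontal line have modulus at least [normc s], so discs of
   radius [rho] around them stay in the right half plane and outside the disc of radius [d]. The
   induction moves left by [rho / 2] at a time. *)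
pose rho := Num.min sigma0 (normc s - d).
have rho0 : 0 < rho by rewrite lt_min s0 subr_gt0.
have kd z : 0 < Re z -> d < normc z -> exists l, cderiv kappa z l.
  move=> z0 dz; have [l1 H1] := Phi_cderiv z0; have [l2 H2] := lsum_cderiv dz.
  by eexists; apply: cderivD H1 (cderivM (cderiv_cst (-1) z) H2).
have ns x : sigma0 <= x -> normc s <= normc (x +i* tau).
  by move=> sx; apply: le_normc_Re; rewrite -/sigma0 (ltW s0).
have main n x : sigma0 <= x -> d < x + n%:R * (rho / 2) -> kappa (x +i* tau) = 0.
  elim: n x => [|n IH] x sx dx.
    rewrite mul0r addr0 in dx.
    by rewrite /kappa Phi_lsum_large// mulN1r subrr.
  pose s2 := (x + rho / 2) +i* tau.
  have sx2 : sigma0 <= x + rho / 2 by apply: le_trans sx _; rewrite lerDl divr_ge0// ltW.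
  have kd2 w : normc w < rho -> exists l, cderiv (fun w => kappa (s2 + w)) w l.
    move=> wr; have [||l Hl] := kd (s2 + w).
    - have := le_lt_trans (le_Re_normc w) wr; rewrite ltr_norml => /andP[w1 _].
      have rs : rho <= sigma0 by rewrite ge_min lexx.
      by rewrite cReD /=; lra.
    - have rs : rho <= normc s - d by rewrite ge_min lexx orbT.
      have := lerB_normc s2 (- w); rewrite opprK normcN; have := ns _ sx2; rewrite -/s2; lra.
    by exists l; exact: cderiv_shift.
  have [c [kc _ ck]] := taylor rho0 kd2.
  have r2 : 0 < rho / 2 by rewrite divr_gt0.
  have r2r : rho / 2 < rho by rewrite ltr_pdivrMr// ltr_pMr// ltr1n.
  have [L cL] := ck _ r2 r2r.
  have c0 : forall m, c m = 0.
    apply: (pser_eq0 r2 r2 cL) => y y0 yr; rewrite -kc; last first.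
      by rewrite normcR gtr0_norm// (lt_trans yr).
    have -> : s2 + y%:C = (x + rho / 2 + y) +i* tau by rewrite /s2 /GRing.add /= addr0.
    apply: IH; first by apply: le_trans sx2 _; rewrite lerDl ltW.
    by move: dx; rewrite -natr1 mulrDl mul1r; lra.
  have nr : normc (- (rho / 2)%:C) < rho by rewrite normcN normcR gtr0_norm.
  have -> : x +i* tau = s2 + (- (rho / 2)%:C).
    by rewrite /s2 /GRing.add /GRing.opp /= oppr0 addr0 addrK.
  rewrite kc// (_ : c = fun=> 0); last exact/funext.
  rewrite /pser (_ : (fun n0 => 0 * _ ^+ n0) = fun=> 0); last by apply/funext => k; rewrite mul0r.
  apply/esym/(@csum_unique _ (fun=> 0) 0).
    by move=> k; rewrite big1// => i _; rewrite (normc0 R).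
  by move=> e e0; exists 0%N => k _; rewrite big1 ?subrr ?(normc0 R) ?(ltW e0).
have d2 : 0 <= d / (rho / 2) by rewrite divr_ge0 ?(ltW d0)// divr_ge0// ltW.
have -> : s = sigma0 +i* tau by rewrite /sigma0 /tau; case: (s).
apply: (main (Num.bound (d / (rho / 2)))) => //.
have := archi_boundP d2; rewrite ltr_pdivrMr ?divr_gt0// => /lt_trans; apply.
by rewrite ltrDr.
Qed.

End laplace.

(** * Scaling of Lebesgue measure and two explicit integrals *)

Section lebesgue_facts.
Variable R : realType.
Notation mu := (@lebesgue_measure R).
Local Open Scope ereal_scope.

Lemma measurable_scale (c : R) : measurable_fun setT (fun x : measurableTypeR R => (c * x)%R : measurableTypeR R).
Proof. exact: measurable_funM. Qed.

Section scale.
Variable c : R.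
Hypothesis c0 : (c != 0)%R.

Let nc : (0 <= `|c|)%R := normr_ge0 c.

Let nu : {measure set (measurableTypeR R) -> \bar R} :=
  mscale (NngNum nc)
   (measure_function_pushforward__canonical__measure_function_Measure mu (measurable_scale c)).

Lemma lebesgue_measure_scale (A : set R) : measurable A ->
  `|c|%:E * mu ((fun x => c * x)%R @^-1` A) = mu A.
Proof.
move=> mA; suff -> : mu A = nu A by [].
apply: lebesgue_measure_unique => //= _ [[a b]] _ <-.
rewrite /mscale /= /pushforward.
have [cp|cn|c00] := ltgtP 0%R c; last by move: c0; rewrite -c00 eqxx.
  rewrite (_ : _ @^-1` _ = `](a / c)%R, (b / c)%R]%classic); last first.
    apply/seteqP; split => x /=; rewrite !in_itv/= ler_pdivlMr// ltr_pdivrMr// mulrC//.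
  rewrite !lebesgue_measure_itv/= !lte_fin ltr_pM2r ?invr_gt0//.
  case: ifPn => _; last by rewrite mule0.
  by rewrite -!EFinB -EFinM gtr0_norm// mulrBr !mulrA !(mulrC c) !mulfK ?gt_eqF.
rewrite (_ : _ @^-1` _ = `[(b / c)%R, (a / c)%R[%classic); last first.
  by apply/seteqP; split => x /=; rewrite !in_itv/= ler_ndivrMr// ltr_ndivlMr// andbC mulrC.
rewrite !lebesgue_measure_itv/= !lte_fin ltr_nM2r ?invr_lt0//.
case: ifPn => _; last by rewrite mule0.
rewrite -!EFinB -EFinM ltr0_norm// mulrBr !mulNr opprK.
by rewrite !mulrA !(mulrC c) !mulfK ?lt_eqF// addrC.
Qed.

Lemma ge0_integral_scale (g : R -> \bar R) : measurable_fun setT g -> (forall x, 0 <= g x) ->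
  `|c|%:E * \int[mu]_x g (c * x)%R = \int[mu]_x g x.
Proof.
move=> mg g0.
transitivity (\int[nu]_x g x).
  rewrite /nu ge0_integral_mscale//=; congr (_ * _).
  by rewrite ge0_integral_pushforward//; exact: measurable_scale.
by apply: eq_measure_integral => A mA _; rewrite -[RHS]lebesgue_measure_scale.
Qed.

End scale.

Lemma integral_le_of_nondecreasing (F : (set R)^nat) (f : R -> \bar R) (B : \bar R) :
  nondecreasing_seq F -> (forall i, measurable (F i)) ->
  measurable_fun setT f -> (forall x, 0 <= f x) ->
  (forall i, \int[mu]_(x in F i) f x <= B) -> \int[mu]_(x in \bigcup_i F i) f x <= B.
Proof.
move=> ndF mF mf f0 fB.
have cv : (fun i => \int[mu]_(x in F i) f x) @ \oo --> \int[mu]_(x in \bigcup_i F i) f x.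
  by apply: ge0_nondecreasing_set_cvg_integral => // i; exact: measurable_funTS.
rewrite -(cvg_lim _ cv)//.
apply: lime_le; last by apply: nearW.
apply: ereal_nondecreasing_is_cvgn.
apply: ge0_nondecreasing_set_nondecreasing_integral => //.
by move=> i; exact: measurable_funTS.
Qed.

(** The exponent may be negative, so the fundamental theorem is applied on segments away from 0 and
    the bound passes to their union. *)
Lemma integral_powR_0 (e M : R) : (-1 < e)%R -> (0 < M)%R ->
  \int[mu]_(x in `]0%R, M]) (x `^ e)%:E <= ((e + 1)^-1 * M `^ (e + 1))%:E.
Proof.
move=> e1 M0; have e10 : (0 < e + 1)%R by rewrite -ltrBlDr sub0r.
have -> : `]0%R, M]%classic = \bigcup_n `[(M / n.+1%:R)%R, M]%classic :> set R.
  apply/seteqP; split => x /=; rewrite in_itv/=.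
    move=> /andP[x0 x1]; exists (Num.bound (M / x)) => //=.
    rewrite in_itv/= x1 andbT ler_pdivrMr// mulrC -ler_pdivrMr//.
    apply: le_trans (ltW (archi_boundP _)) _; first by rewrite divr_ge0// ltW.
    by rewrite ler_nat.
  by move=> [n _] /=; rewrite in_itv/= => /andP[h ->]; rewrite andbT (lt_le_trans _ h)// divr_gt0.
apply: integral_le_of_nondecreasing.
- apply/nondecreasing_seqP => n; rewrite subsetEset => x /=; rewrite !in_itv/= => /andP[h ->].
  by rewrite andbT (le_trans _ h)// ler_pM2l// lef_pV2 ?posrE// ler_nat.
- by move=> i; exact: measurable_itv.
- apply/measurable_EFinP; exact: measurable_powR.
- by move=> x; rewrite lee_fin powR_ge0.
(* For n = 0 the segment is the single point [M], while the fundamental theorem asks for distinct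
   endpoints. *)
move=> n; case: n => [|n].
  rewrite divr1 set_itv1 integral_set1 lee_fin.
  by rewrite mulr_ge0 ?powR_ge0// invr_ge0 ltW.
have r0 : (0 < M / n.+2%:R)%R by rewrite divr_gt0.
have r1 : (M / n.+2%:R < M)%R by rewrite ltr_pdivrMr// ltr_pMr// ltr1n.
pose G (x : R) := ((e + 1)^-1 * x `^ (e + 1))%R.
have dG (x : R) : (0 < x)%R -> is_derive x 1%R G (x `^ e)%R.
  move=> x0; rewrite (_ : x `^ e = (e + 1)^-1 *: ((e + 1) * x `^ (e + 1 - 1)))%R.
    by apply: is_deriveZ; exact: is_derive1_powR.
  by rewrite /GRing.scale /= mulrA mulVf ?gt_eqF// mul1r addrK.
have cG (x : R) : (0 < x)%R -> {for x, continuous G}.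
  move=> x0; apply/differentiable_continuous/derivable1_diffP.
  by have [] := dG x x0.
rewrite (@continuous_FTC2 R (fun x => x `^ e)%R G)//.
- rewrite -EFinB lee_fin /G gerBl mulr_ge0 ?invr_ge0 ?powR_ge0// ltW//.
- apply: continuous_in_subspaceT => x; rewrite inE/= in_itv/= => /andP[rx _].
  have x0 := lt_le_trans r0 rx.
  by apply/differentiable_continuous/derivable1_diffP; have [] := is_derive1_powR e x0.
- split.
  + by move=> x; rewrite in_itv/= => /andP[rx _]; have [] := dG x (lt_trans r0 rx).
  + exact/cvg_at_right_filter/cG.
  + exact/cvg_at_left_filter/cG/(lt_trans r0).
- move=> x; rewrite in_itv/= => /andP[rx _]; rewrite derive1E.
  by have [_ ->] := dG x (lt_trans r0 rx).
Qed.

Lemma integral_expR_0y (t : R) : (0 < t)%R ->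
  \int[mu]_(x in `]0%R, +oo[) (expR (- (t * x)))%:E <= (t^-1)%:E.
Proof.
move=> t0.
have mE : measurable_fun setT (fun x : R => (expR (- (t * x)))%:E).
  apply/measurable_EFinP; apply: continuous_measurable_fun => x.
  apply: continuous_comp; last exact: continuous_expR.
  by apply: cvgN; apply: cvgM; [exact: cvg_cst|exact: cvg_id].
have -> : `]0%R, +oo[%classic = \bigcup_n `]0%R, (n.+1%:R)%R]%classic :> set R.
  apply/seteqP; split => x /=; rewrite in_itv/= ?andbT.
    move=> x0; exists (Num.bound x) => //=; rewrite in_itv/= x0/=.
    by rewrite (le_trans (ltW (archi_boundP (ltW x0))))// ler_nat.
  by move=> [n _] /=; rewrite in_itv/= => /andP[].
apply: integral_le_of_nondecreasing => //.
- apply/nondecreasing_seqP => n; rewrite subsetEset => x /=; rewrite !in_itv/= => /andP[-> h].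
  by rewrite (le_trans h)// ler_nat.
move=> n; rewrite integral_itv_obnd_cbnd; last exact: measurable_funTS.
pose G (x : R) := (- t^-1 * expR (- (t * x)))%R.
have dG (x : R) : is_derive x 1%R G (expR (- (t * x))).
  have d1 : is_derive x 1%R (fun x : R => - (t * x))%R (- t)%R.
    apply/rderivP => e e0; exists 1%R => // u _.
    by rewrite (_ : _ - _ = 0)%R ?normr0 ?mulr_ge0 ?(ltW e0)//; ring.
  have d2 := @is_derive1_comp _ expR (fun x : R => - (t * x))%R x _ _ (is_derive_expR _) d1.
  have d3 := is_deriveZ (- t^-1)%R d2.
  rewrite (_ : expR (- (t * x)) = - t^-1 *: (expR (- (t * x)) * - t))%R//.
  by rewrite /GRing.scale /=; field; rewrite gt_eqF.
have cG (x : R) : {for x, continuous G}.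
  by apply/differentiable_continuous/derivable1_diffP; have [] := dG x.
rewrite (@continuous_FTC2 R (fun x => expR (- (t * x)))%R G)//.
- rewrite -EFinB lee_fin /G mulr0 oppr0 expR0 mulr1 !mulNr opprK addrC gerBl.
  by rewrite mulr_ge0 ?invr_ge0 ?expR_ge0// ltW.
- apply: continuous_in_subspaceT => x _.
  apply: continuous_comp; last exact: continuous_expR.
  by apply: cvgN; apply: cvgM; [exact: cvg_cst|exact: cvg_id].
- split; [by move=> x _; have [] := dG x|exact/cvg_at_right_filter/cG|exact/cvg_at_left_filter/cG].
- by move=> x _; rewrite derive1E; have [_ ->] := dG x.
Qed.

End lebesgue_facts.

(** * The coefficient bound that depends only on the weighted norm *)

Section coefficient_bound.
Variable R : realType.
Notation mu := (@lebesgue_measure R).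

Lemma amgm_weight (u p q sigma : R) : 0 <= u -> 0 < sigma -> 0 < p ->
  u * q <= sigma^-1 * (u ^+ 2 * p) + sigma * (p^-1 * q ^+ 2).
Proof.
move=> u0 s0 p0.
have : 0 <= (u * p - sigma * q) ^+ 2 + u ^+ 2 * p ^+ 2 + sigma ^+ 2 * q ^+ 2.
  by apply: addr_ge0; [apply: addr_ge0|]; rewrite ?sqr_ge0 -?exprMn ?sqr_ge0.
move=> h; have sp : 0 < sigma * p by rewrite mulr_gt0.
rewrite -(ler_pM2l sp).
have -> : sigma * p * (sigma^-1 * (u ^+ 2 * p) + sigma * (p^-1 * q ^+ 2)) =
  u ^+ 2 * p ^+ 2 + sigma ^+ 2 * q ^+ 2 by field; rewrite !gt_eqF.
by nra.
Qed.

(* By AM-GM, [u e^(-sigma x)] is at most [u^2 x^e] plus the dual weight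
   [x^(-e) e^(-2 sigma x)]; the latter is integrable at 0 because [e < 1], and
   [-1 <= e] gives [x^(-e) <= x] for [x >= 1]. *)
Lemma weighted_laplace (u : R -> R) (e E sigma : R) : measurable_fun setT u ->
  (forall x, 0 <= u x) -> -1 <= e -> e < 1 -> 0 < sigma ->
  (\int[mu]_(x in `]0%R, +oo[) (u x ^+ 2 * x `^ e)%:E <= E%:E)%E ->
  (\int[mu]_(x in `[0%R, +oo[) (u x * expR (- (sigma * x)))%:E <=
    ((E + sigma ^+ 2 / (1 - e) + 1) / sigma)%:E)%E.
Proof.
move=> mu0 u0 e1 e2 s0 uE.
have mexp (t : R) : measurable_fun setT (fun x : R => expR (- (t * x))).
  apply: continuous_measurable_fun => x.
  apply: continuous_comp; last exact: continuous_expR.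
  by apply: cvgN; apply: cvgM; [exact: cvg_cst|exact: cvg_id].
have mpow (t : R) : measurable_fun setT (fun x : R => x `^ t) by exact: measurable_powR.
have mue : measurable_fun setT (fun x : R => u x ^+ 2 * x `^ e).
  apply: measurable_funM; last exact: mpow.
  by rewrite (_ : (fun x => u x ^+ 2) = (fun x => u x * u x)); [exact: measurable_funM|apply/funext].
pose D : set R := `]0%R, +oo[%classic.
have mD : measurable D by exact: measurable_itv.
pose D1 : set R := `]0%R, 1%R]%classic.
have mD1 : measurable D1 by exact: measurable_itv.
have D1D : D1 `<=` D by move=> x; rewrite /D1 /D /= !in_itv/= andbT => /andP[].
(* [g1] is the weighted square; the dual term is dominated by [g2] on ]0, 1], and by [g3] for x > 1,
   where sigma x <= exp (sigma x). *)
pose g1 (x : R) := (sigma^-1 * (u x ^+ 2 * x `^ e))%:E.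
pose g2 (x : R) := (sigma%:E * ((fun x => (x `^ (- e))%:E) \_ D1) x)%E.
pose g3 (x : R) := (expR (- (sigma * x)))%:E.
have m1 : measurable_fun D g1.
  by apply: measurable_funTS; apply/measurable_EFinP; apply: measurable_funM => //; exact: mue.
have m2 : measurable_fun D ((fun x : R => (x `^ (- e))%:E) \_ D1).
  apply: measurable_funTS; apply/(measurable_restrictT _ _).1 => //.
  by apply: measurable_funTS; apply/measurable_EFinP; exact: mpow.
have m2' : measurable_fun D g2 by exact: measurable_funeM.
have m3 : measurable_fun D g3.
  by apply: measurable_funTS; apply/measurable_EFinP; exact: mexp.
have m23 : measurable_fun D (fun x => g2 x + g3 x)%E by exact: emeasurable_funD.
rewrite -integral_itv_obnd_cbnd; last first.
  by apply: measurable_funTS; apply/measurable_EFinP; exact: measurable_funM.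
apply: (@le_trans _ _ (\int[mu]_(x in D) (g1 x + (g2 x + g3 x)))%E).
  apply: ge0_le_integral => //.
  - by move=> x _; rewrite lee_fin mulr_ge0 ?expR_ge0.
  - by apply: measurable_funTS; apply/measurable_EFinP; apply: measurable_funM => //; exact: mexp.
  - exact: emeasurable_funD.
  move=> x; rewrite /D /= in_itv/= andbT => x0.
  have p0 : 0 < x `^ e by rewrite powR_gt0.
  have := @amgm_weight (u x) (x `^ e) (expR (- (sigma * x))) sigma (u0 x) s0 p0.
  rewrite -powRN => h.
  have E2 : expR (- (sigma * x)) ^+ 2 = expR (- (2 * sigma * x)).
    by rewrite -expRM_natl; congr expR; ring.
  have e20 : expR (- (sigma * x)) <= 1 by rewrite -[leRHS]expR0 ler_expR oppr_le0 mulr_ge0 ?(ltW s0) ?(ltW x0).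
  rewrite /g1 /g2 /g3 /patch; case: ifPn => xD1.
    rewrite -EFinM -!EFinD lee_fin; apply: le_trans h _; rewrite lerD2l.
    apply: (@le_trans _ _ (sigma * x `^ (- e))); last by rewrite lerDl expR_ge0.
    rewrite ler_wpM2l ?(ltW s0)// ler_piMr ?powR_ge0//.
    by rewrite expr_le1 ?expR_ge0.
  rewrite mule0 add0e -EFinD lee_fin; apply: le_trans h _; rewrite lerD2l.
  have x1 : 1 < x.
    rewrite ltNge; apply: contraNN xD1 => x1; apply/mem_set.
    by rewrite /D1 /= in_itv/= x0.
  rewrite expr2 mulrA mulrA ler_piMl ?expR_ge0//.
  have xe : x `^ (- e) <= x.
    by rewrite -[leRHS](powRr1 (ltW x0)) ler_powR ?(ltW x1)// lerNl.
  rewrite expRN ler_pdivrMr ?expR_gt0// mul1r.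
  apply: le_trans (expR_ge_id _); by rewrite ler_wpM2l ?(ltW s0).
have g20 x : (0 <= g2 x)%E.
  rewrite mule_ge0 ?lee_fin ?(ltW s0)//.
  by apply: erestrict_ge0 => y _; rewrite lee_fin powR_ge0.
rewrite ge0_integralD//; last 2 first.
- by move=> x _; rewrite lee_fin mulr_ge0 ?invr_ge0 ?(ltW s0)// mulr_ge0 ?sqr_ge0 ?powR_ge0.
- by move=> x _; rewrite adde_ge0 ?lee_fin ?expR_ge0.
rewrite ge0_integralD//; last by move=> x _; rewrite lee_fin expR_ge0.
rewrite (_ : (E + sigma ^+ 2 / (1 - e) + 1) / sigma =
   sigma^-1 * E + (sigma * (1 - e)^-1 + sigma^-1)); last first.
  by field; rewrite gt_eqF//= subr_eq0 gt_eqF.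
rewrite !EFinD; apply: leeD; last apply: leeD.
- rewrite /g1; under eq_integral do rewrite EFinM.
  rewrite ge0_integralZl_EFin//.
  + by rewrite EFinM; apply: lee_wpmul2l => //; rewrite lee_fin invr_ge0 ltW.
  + by move=> x _; rewrite lee_fin mulr_ge0 ?sqr_ge0 ?powR_ge0.
  + by apply: measurable_funTS; exact/measurable_EFinP.
  + by rewrite invr_ge0 ltW.
- rewrite /g2 ge0_integralZl_EFin//; last 2 first.
  + by move=> x _; apply: erestrict_ge0 => y _; rewrite lee_fin powR_ge0.
  + exact: ltW.
  rewrite EFinM; apply: lee_wpmul2l; first by rewrite lee_fin ltW.
  rewrite -integral_mkcondr setIidr//.
  have -> : 1 - e = - e + 1 by rewrite addrC.
  apply: le_trans (integral_powR_0 _ ltr01) _; first by rewrite ltrN2.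
  by rewrite powR1 mulr1.
- exact: integral_expR_0y.
Qed.

Definition shift2 (u : nat -> R[i]) (n : nat) : R[i] := if n is n'.+2 then u n' else 0.

Lemma prad_shift2 (u : nat -> R[i]) (r K : R) : 0 <= r -> prad u r K -> prad (shift2 u) r (K * r ^+ 2).
Proof.
move=> r0 uK; have K0 : 0 <= K * r ^+ 2 by rewrite mulr_ge0 ?sqr_ge0 ?(prad_ge0 uK).
case=> [|[|n]]; [by rewrite [shift2 _ _](_ : _ = 0)// (normc0 R) mul0r..|].
by rewrite /shift2 -[n.+2]addn2 exprD mulrA ler_wpM2r ?sqr_ge0.
Qed.

Lemma pser_shift2 (u : nat -> R[i]) (r K : R) z : prad u r K -> normc z < r ->
  pser (shift2 u) z = z ^+ 2 * pser u z.
Proof.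
move=> uK zr; have r0 : 0 < r := le_lt_trans (normc_ge0 _) zr.
have p2 := prad_shift2 (ltW r0) uK.
rewrite (pser_recl p2 zr) (pser_recl (prad_shift r0 p2) zr) /= !add0r mulrA.
by rewrite -expr2.
Qed.

Section laplace_circle.
Variables (a : nat -> R[i]) (C d e E T : R).
Hypotheses (d0 : 0 < d) (dT : d < T) (e1 : -1 <= e) (e2 : e < 1).
Hypothesis ha : forall n, normc (a n) <= C * d ^+ n.
Let f := pser (fun n => a n / n`!%:R).
Hypothesis fE : forall s : bool,
  (\int[mu]_(x in `]0%R, +oo[) (normc (f ((-1) ^+ s * x)%:C) ^+ 2 * x `^ e)%:E <= E%:E)%E.

(** The numerator in [weighted_laplace] with [sigma = Re s] replaced by its largest value [T] on the
    circle. *)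
Let Q := E + T ^+ 2 / (1 - e) + 1.

Let T0 : 0 < T. Proof. exact: lt_trans dT. Qed.

Lemma normc_f_measurable (b : nat -> R[i]) : (forall n, normc (b n) <= C * d ^+ n) ->
  measurable_fun setT (fun x : R => normc (pser (fun n => b n / n`!%:R) x%:C)).
Proof.
move=> hb; apply: continuous_measurable_fun => x; apply: ccont_normc.
exact: (cderiv_ccont_real (egf_cderiv d0 x%:C hb)).
Qed.

Lemma lsum_bound_half (b : nat -> R[i]) s : (forall n, normc (b n) <= C * d ^+ n) ->
  (\int[mu]_(x in `]0%R, +oo[) (normc (pser (fun n => b n / n`!%:R) x%:C) ^+ 2 * x `^ e)%:E <= E%:E)%E ->
  normc s = T -> 0 < Re s -> Re s * normc (lsum b s) <= 2 * Q.
Proof.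
move=> hb bE sT s0.
have W sigma (sp : 0 < sigma) := @weighted_laplace (fun x => normc (pser (fun n => b n / n`!%:R) x%:C))
   e E sigma (normc_f_measurable hb) (fun x => normc_ge0 _) e1 e2 sp bE.
rewrite -(Phi_lsum d0 hb _ s0); last 2 first.
- by move=> sigma sp; eexists; exact: W.
- by rewrite sT.
have H : normc (Phi b s) <= 2 * ((E + Re s ^+ 2 / (1 - e) + 1) / Re s).
  apply: normc_CI; first exact: measurable_itv.
  split; first exact: (lapker_cont d0 hb).
  apply: le_trans (W _ s0); rewrite le_eqVlt; apply/orP; left; apply/eqP.
  by apply: eq_integral => x _; rewrite normc_lapker.
rewrite -ler_pdivlMl//; apply: le_trans H _.
rewrite [leRHS]mulrC -[leRHS]mulrA ler_wpM2l//.
rewrite ler_wpM2r ?invr_ge0 ?(ltW s0)// /Q lerD2r lerD2l ler_wpM2r ?invr_ge0 ?subr_ge0 ?(ltW e2)//.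
by rewrite lerXn2r ?nnegrE ?(ltW s0) ?(ltW T0)// -sT (le_trans (ler_norm _))// le_Re_normc.
Qed.

(* The Laplace transform is bounded in each half plane by a multiple of
   [1 / |Re s|]; the left one is reached through [x |-> f (- x)]. *)
Lemma lsum_bound s : normc s = T -> `|Re s| * normc (lsum a s) <= 2 * Q.
Proof.
move=> sT.
have Q0 : 0 <= Q.
  have E0 : 0 <= E.
    rewrite -lee_fin; apply: le_trans (fE false); apply: integral_ge0 => x _.
    by rewrite lee_fin mulr_ge0 ?sqr_ge0 ?powR_ge0.
  by rewrite /Q !addr_ge0// divr_ge0 ?sqr_ge0// subr_ge0 ltW.
have [s0|s0|s0] := ltgtP 0 (Re s); last by rewrite -s0 normr0 mul0r mulr_ge0.
  rewrite gtr0_norm//; apply: lsum_bound_half => //.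
  apply: le_trans (fE false); rewrite le_eqVlt; apply/orP; left; apply/eqP.
  apply: eq_integral => x _; have -> : (-1) ^+ false * x = x by rewrite expr0 mul1r.
  by [].
rewrite ltr0_norm//.
pose b n := (-1) ^+ n * a n.
have hb n : normc (b n) <= C * d ^+ n.
  by rewrite normcM normcX normcN (normc1 R) expr1n mul1r.
have -> : lsum a s = - lsum b (- s).
  have ds : d < normc (- s) by rewrite normcN sT.
  have bs := lsum_bsum d0 hb 0 ds.
  rewrite -mulN1r -(csumZ (-1) bs); congr csum; apply/funext => n.
  rewrite add0n /b [(- s) ^+ _]exprNn invfM invr_sign.
  rewrite (exprS (-1) n); set w := (-1) ^+ n.
  have w2 : w * w = 1 by rewrite -expr2 sqrr_sign.
  by rewrite -[LHS]mul1r -{1}w2; ring.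
rewrite normcN -[- Re s](_ : Re (- s) = _); last by case: (s).
apply: lsum_bound_half => //; last 2 first.
- by rewrite normcN.
- by case: (s) s0 => p q /=; rewrite oppr_gt0.
apply: le_trans (fE true); rewrite le_eqVlt; apply/orP; left; apply/eqP.
apply: eq_integral => x _; have -> : (-1) ^+ true * x = - x by rewrite expr1 mulN1r.
have -> : f (- x)%:C = pser (fun n => b n / n`!%:R) x%:C; last by [].
rewrite /f /pser; congr csum; apply/funext => n; rewrite /b.
have -> : (- x)%:C = - x%:C :> R[i] by exact: rmorphN.
by rewrite [(- x%:C) ^+ n]exprNn -(mulrA _ (a n)) [LHS]mulrCA mulrA.
Qed.

(* On the circle [|s| = T] one has [|s ^ 2 + T ^ 2| = 2 T |Re s|], which
   cancels the singularity of the bound on the imaginary axis. *)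
Lemma circle_coef_bound : exists c : nat -> R[i],
  prad c T^-1 (8 * Q) /\ forall x : R, 0 < x -> x < d^-1 ->
    (1 + T%:C ^+ 2 * x%:C ^+ 2) * pser a x%:C = pser c x%:C.
Proof.
have pr : prad a d^-1 C by move=> n; rewrite exprVn ler_pdivrMr ?exprn_gt0.
have dV : 0 < d^-1 by rewrite invr_gt0.
have Pd z : normc z < d^-1 -> exists l, cderiv (fun z => (1 + T%:C ^+ 2 * z ^+ 2) * pser a z) z l.
  move=> zd; eexists; apply: cderivM; last exact: cderiv_pser pr zd.
  apply: cderivD; first exact: cderiv_cst.
  by apply: cderivM; [exact: cderiv_cst|exact: cderivX].
have [c [fc cb _]] := taylor dV Pd.
exists c; split; last by move=> x x0 xd; rewrite fc// normcR gtr0_norm.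
(* In the variable z = 1 / s the product is holomorphic near 0, so Cauchy's estimate applies on |z|
   = 1 / T and costs the first factor 2; the modulus there is 2 |Re s| |lsum a s|, at most 4 Q. *)
rewrite (_ : 8 * Q = 2 * (4 * Q)); last by ring.
apply: cb; first by rewrite invr_gt0.
  by rewrite ltf_pV2 ?posrE.
move=> z zT.
have z0 : z != 0 by rewrite -normc_gt0 zT invr_gt0.
pose s := z^-1.
have sT : normc s = T by rewrite /s normcV zT invrK.
have ssT : s ^+ 2 + T%:C ^+ 2 = 2 * (Re s)%:C * s.
  move: sT; case: (s) => p q /= h; rewrite -h -rmorphXn /= sqr_sqrtr ?addr_ge0 ?sqr_ge0//.
  by apply/eqP; rewrite eq_complex /=; apply/andP; split; apply/eqP; rewrite /=; ring.
have lE : lsum a s = z * pser a z.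
  have zd : normc z < d^-1 by rewrite zT ltf_pV2 ?posrE.
  have [L bL] := bsum_pser_lt pr zd.
  rewrite /pser -(csumZ z bL); congr csum; apply/funext => n.
  by rewrite /s -exprVn invrK exprS mulrCA.
have -> : (1 + T%:C ^+ 2 * z ^+ 2) * pser a z = z * (s ^+ 2 + T%:C ^+ 2) * lsum a s.
  by rewrite lE /s; field.
rewrite ssT (_ : z * (2 * (Re s)%:C * s) = 2 * (Re s)%:C); last by rewrite /s; field.
rewrite !normcM normcR (normc_nat R 2) -mulrA (_ : 4 * Q = 2 * (2 * Q)); last by ring.
by rewrite ler_wpM2l//; exact: lsum_bound.
Qed.

End laplace_circle.

(* Subtracting the bounds of [circle_coef_bound] for two radii isolates the
   coefficients. *)
Lemma coef_bound (delta e T : R) : 0 < delta -> -1 <= e -> e < 1 -> delta < T ->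
  exists K : R, forall c : nat -> R[i], egrow delta c ->
    (forall s : bool,
      (\int[mu]_(x in `]0%R, +oo[) (normc (pser c ((-1) ^+ s * x)%:C) ^+ 2 * x `^ e)%:E <= 1)%E) ->
    forall n, normc (c n) * n`!%:R <= K * T ^+ n.
Proof.
move=> de0 e1 e2 dT.
pose T1 := (delta + T) / 2.
pose d := (delta + T1) / 2.
have ded : delta < d by rewrite /d /T1; lra.
have dT1 : d < T1 by rewrite /d /T1; lra.
have T1T : T1 < T by rewrite /T1; lra.
have d0 := lt_trans de0 ded.
have T10 := lt_trans d0 dT1.
have T0 := lt_trans T10 T1T.
have TT : 0 < T ^+ 2 - T1 ^+ 2 by rewrite subr_gt0 ltrXn2r// ?nnegrE ?ltW.
pose Q (t : R) := 8 * (1 + t ^+ 2 / (1 - e) + 1).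
have Q0 t : 0 <= Q t.
  by rewrite /Q mulr_ge0// !addr_ge0// divr_ge0 ?sqr_ge0// subr_ge0 ltW.
exists ((Q T + Q T1) * T ^+ 2 / (T ^+ 2 - T1 ^+ 2)) => c cg cE n.
(* The constant [C] belongs to this particular [c]: it makes the circle bounds applicable and does
   not appear in their conclusion. *)
have [C HC] := cg d ded.
pose a k := c k * k`!%:R.
have fk k : (k`!%:R : R[i]) != 0 by rewrite pnatr_eq0 -lt0n fact_gt0.
have cE' : c = fun k => a k / k`!%:R by apply/funext => k; rewrite /a mulfK.
have ha k : normc (a k) <= C * d ^+ k by rewrite normcM normc_nat.
have aE (s : bool) : (\int[mu]_(x in `]0%R, +oo[)
    (normc (pser (fun k => a k / k`!%:R) ((-1) ^+ s * x)%:C) ^+ 2 * x `^ e)%:E <= 1%:E)%E.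
  by rewrite -cE'.
have [c1 [p1 H1]] := circle_coef_bound d0 dT1 e1 e2 ha aE.
have [c2 [p2 H2]] := circle_coef_bound d0 (lt_trans dT1 T1T) e1 e2 ha aE.
rewrite -/(Q T1) in p1; rewrite -/(Q T) in p2.
have TV : 0 < T^-1 by rewrite invr_gt0.
have TVl : T^-1 <= T1^-1 by rewrite lef_pV2 ?posrE// ltW.
have TVd : T^-1 <= d^-1 by rewrite lef_pV2 ?posrE// ltW// (lt_trans dT1).
have T01 : 0 <= T^-1 <= T1^-1 by rewrite (ltW TV).
have T0d : 0 <= T^-1 <= d^-1 by rewrite (ltW TV).
have p1' := prad_le T01 p1.
have pa : prad a d^-1 C by move=> k; rewrite exprVn ler_pdivrMr ?exprn_gt0.
have pa' := prad_le T0d pa.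
have pk := pradZ (T ^+ 2 - T1 ^+ 2)%:C pa'.
(* The difference of the two identities is (T^2 - T1^2) x^2 times the series of [a]; the factor x^2
   is realised by [shift2], hence the index n + 2. *)
have E := pser_inj TV TV (prad_shift2 (ltW TV) pk) (pradB (ltW TV) p2 p1') _ n.+2.
have : (T ^+ 2 - T1 ^+ 2)%:C * a n = c2 n.+2 - c1 n.+2.
  apply: E => x x0 xT.
  have nx : normc x%:C < T^-1 by rewrite normcR gtr0_norm.
  have xd := lt_le_trans xT TVd.
  rewrite (pser_shift2 pk nx) (pserZ _ pa' nx) (pserB p2 p1' nx) -H1// -H2//.
  by rewrite rmorphB !rmorphXn /=; ring.
move=> /(congr1 (@normc R)); rewrite normcM normcR (gtr0_norm TT) /a normcM normc_nat => eqn.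
rewrite [leRHS]mulrAC ler_pdivlMr// mulrC eqn.
apply: le_trans (le_normcB _ _) _.
have b2 : normc (c2 n.+2) <= Q T * T ^+ n.+2.
  by have := p2 n.+2; rewrite exprVn ler_pdivrMr ?exprn_gt0.
have b1 : normc (c1 n.+2) <= Q T1 * T ^+ n.+2.
  by have := p1' n.+2; rewrite exprVn ler_pdivrMr ?exprn_gt0.
apply: le_trans (lerD b2 b1) _.
by rewrite -mulrDl -[n.+2]addn2 exprD [T ^+ n * _]mulrC mulrA.
Qed.

End coefficient_bound.

(** * The one-dimensional problem *)

Section line_energy.
Variable R : realType.
Notation mu := (@lebesgue_measure R).
Implicit Types (c k : nat -> R[i]) (t : R).

(* For [t = 2 * a + 1] this is [energy a] in dimension [d = 1]. *)
Definition E1 t c : \bar R :=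
  (\int[mu]_x (normc (pser c x%:C) ^+ 2 * `|x| `^ t)%:E)%E.

Definition evenc c := forall n, odd n -> c n = 0.

Definition shift1 c n : R[i] := if n is n'.+1 then c n' else 0.

Lemma growth_const_ge0 c (C T : R) :
  (forall n, normc (c n) * n`!%:R <= C * T ^+ n) -> 0 <= C.
Proof.
by move=> /(_ 0%N); rewrite expr0 [leRHS]mulr1; apply: le_trans; rewrite mulr_ge0 ?normc_ge0.
Qed.

Lemma egrow_entire (a : R) c : 0 < a -> egrow a c -> forall x : R, ccont (fun t : R => pser c t%:C) x.
Proof. by move=> a0 cg x; exact: cderiv_ccont_real (egrow_cderiv x%:C (ltW a0) cg). Qed.

Lemma egrow_pradr (a r : R) c : 0 < a -> 0 <= r -> egrow a c -> exists K, prad c r K.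
Proof.
move=> a0 r0 cg; have [|C HC] := cg (a + 1); first by rewrite ltrDl.
by exists (C * expR ((a + 1) * r)); apply: egrow_prad HC => //; rewrite addr_ge0 ?(ltW a0).
Qed.

Lemma prad_shift1 c (r K : R) : 0 <= r -> prad c r K -> prad (shift1 c) r (K * r).
Proof.
move=> r0 cK; have K0 : 0 <= K * r by rewrite mulr_ge0 ?(prad_ge0 cK).
case=> [|n]; first by rewrite [shift1 _ _](_ : _ = 0)// (normc0 R) mul0r.
by rewrite /shift1 exprSr mulrA ler_wpM2r.
Qed.

Lemma pser_shift1 (a : R) c z : 0 < a -> egrow a c -> pser (shift1 c) z = z * pser c z.
Proof.
move=> a0 cg; have r0 : 0 <= normc z + 1 by rewrite addr_ge0 ?normc_ge0.
have zr : normc z < normc z + 1 by rewrite ltrDl.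
have [K cK] := egrow_pradr a0 r0 cg.
by rewrite (pser_recl (prad_shift1 r0 cK) zr) /= add0r.
Qed.

Lemma natmul_geometric (T0 T : R) n : 0 <= T0 -> T0 < T ->
  n%:R * T0 ^+ n <= (1 - T0 / T)^-1 * T ^+ n.
Proof.
move=> T00 T0T; have T1 : 0 < T := le_lt_trans T00 T0T.
have := @geometric_n_le R (T0 / T) n _ _; rewrite divr_ge0 ?(ltW T1)// => /(_ isT).
rewrite ltr_pdivrMr// mul1r => /(_ T0T).
by rewrite expr_div_n mulrA ler_pdivrMr ?exprn_gt0.
Qed.

Lemma egrow_shift1 (a : R) c : 0 < a -> egrow a c -> egrow a (shift1 c).
Proof.
move=> a0 cg T aT; pose T0 := (a + T) / 2.
have aT0 : a < T0 by rewrite /T0; lra.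
have T0T : T0 < T by rewrite /T0; lra.
have T00 := lt_trans a0 aT0.
have [C HC] := cg _ aT0.
have C0 : 0 <= C by exact: growth_const_ge0 HC.
have q1 : 0 < 1 - T0 / T by rewrite subr_gt0 ltr_pdivrMr ?mul1r// (lt_trans T00).
exists (C / T0 * (1 - T0 / T)^-1) => -[|n].
  rewrite [shift1 _ _](_ : _ = 0)// (normc0 R) mul0r mulr_ge0 ?exprn_ge0 ?(ltW (lt_trans T00 T0T))//.
  by rewrite mulr_ge0 ?invr_ge0 ?(ltW q1)// divr_ge0// ltW.
rewrite /shift1 factS natrM mulrCA.
apply: (@le_trans _ _ (C / T0 * (n.+1%:R * T0 ^+ n.+1))).
  by rewrite [leRHS]mulrCA ler_wpM2l// exprS mulrA divfK ?gt_eqF// HC.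
rewrite -[leRHS]mulrA ler_wpM2l//; first exact: divr_ge0 C0 (ltW T00).
exact: natmul_geometric (ltW T00) T0T.
Qed.

Lemma E1_measurable (a : R) t c : 0 < a -> egrow a c ->
  measurable_fun setT (fun x : R => (normc (pser c x%:C) ^+ 2 * `|x| `^ t)%:E).
Proof.
move=> a0 cg; apply/measurable_EFinP; apply: measurable_funM.
  have m : measurable_fun setT (fun x : R => normc (pser c x%:C)).
    by have [] := cont_measurable (egrow_entire a0 cg).
  rewrite (_ : (fun x => _ ^+ 2) = (fun x : R => normc (pser c x%:C) * normc (pser c x%:C))).
    exact: measurable_funM.
  by apply/funext.
exact: (measurableT_comp (measurable_powR t) (@normr_measurable R setT)).
Qed.

Lemma E1_ge0 t c : (0 <= E1 t c)%E.
Proof. by apply: integral_ge0 => x _; rewrite lee_fin mulr_ge0 ?sqr_ge0 ?powR_ge0. Qed.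

Lemma E1Z (a : R) t (w : R[i]) c : 0 < a -> egrow a c ->
  E1 t (fun n => w * c n) = ((normc w ^+ 2)%:E * E1 t c)%E.
Proof.
move=> a0 cg; rewrite /E1 -ge0_integralZl_EFin ?sqr_ge0//; last 2 first.
- by move=> x _; rewrite lee_fin mulr_ge0 ?sqr_ge0 ?powR_ge0.
- exact: E1_measurable cg.
apply: eq_integral => x _; rewrite -EFinM mulrA -exprMn -normcM; congr (normc _ ^+ 2 * _)%:E.
have r0 : 0 <= normc x%:C + 1 by rewrite addr_ge0 ?normc_ge0.
have [K cK] := egrow_pradr a0 r0 cg.
by rewrite (pserZ w cK)// ltrDl.
Qed.

Lemma E1_shift1 (a : R) t c : 0 < a -> egrow a c -> -2 < t -> E1 t (shift1 c) = E1 (t + 2) c.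
Proof.
move=> a0 cg t1; apply: eq_integral => x _; congr EFin.
rewrite (pser_shift1 _ a0 cg) normcM normcR exprMn -mulrA mulrCA; congr (_ * _).
(* At 0 both integrands vanish, because [-2 < t] makes the exponent t + 2 nonzero. *)
have [->|x0] := eqVneq x 0.
  by rewrite normr0 expr0n /= mul0r powR0// gt_eqF//; lra.
rewrite addrC powRD; last by rewrite normr_eq0 x0 implybT.
by rewrite -(powR_mulrn 2)// mulrC.
Qed.

Lemma integral_sym (f : R -> \bar R) : measurable_fun setT f -> (forall x, 0 <= f x)%E ->
  (\int[mu]_x f (- x)%R = \int[mu]_x f x)%E.
Proof.
move=> mf f0; have n1 : (-1 : R) != 0 by rewrite oppr_eq0 oner_eq0.
rewrite -(ge0_integral_scale n1 mf f0) normrN1 mul1e.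
by apply: eq_integral => x _; rewrite mulN1r.
Qed.

(* [ce] is the even part; the odd part is [x] times the even series [co]. *)
Definition ce c n : R[i] := if odd n then 0 else c n.
Definition co c n : R[i] := if odd n then 0 else c n.+1.

Lemma egrow_le (a : R) c c' : (forall n, normc (c' n) <= normc (c n)) -> egrow a c -> egrow a c'.
Proof.
move=> cc cg T aT; have [C HC] := cg T aT; exists C => n; apply: le_trans (HC n).
by rewrite ler_wpM2r.
Qed.

Lemma egrow_ce (a : R) c : egrow a c -> egrow a (ce c).
Proof.
by apply: egrow_le => n; rewrite /ce; case: ifP => // _; rewrite (normc0 R) normc_ge0.
Qed.

Lemma egrow_co (a : R) c : 0 < a -> egrow a c -> egrow a (co c).
Proof.
move=> a0 cg T aT; have [C HC] := cg T aT; exists (C * T) => n.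
apply: (@le_trans _ _ (normc (c n.+1) * n.+1`!%:R)); last by rewrite -mulrA -exprS.
rewrite /co; case: ifP => _; first by rewrite (normc0 R) mul0r mulr_ge0 ?normc_ge0.
rewrite ler_wpM2l ?normc_ge0// ler_nat factS leq_pmull//.
Qed.

Lemma even_ce c : evenc (ce c). Proof. by move=> n; rewrite /ce => ->. Qed.
Lemma even_co c : evenc (co c). Proof. by move=> n; rewrite /co => ->. Qed.

Lemma pser_neg c z : evenc c -> pser c (- z) = pser c z.
Proof.
move=> ev; congr csum; apply/funext => n; have [/ev ->|on] := boolP (odd n).
  by rewrite !mul0r.
by rewrite exprNn -signr_odd (negbTE on) expr0 mul1r.
Qed.

Lemma pser_even_odd (a : R) c z : 0 < a -> egrow a c ->
  pser c z = pser (ce c) z + z * pser (co c) z.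
Proof.
move=> a0 cg; rewrite -(pser_shift1 _ a0 (egrow_co a0 cg)).
have r0 : 0 <= normc z + 1 by rewrite addr_ge0 ?normc_ge0.
have zr : normc z < normc z + 1 by rewrite ltrDl.
have [K1 H1] := egrow_pradr a0 r0 (egrow_ce cg).
have [K2 H2] := egrow_pradr a0 r0 (egrow_shift1 a0 (egrow_co a0 cg)).
rewrite -(pserD H1 H2 zr); congr csum; apply/funext => -[|n] /=.
  by rewrite /ce /= addr0.
rewrite /ce /co /=; case: (odd n) => /=; first by rewrite addr0.
by rewrite add0r.
Qed.

Lemma parallelogram (u v : R[i]) : normc (u + v) ^+ 2 + normc (u - v) ^+ 2 =
  2 * (normc u ^+ 2 + normc v ^+ 2).
Proof.
case: u v => [p q] [r s] /=; rewrite !sqr_sqrtr ?addr_ge0 ?sqr_ge0//; ring.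
Qed.

(** Adding the reflected integral and comparing doubled values avoids splitting integrands of
    changing sign, so infinite integrals are allowed. *)
Lemma integral_even_odd (u v w : R -> \bar R) : measurable_fun setT u -> measurable_fun setT v ->
  measurable_fun setT w -> (forall x, 0 <= u x)%E -> (forall x, 0 <= v x)%E -> (forall x, 0 <= w x)%E ->
  (forall x, u x + u (- x)%R = (v x + w x) + (v x + w x))%E ->
  (\int[mu]_x u x = \int[mu]_x v x + \int[mu]_x w x)%E.
Proof.
move=> mfu mfv mfw u0 v0 w0 uvw.
have muN : measurable_fun setT (fun x : R => u (- x)).
  by apply: (measurableT_comp mfu); exact: measurable_funN.
have mvw : measurable_fun setT (fun x => v x + w x)%E by exact: emeasurable_funD.
have vw0 x : (0 <= v x + w x)%E by rewrite adde_ge0.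
have h (x y : \bar R) : (0 <= x)%E -> (0 <= y)%E -> (x + x = y + y)%E -> x = y.
  case: x y => [x| |] [y| |] //= _ _; rewrite -?EFinD // => -[xy].
  by congr EFin; lra.
apply: h; [exact: integral_ge0|by apply: adde_ge0; exact: integral_ge0|].
rewrite -{2}(integral_sym mfu u0) -ge0_integralD// -ge0_integralD// -ge0_integralD//.
by apply: eq_integral => x _; exact: uvw.
Qed.

(** At the points x and -x the function is the sum and the difference of the same two numbers, so
    the parallelogram identity removes the cross term. The factor x of the odd part raises the
    exponent by 2. *)
Lemma E1_even_odd (a : R) t c : 0 < a -> egrow a c -> -1 < t ->
  E1 t c = (E1 t (ce c) + E1 (t + 2) (co c))%E.
Proof.
move=> a0 cg t1; have cog := egrow_co a0 cg; have ceg := egrow_ce cg.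
rewrite -(E1_shift1 a0 cog (lt_trans _ t1)); last by lra.
have sg := egrow_shift1 a0 cog.
apply: integral_even_odd.
- exact: E1_measurable cg.
- exact: E1_measurable ceg.
- exact: E1_measurable sg.
- by move=> x; rewrite lee_fin mulr_ge0 ?sqr_ge0 ?powR_ge0.
- by move=> x; rewrite lee_fin mulr_ge0 ?sqr_ge0 ?powR_ge0.
- by move=> x; rewrite lee_fin mulr_ge0 ?sqr_ge0 ?powR_ge0.
move=> x; rewrite normrN -!EFinD; congr EFin.
rewrite (pser_shift1 _ a0 cog).
have E := pser_even_odd _ a0 cg.
have -> : (- x)%:C = - x%:C :> R[i] by exact: rmorphN.
rewrite (E x%:C) (E (- x%:C)) (pser_neg _ (even_ce c)) (pser_neg _ (even_co c)).
rewrite mulNr -mulrDl parallelogram.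
by rewrite -mulrDl -mulrDl; congr (_ * _); ring.
Qed.

Lemma integral_setCU (I : set R) (f : R -> \bar R) : measurable I -> measurable_fun setT f ->
  (forall x, 0 <= f x)%E ->
  (\int[mu]_x f x = \int[mu]_(x in ~` I) f x + \int[mu]_(x in I) f x)%E.
Proof.
move=> mI mf f0; rewrite -ge0_integral_setU//; first by rewrite setvU.
- exact: measurableC.
- exact: measurable_funTS.
- by apply/disj_setPS => x [].
Qed.

Lemma integral_half (f : R -> \bar R) : measurable_fun setT f -> (forall x, 0 <= f x)%E ->
  (forall x, f (- x)%R = f x) ->
  (\int[mu]_x f x <= \int[mu]_(x in `]0%R, +oo[) f x + \int[mu]_(x in `]0%R, +oo[) f x)%E.
Proof.
move=> mf f0 fe.
have E0 : (\int[mu]_(x in `[0%R, +oo[) f x = \int[mu]_(x in `]0%R, +oo[) f x)%E.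
  by rewrite integral_itv_obnd_cbnd//; exact: measurable_funTS.
have E2 : (\int[mu]_(x in `]-oo, 0%R[) f x <= \int[mu]_(x in `]0%R, +oo[) f x)%E.
  rewrite -E0 ge0_integration_by_substitution0//.
  under [leRHS]eq_integral do rewrite fe.
  apply: ge0_subset_integral => //; first exact: measurable_funTS.
  by move=> x /=; rewrite !in_itv /=; exact: ltW.
rewrite (_ : setT = `]-oo, 0%R[ `|` `[0%R, +oo[); last first.
  by apply/seteqP; split=> // x _ /=; rewrite !in_itv /= andbT; case: ltP => _; [left|right].
rewrite ge0_integral_setU//; last 2 first.
- exact: measurable_funTS.
- by apply/disj_setPS => x /= [] /=; rewrite !in_itv /= andbT => h1 h2; have := lt_le_trans h1 h2; rewrite ltxx.
by rewrite E0; apply: leeD.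
Qed.

Lemma weight_finite (t M : R) : -1 < t -> 0 < M -> exists W : R, 0 <= W /\
  (\int[mu]_(x in `[(- M)%R, M]) (`|x| `^ t)%:E <= W%:E)%E.
Proof.
move=> t1 M0; pose I := (t + 1)^-1 * M `^ (t + 1).
have I0 : 0 <= I by rewrite mulr_ge0 ?powR_ge0// invr_ge0; lra.
exists (I + I); split; first by rewrite addr_ge0.
pose f := ((fun x : R => (`|x| `^ t)%:E) \_ `[(- M)%R, M])%E.
have mI : measurable (`[(- M)%R, M]%classic : set R) by exact: measurable_itv.
have mp : measurable_fun setT (fun x : R => (`|x| `^ t)%:E).
  apply/measurable_EFinP.
  exact: (measurableT_comp (measurable_powR t) (@normr_measurable R setT)).
rewrite integral_mkcond -/f.
have f0 x : (0 <= f x)%E by apply: erestrict_ge0 => y _; rewrite lee_fin powR_ge0.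
have mf : measurable_fun setT f.
  by apply/(measurable_restrictT _ _).1 => //; exact: measurable_funTS.
apply: le_trans (integral_half mf f0 _) _.
  move=> x; rewrite /f /patch; congr (if _ then _ else _); last by rewrite normrN.
  apply/idP/idP; rewrite !inE /= !in_itv /=; lra.
suff h : (\int[mu]_(x in `]0%R, +oo[) f x <= I%:E)%E by rewrite EFinD; exact: leeD.
rewrite /f -integral_mkcondr (_ : _ `&` _ = `]0%R, M]%classic); last first.
  apply/seteqP; split => x /=; rewrite !in_itv /=; first by move=> [/andP[-> _] /andP[_ ->]].
  by move=> /andP[x0 xM]; rewrite x0 xM andbT; split=> //; rewrite (le_trans _ (ltW x0))// oppr_le0 ltW.
apply: le_trans (integral_powR_0 t1 M0); rewrite le_eqVlt; apply/orP; left; apply/eqP.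
by apply: eq_integral => x; rewrite inE /= in_itv /= => /andP[x0 _]; rewrite gtr0_norm.
Qed.

Lemma pser_bounded (a M : R) c : 0 < a -> 0 <= M -> egrow a c ->
  exists2 G : R, 0 <= G & forall x : R, `|x| <= M -> normc (pser c x%:C) <= G.
Proof.
move=> a0 M0 cg; have [|C HC] := cg (a + 1); first by rewrite ltrDl.
have C0 : 0 <= C by exact: growth_const_ge0 HC.
have a1 : 0 <= a + 1 by rewrite addr_ge0 ?(ltW a0).
exists (C * expR ((a + 1) * M)) => [|x xM]; first by rewrite mulr_ge0 ?expR_ge0.
apply: le_trans (normc_csum (normc_pser_exp _ a1 HC)) _.
by rewrite normcR ler_wpM2l// ler_expR ler_wpM2l.
Qed.

(** Outside [-1, 1] the larger exponent dominates; inside, the function is bounded and the weight is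
    integrable since -1 < s. *)
Lemma E1_fin (a s t : R) c : 0 < a -> egrow a c -> -1 < s -> s <= t ->
  (E1 t c < +oo)%E -> (E1 s c < +oo)%E.
Proof.
move=> a0 cg s1 st ct.
have [G G0 HG] := pser_bounded a0 ler01 cg.
have [W [W0 HW]] := weight_finite s1 ltr01.
pose I : set R := `[(- 1)%R, 1%R]%classic.
have mI : measurable I by exact: measurable_itv.
pose f t (x : R) := (normc (pser c x%:C) ^+ 2 * `|x| `^ t)%:E.
have f0 u x : (0 <= f u x)%E by rewrite lee_fin mulr_ge0 ?sqr_ge0 ?powR_ge0.
have mf u : measurable_fun setT (f u) by exact: E1_measurable cg.
have mp : measurable_fun setT (fun x : R => (`|x| `^ s)%:E).
  apply/measurable_EFinP.
  exact: (measurableT_comp (measurable_powR s) (@normr_measurable R setT)).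
rewrite /E1 (integral_setCU mI (mf s) (f0 s)).
apply: lte_add_pinfty.
  apply: le_lt_trans ct; apply: (@le_trans _ _ (\int[mu]_(x in ~` I) f t x)%E).
    apply: ge0_le_integral => //; first exact: measurableC.
      by apply: measurable_funS (mf s).
      by apply: measurable_funS (mf t).
    move=> x; rewrite /I /= in_itv /= => /negP; rewrite -ler_norml -ltNge => x1.
    by rewrite lee_fin ler_wpM2l ?sqr_ge0// ler_powR// ltW.
  by apply: ge0_subset_integral => //; do ?[exact: measurableC|exact: mf].
apply: (@le_lt_trans _ _ (\int[mu]_(x in I) ((G ^+ 2)%:E * (`|x| `^ s)%:E))%E).
  apply: ge0_le_integral => //.
  - by apply: measurable_funS (mf s).
  - by apply: measurable_funeM; apply: measurable_funS mp.
  move=> x; rewrite /I /= in_itv /= -ler_norml => x1.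
  by rewrite -EFinM lee_fin ler_wpM2r ?powR_ge0// lerXn2r ?nnegrE ?normc_ge0// HG.
rewrite ge0_integralZl_EFin ?sqr_ge0//; last by apply: measurable_funS mp.
apply: (@le_lt_trans _ _ ((G ^+ 2)%:E * W%:E)%E); last by rewrite -EFinM ltry.
by apply: lee_wpmul2l => //; rewrite lee_fin sqr_ge0.
Qed.

Lemma weight_measurable t : measurable_fun setT (fun x : R => (`|x| `^ t)%:E).
Proof.
apply/measurable_EFinP.
exact: (measurableT_comp (measurable_powR t) (@normr_measurable R setT)).
Qed.

Lemma ge0_integralD_line (D : set R) (f g : R -> \bar R) : measurable D -> measurable_fun setT f ->
  measurable_fun setT g -> (forall x, 0 <= f x)%E -> (forall x, 0 <= g x)%E ->
  (\int[mu]_(x in D) (f x + g x) = \int[mu]_(x in D) f x + \int[mu]_(x in D) g x)%E.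
Proof.
move=> mD mf mg f0 g0; rewrite ge0_integralD//.
- by apply: measurable_funS mf.
- by apply: measurable_funS mg.
Qed.

Lemma ge0_integralZ_line (D : set R) (k : R) (f : R -> \bar R) : measurable D -> 0 <= k ->
  measurable_fun setT f -> (forall x, 0 <= f x)%E ->
  (\int[mu]_(x in D) (k%:E * f x) = k%:E * \int[mu]_(x in D) f x)%E.
Proof.
by move=> mD k0 mf f0; rewrite ge0_integralZl_EFin//; apply: measurable_funS mf.
Qed.

Lemma ge0_le_integral_line (D : set R) (f g : R -> \bar R) : measurable D -> measurable_fun setT f ->
  measurable_fun setT g -> (forall x, 0 <= f x)%E -> (forall x, D x -> f x <= g x)%E ->
  (\int[mu]_(x in D) f x <= \int[mu]_(x in D) g x)%E.
Proof.
move=> mD mf mg f0 fg; apply: ge0_le_integral => //.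
- by apply: measurable_funS mf.
- by apply: measurable_funS mg.
Qed.

Lemma fin_num_shift_le (lam th : R) (xs xt ys yt : \bar R) : 0 <= th ->
  xs \is a fin_num -> xt \is a fin_num -> ys \is a fin_num -> yt \is a fin_num ->
  (lam%:E * xs <= xt)%E -> (lam%:E * ys + th%:E * xt <= yt + (lam * th)%:E * xs)%E ->
  (lam%:E * ys <= yt)%E.
Proof.
move: xs xt ys yt => [xs| |] [xt| |] [ys| |] [yt| |] // th0 _ _ _ _.
rewrite -!EFinM -!EFinD !lee_fin => h; have := ler_wpM2l th0 h; lra.
Qed.

(* The constant [th = lam ^ (2 / (t - s))] is chosen so that the factors of
   [(|x| ^ (t - s) - lam) * (x ^ 2 - th)] change sign together; this product
   is therefore nonnegative, and is integrated against [|f|^2 |x|^s]. *)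
Lemma E1_shift_le (a lam s t : R) c : 0 < a -> egrow a c -> -1 < s -> s < t -> 0 <= lam ->
  (lam%:E * E1 s c <= E1 t c)%E -> (lam%:E * E1 (s + 2) c <= E1 (t + 2) c)%E.
Proof.
move=> a0 cg s1 st l0 h.
(* Apart from this trivial case all four energies are finite, which the cancellation in
   [fin_num_shift_le] requires. *)
have [->|] := eqVneq (E1 (t + 2) c) +oo%E; first by rewrite leey.
rewrite -ltey => At2.
have t1 := lt_trans s1 st.
have At : (E1 t c < +oo)%E by apply: (E1_fin a0 cg t1 _ At2); rewrite lerDl.
have As : (E1 s c < +oo)%E.
  by apply: (E1_fin a0 cg s1 _ At2); rewrite (le_trans (ltW st))// lerDl.
have As2 : (E1 (s + 2) c < +oo)%E.
  by apply: (E1_fin a0 cg _ _ At2); rewrite ?lerD2r ?(ltW st)// (lt_trans s1)// ltrDl.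
have fin u : (E1 u c < +oo)%E -> E1 u c \is a fin_num by move=> h'; rewrite ge0_fin_numE ?E1_ge0.
pose f u (x : R) := (normc (pser c x%:C) ^+ 2 * `|x| `^ u)%:E.
have f0 u x : (0 <= f u x)%E by rewrite lee_fin mulr_ge0 ?sqr_ge0 ?powR_ge0.
have mf u : measurable_fun setT (f u) by exact: E1_measurable cg.
pose q := t - s; have q0 : 0 < q by rewrite subr_gt0.
pose th := lam `^ (2 / q); have th0 : 0 <= th by exact: powR_ge0.
have mZ (k u : R) : measurable_fun setT (fun x => k%:E * f u x)%E by exact: measurable_funeM.
have Z0 (k u : R) x : 0 <= k -> (0 <= k%:E * f u x)%E by move=> k0; rewrite mule_ge0.
have IZ (k u : R) : 0 <= k -> (\int[mu]_x (k%:E * f u x) = k%:E * E1 u c)%E.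
  by move=> k0; exact: ge0_integralZ_line measurableT k0 (mf u) (f0 u).
have lth : 0 <= lam * th by rewrite mulr_ge0.
have key : (lam%:E * E1 (s + 2) c + th%:E * E1 t c <= E1 (t + 2) c + (lam * th)%:E * E1 s c)%E.
  rewrite -(IZ _ _ l0) -(IZ _ _ th0) -(IZ _ _ lth).
  have -> : E1 (t + 2) c = (\int[mu]_x f (t + 2)%R x)%E by [].
  have m1 : measurable_fun setT (fun x => lam%:E * f (s + 2)%R x + th%:E * f t x)%E.
    exact: emeasurable_funD.
  have m2 : measurable_fun setT (fun x => f (t + 2)%R x + (lam * th)%:E * f s x)%E.
    exact: emeasurable_funD.
  have g1 x : (0 <= lam%:E * f (s + 2)%R x + th%:E * f t x)%E by rewrite adde_ge0 ?Z0.
  have g2 x : (0 <= f (t + 2)%R x + (lam * th)%:E * f s x)%E by rewrite adde_ge0 ?Z0.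
  rewrite -(ge0_integralD_line measurableT (mZ lam (s + 2)) (mZ th t) (fun x => Z0 _ _ x l0) (fun x => Z0 _ _ x th0)).
  rewrite -(ge0_integralD_line measurableT (mf (t + 2)) (mZ (lam * th) s) (f0 (t + 2)) (fun x => Z0 _ _ x lth)).
  (* The point 0 is discarded because a power with a sum as exponent factors in general only over a
     nonzero base. *)
  apply: ae_ge0_le_integral => //.
  exists [set 0]; split; [exact: measurable_set1|exact: lebesgue_measure_set1|].
  move=> x /= H; apply: contrapT => /eqP x0; apply: H => _.
  rewrite /f -!EFinM -!EFinD lee_fin.
  set N := normc _ ^+ 2; have N0 : 0 <= N by exact: sqr_ge0.
  have X0 : 0 < `|x| by rewrite normr_gt0.
  have P2 u : `|x| `^ (u + 2) = `|x| `^ u * `|x| ^+ 2.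
    rewrite powRD; last by rewrite (gt_eqF X0) implybT.
    by rewrite -(powR_mulrn 2) ?ltW.
  rewrite !P2.
  have -> : `|x| `^ t = `|x| `^ s * `|x| `^ q.
    rewrite -powRD; last by rewrite (gt_eqF X0) implybT.
    by rewrite /q addrC subrK.
  have S0 := powR_ge0 `|x| s.
  have E2 : (`|x| `^ q) `^ (2 / q) = `|x| ^+ 2.
    rewrite -powRrM mulrCA divff ?gt_eqF// mulr1 -(powR_mulrn 2) ?ltW//.
  have p0 : 0 <= 2 / q by rewrite divr_ge0// ltW.
  have D : 0 <= (`|x| `^ q - lam) * (`|x| ^+ 2 - th).
    have [lx|xl] := leP lam (`|x| `^ q).
      apply: mulr_ge0; rewrite subr_ge0// -E2 /th.
      by rewrite ge0_ler_powR ?nnegrE ?powR_ge0.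
    apply: mulr_le0; rewrite subr_le0 ?(ltW xl)// -E2 /th.
    by rewrite ge0_ler_powR ?nnegrE ?powR_ge0// ltW.
  rewrite -subr_ge0; move: D; set Y := `|x| `^ q; set X2 := `|x| ^+ 2.
  set S := `|x| `^ s in S0 *; move=> D.
  have -> : N * (S * Y * X2) + lam * th * (N * S) - (lam * (N * (S * X2)) + th * (N * (S * Y)))
     = N * (S * ((Y - lam) * (X2 - th))) by ring.
  by rewrite mulr_ge0// mulr_ge0.
exact: fin_num_shift_le th0 (fin _ As) (fin _ At) (fin _ As2) (fin _ At2) h key.
Qed.

Lemma E1_half_le (a e : R) c (s : bool) : 0 < a -> egrow a c ->
  (\int[mu]_(x in `]0%R, +oo[) (normc (pser c ((-1) ^+ s * x)%:C) ^+ 2 * x `^ e)%:E <= E1 e c)%E.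
Proof.
move=> a0 cg.
pose f (x : R) := (normc (pser c x%:C) ^+ 2 * `|x| `^ e)%:E.
have f0 x : (0 <= f x)%E by rewrite lee_fin mulr_ge0 ?sqr_ge0 ?powR_ge0.
have mf : measurable_fun setT f by exact: E1_measurable cg.
pose w : R := (-1) ^+ s.
have w1 : `|w| = 1 by rewrite /w normrX normrN1 expr1n.
have wn0 : w != 0 by rewrite -normr_eq0 w1 oner_eq0.
have mfw : measurable_fun setT (fun x : R => f (w * x)).
  by apply: (measurableT_comp mf); exact: measurable_scale.
rewrite /E1 -/(f _) -(ge0_integral_scale wn0 mf f0) w1 mul1e.
rewrite (_ : (\int[mu]_(x in _) _)%E = (\int[mu]_(x in `]0%R, +oo[) f (w * x)%R)%E).
  by apply: ge0_subset_integral => //; exact: measurable_itv.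
apply: eq_integral => x; rewrite inE /= in_itv /= andbT => x0.
by rewrite /f normrM w1 mul1r (gtr0_norm x0).
Qed.

(* Multiplication by [x] lowers the exponent of the weight by 2, and brings it
   into the range [-1, 1) required by [coef_bound]. *)
Lemma E1_coef_bound (a b T : R) : 0 < a -> -1 < b -> a < T ->
  exists K : R, forall c, egrow a c -> (E1 b c <= 1)%E -> forall n, normc (c n) * n`!%:R <= K * T ^+ n.
Proof.
move=> a0 b1 aT; have T0 := lt_trans a0 aT.
suff H m b' : -1 + m%:R * 2 <= b' -> b' < 1 + m%:R * 2 ->
  exists K : R, forall c, egrow a c -> (E1 b' c <= 1)%E -> forall n, normc (c n) * n`!%:R <= K * T ^+ n.
  have b0 : 0 <= (b + 1) / 2 by lra.
  have /andP[h1 h2] := truncn_itv b0.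
  move: (Num.truncn _) h1 h2 => M h1; rewrite -[M.+1]addn1 natrD => h2.
  by apply: (H M); lra.
elim: m b' => [|m IH] b'.
  rewrite mul0r !addr0 => h1 h2; have [K HK] := coef_bound a0 h1 h2 aT.
  exists K => c cg cE; apply: (HK c cg) => s.
  exact: le_trans (E1_half_le _ _ a0 cg) cE.
rewrite -addn1 natrD => h1 h2; have m0 : 0 <= m%:R :> R by [].
have [||K HK] := IH (b' - 2); [lra|lra|].
exists (K * T) => c cg cE n.
have := HK (shift1 c) (egrow_shift1 a0 cg) _ n.+1.
rewrite (E1_shift1 a0 cg); last lra.
rewrite subrK => /(_ cE); rewrite exprS mulrA; apply: le_trans.
by rewrite ler_wpM2l ?normc_ge0// ler_nat factS leq_pmull.
Qed.

End line_energy.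

(** * Existence of an even minimizer in dimension one *)

Section minimizer.
Variable R : realType.
Notation mu := (@lebesgue_measure R).
Implicit Types (c g : nat -> R[i]) (a s t : R).

Lemma E1_fin_num t c : (E1 t c < +oo)%E -> E1 t c \is a fin_num.
Proof. by rewrite ge0_fin_numE ?E1_ge0. Qed.

Lemma ultra_bounded (U : set_system nat) (u : nat -> R) (B : R) : UltraFilter U ->
  (forall j, `|u j| <= B) -> exists l : R, forall e : R, 0 < e -> U [set j | `|u j - l| <= e].
Proof.
move=> UU uB.
have FP : ProperFilter (u @ U) by exact: fmap_proper_filter.
have FB : (u @ U) `[(- B)%R, B]%classic.
  apply: (@filterS _ U _ setT); [move=> j _|exact: filterT].
  by rewrite /= in_itv /= -ler_norml; exact: uB.
have [l [_ cl]] := @segment_compact R (- B) B (u @ U) FP FB.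
exists l => e e0; have [//|H] := in_ultra_setVsetC [set j | `|u j - l| <= e] UU.
have [y [yA yN]] := cl (~` [set y | `|y - l| <= e]) (ball l e) H (nbhsx_ballx _ _ e0).
by exfalso; apply: yA => /=; rewrite distrC; exact: ltW yN.
Qed.

(** Bounded sequences converge along an ultrafilter, and the same [U] serves every index n; this
    replaces a diagonal subsequence. *)
Lemma ultra_coef (U : set_system nat) (c : nat -> nat -> R[i]) (B : nat -> R) : UltraFilter U ->
  (forall j n, normc (c j n) <= B n) ->
  exists g, forall n (e : R), 0 < e -> U [set j | normc (c j n - g n) <= e].
Proof.
move=> UU cB.
suff H n : exists w : R[i], forall e : R, 0 < e -> U [set j | normc (c j n - w) <= e].
  by have [g Hg] := choice H; exists g.
have [|l1 H1] := @ultra_bounded U (fun j => Re (c j n)) (B n) UU.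
  by move=> j; exact: le_trans (le_Re_normc _) (cB j n).
have [|l2 H2] := @ultra_bounded U (fun j => Im (c j n)) (B n) UU.
  by move=> j; exact: le_trans (le_Im_normc _) (cB j n).
exists (l1 +i* l2) => e e0; have e20 : 0 < e / 2 by rewrite divr_gt0.
apply: filterS2 (H1 _ e20) (H2 _ e20) => j /= h1 h2.
apply: le_trans (normc_le_ReIm _) _; rewrite cReB cImB.
by rewrite [leRHS](splitr e); exact: lerD.
Qed.

Lemma ultra_limit_le (U : set_system nat) (u : nat -> R[i]) (w : R[i]) (b : R) : UltraFilter U ->
  (forall j, normc (u j) <= b) -> (forall e : R, 0 < e -> U [set j | normc (u j - w) <= e]) ->
  normc w <= b.
Proof.
move=> UU ub H; apply/ler_addgt0Pr => e e0.
have [j /= hj] := filter_ex (H e e0).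
have -> : w = u j - (u j - w) by rewrite subKr.
by apply: le_trans (le_normcB _ _) _; exact: lerD.
Qed.

(** A common bound at the doubled radius makes all terms beyond some N smaller than [eta] at radius
    [r]; only finitely many coefficients are left, and these converge along [U]. *)
Lemma ultra_prad (U : set_system nat) (c : nat -> nat -> R[i]) g (r K eta : R) : UltraFilter U ->
  0 < r -> 0 < eta -> (forall j, prad (fun n => c j n - g n) (2 * r) K) ->
  (forall n (e : R), 0 < e -> U [set j | normc (c j n - g n) <= e]) ->
  U [set j | prad (fun n => c j n - g n) r eta].
Proof.
move=> UU r0 eta0 cK H.
have K0 : 0 <= K := prad_ge0 (cK 0%N).
pose N := Num.bound (K / eta).
have KN : K <= eta * 2 ^+ N.
  rewrite -ler_pdivrMl// mulrC; apply: le_trans (ltW (archi_boundP (divr_ge0 K0 (ltW eta0)))) _.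
  by rewrite -natrX ler_nat ltnW// ltn_expl.
have FN m : U [set j | forall n, (n < m)%N -> normc (c j n - g n) * r ^+ n <= eta].
  elim: m => [|m IH]; first by apply: filterS filterT.
  have rm : 0 < r ^+ m by rewrite exprn_gt0.
  apply: filterS2 IH (H m (eta / r ^+ m) _); last by rewrite divr_gt0.
  move=> j /= h1 h2 n; rewrite ltnS leq_eqVlt => /predU1P[->|]; last exact: h1.
  by rewrite -ler_pdivlMr.
apply: filterS (FN N) => j /= hj n; have [/hj//|Nn] := ltnP n N.
have p2 : 0 < 2 ^+ n :> R by rewrite exprn_gt0.
rewrite -(ler_pM2r p2) -mulrA -exprMn (mulrC r); apply: le_trans (cK j n) _.
apply: le_trans KN _; by rewrite ler_wpM2l ?(ltW eta0)// ler_weXn2l// ler1n.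
Qed.

Lemma pser_small c (r eta : R) z : 0 < r -> prad c r eta -> normc z <= r / 2 ->
  normc (pser c z) <= 2 * eta.
Proof.
move=> r0 cr zr; have rr : r / 2 < r by rewrite ltr_pdivrMr// ltr_pMr// ltr1n.
have := normc_csum (bsum_pser r0 cr zr rr).
rewrite (_ : eta / _ = 2 * eta)//.
have -> : r / 2 / r = 2^-1 by rewrite mulrAC divff ?gt_eqF// mul1r.
by field.
Qed.

Lemma growth_bounded c (C T M x : R) : 0 <= T -> (forall n, normc (c n) * n`!%:R <= C * T ^+ n) ->
  `|x| <= M -> normc (pser c x%:C) <= C * expR (T * M).
Proof.
move=> T0 HC xM; have C0 := growth_const_ge0 HC.
apply: le_trans (normc_csum (normc_pser_exp _ T0 HC)) _.
by rewrite normcR ler_wpM2l// ler_expR ler_wpM2l.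
Qed.

Lemma sqr_le_add (p q G eta : R) : 0 <= p -> 0 <= q -> p <= G -> q <= G -> 0 <= eta ->
  p - q <= eta -> p ^+ 2 <= q ^+ 2 + 2 * G * eta.
Proof.
move=> p0 q0 pG qG e0 pq; rewrite -lerBlDl subr_sqr.
apply: (@le_trans _ _ (eta * (p + q))); first by rewrite ler_wpM2r ?addr_ge0.
by rewrite mulrC ler_wpM2r//; lra.
Qed.

Definition E1loc t (M : R) c : \bar R :=
  (\int[mu]_(x in `[(- M)%R, M]) (normc (pser c x%:C) ^+ 2 * `|x| `^ t)%:E)%E.

Lemma E1loc_le a t M c : 0 < a -> egrow a c -> (E1loc t M c <= E1 t c)%E.
Proof.
move=> a0 cg; have mI : measurable (`[(- M)%R, M]%classic : set R) by exact: measurable_itv.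
have mf := E1_measurable t a0 cg.
apply: ge0_subset_integral => //.
by move=> x _; rewrite lee_fin mulr_ge0 ?sqr_ge0 ?powR_ge0.
Qed.

Lemma E1loc_close a t (M G eta W : R) c g : 0 < a -> egrow a c -> egrow a g -> 0 <= G -> 0 <= eta ->
  (forall x : R, `|x| <= M -> normc (pser c x%:C) <= G) ->
  (forall x : R, `|x| <= M -> normc (pser g x%:C) <= G) ->
  (forall x : R, `|x| <= M -> normc (pser c x%:C - pser g x%:C) <= eta) ->
  (\int[mu]_(x in `[(- M)%R, M]) (`|x| `^ t)%:E <= W%:E)%E ->
  (E1loc t M c <= E1loc t M g + (2 * G * eta * W)%:E)%E.
Proof.
move=> a0 cg gg G0 e0 cG gG cge HW.
have k0 : 0 <= 2 * G * eta by rewrite !mulr_ge0.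
have mI : measurable (`[(- M)%R, M]%classic : set R) by exact: measurable_itv.
have mw := weight_measurable t.
have w0 (x : R) : (0 <= (`|x| `^ t)%:E)%E by rewrite lee_fin powR_ge0.
apply: (@le_trans _ _ (E1loc t M g + (2 * G * eta)%:E * \int[mu]_(x in `[(- M)%R, M]) (`|x| `^ t)%:E)%E).
  rewrite /E1loc -(ge0_integralZ_line mI k0 mw w0) -(ge0_integralD_line mI).
  - apply: (ge0_le_integral_line mI); first exact: E1_measurable cg.
    + by apply: emeasurable_funD; [exact: E1_measurable gg|exact: measurable_funeM].
    + by move=> x; rewrite lee_fin mulr_ge0 ?sqr_ge0 ?powR_ge0.
    move=> x; rewrite /= in_itv /= -ler_norml => xM.
    rewrite -EFinM -EFinD lee_fin -mulrDl ler_wpM2r ?powR_ge0//.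
    apply: (sqr_le_add (normc_ge0 _) (normc_ge0 _) (cG x xM) (gG x xM) e0).
    exact: le_trans (lerB_normc _ _) (cge x xM).
  - exact: E1_measurable gg.
  - exact: measurable_funeM.
  - by move=> x; rewrite lee_fin mulr_ge0 ?sqr_ge0 ?powR_ge0.
  - by move=> x; rewrite mule_ge0.
by apply: leeD => //; rewrite [(2 * G * eta * W)%:E]EFinM; apply: lee_wpmul2l.
Qed.

Lemma E1_tail a s t (M : R) c : 0 < a -> egrow a c -> 0 < M -> s <= t ->
  (E1 s c <= E1loc s M c + (M `^ (s - t))%:E * E1 t c)%E.
Proof.
move=> a0 cg M0 st.
have f0 u (x : R) : (0 <= (normc (pser c x%:C) ^+ 2 * `|x| `^ u)%:E)%E.
  by rewrite lee_fin mulr_ge0 ?sqr_ge0 ?powR_ge0.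
have mI : measurable (`[(- M)%R, M]%classic : set R) by exact: measurable_itv.
have mIC : measurable (~` `[(- M)%R, M]%classic : set R) by exact: measurableC.
rewrite [leLHS](integral_setCU mI (E1_measurable s a0 cg) (f0 s)) addeC.
rewrite /E1 -(ge0_integralZ_line measurableT (powR_ge0 _ _) (E1_measurable t a0 cg) (f0 t)).
apply: leeD => //.
have k0 (x : R) : (0 <= (M `^ (s - t))%:E * (normc (pser c x%:C) ^+ 2 * `|x| `^ t)%:E)%E.
  by rewrite mule_ge0 ?lee_fin ?powR_ge0//; exact: f0.
have mk : measurable_fun setT (fun x : R => (M `^ (s - t))%:E * (normc (pser c x%:C) ^+ 2 * `|x| `^ t)%:E)%E.
  by apply: measurable_funeM; exact: E1_measurable cg.
apply: (@le_trans _ _ (\int[mu]_(x in ~` `[(- M)%R, M]%classic) ((M `^ (s - t))%:E * (normc (pser c x%:C) ^+ 2 * `|x| `^ t)%:E))%E).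
  apply: (ge0_le_integral_line mIC _ mk (f0 s)); first exact: E1_measurable cg.
  move=> x /=; rewrite in_itv /= => /negP; rewrite -ler_norml -ltNge => xM.
  have X0 : 0 < `|x| := lt_trans M0 xM.
  rewrite -EFinM lee_fin mulrCA ler_wpM2l ?sqr_ge0//.
  have -> : `|x| `^ s = `|x| `^ (s - t) * `|x| `^ t.
    by rewrite -powRD ?subrK// (gt_eqF X0) implybT.
  rewrite ler_wpM2r ?powR_ge0//.
  rewrite -[s - t]opprB !powRN lef_pV2 ?posrE ?powR_gt0//.
  by rewrite ge0_ler_powR ?nnegrE ?subr_ge0 ?(ltW M0) ?(ltW X0) ?(ltW xM).
by apply: ge0_subset_integral.
Qed.

Lemma E1_eq0 a s t c : 0 < a -> egrow a c -> E1 t c = 0%E -> E1 s c = 0%E.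
Proof.
move=> a0 cg E0; apply/eqP; rewrite eq_le E1_ge0 andbT.
have f0 u (x : R) : (0 <= (normc (pser c x%:C) ^+ 2 * `|x| `^ u)%:E)%E.
  by rewrite lee_fin mulr_ge0 ?sqr_ge0 ?powR_ge0.
have ae1 : ae_eq mu setT (fun x : R => (normc (pser c x%:C) ^+ 2 * `|x| `^ t)%:E) (cst 0%E).
  apply/(ae_eq_integral_abs mu measurableT (E1_measurable t a0 cg)).
  by rewrite -[RHS]E0; apply: eq_integral => x _; rewrite gee0_abs.
have ae0 : \forall x \ae mu, x != 0.
  exists [set 0]; split; [exact: measurable_set1|exact: lebesgue_measure_set1|].
  by move=> x /= /negP; rewrite negbK => /eqP.
rewrite -[leRHS](integral0 mu (setT : set R)).
apply: ae_ge0_le_integral => //; first exact: E1_measurable cg.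
apply: filterS2 ae1 ae0 => x /(_ I) /eqP; rewrite /cst eqe mulf_eq0 => /orP[/eqP -> _ _|].
  by rewrite mul0r.
by move=> /eqP /powR_eq0_eq0 /eqP; rewrite normr_eq0 => /eqP ->; rewrite eqxx.
Qed.

Lemma egrowZ a (w : R[i]) c : egrow a c -> egrow a (fun n => w * c n).
Proof.
move=> cg T aT; have [C HC] := cg T aT; exists (normc w * C) => n.
by rewrite normcM -!mulrA ler_wpM2l ?normc_ge0.
Qed.

Lemma E1_normalize a s t c : 0 < a -> egrow a c -> evenc c -> E1 s c != 0%E -> (E1 s c < +oo)%E ->
  exists c', [/\ egrow a c', evenc c', E1 s c' = 1%E &
    E1 t c' = ((fine (E1 s c))^-1%:E * E1 t c)%E].
Proof.
move=> a0 cg ev n0 oo; set B := fine _.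
have fB : E1 s c = B%:E by rewrite fineK// ge0_fin_numE ?E1_ge0.
have B0 : 0 < B.
  by rewrite -lte_fin -fB lt_neqAle eq_sym n0 E1_ge0.
pose w : R[i] := (Num.sqrt B^-1)%:C.
have w2 : normc w ^+ 2 = B^-1.
  by rewrite normcR ger0_norm ?sqrtr_ge0// sqr_sqrtr// invr_ge0 ltW.
exists (fun n => w * c n); split.
- exact: egrowZ.
- by move=> n /ev ->; rewrite mulr0.
- by rewrite (E1Z _ _ a0 cg) w2 fB -EFinM mulVf ?gt_eqF.
- by rewrite (E1Z _ _ a0 cg) w2.
Qed.

Lemma E1_eps_le (x y : \bar R) (B : R) : 0 <= B ->
  (forall e : R, 0 < e -> (x <= y + (e * B)%:E)%E) -> (x <= y)%E.
Proof.
move=> B0 H; apply/lee_addgt0Pr => e e0.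
have B1 : 0 < B + 1 by rewrite ltr_wpDl.
apply: le_trans (H (e / (B + 1)) (divr_gt0 e0 B1)) _; apply: leeD => //.
rewrite lee_fin -mulrA ler_piMr ?(ltW e0)// mulrC ler_pdivrMr// mul1r lerDl//.
Qed.

Section limit.
Variables (a s t : R) (U : set_system nat) (c : nat -> nat -> R[i]).
Hypotheses (a0 : 0 < a) (s1 : -1 < s) (UU : UltraFilter U).
Hypothesis cg : forall j, egrow a (c j).
Hypothesis cE : forall j, (E1 s (c j) <= 1)%E.

(** The constants of [E1_coef_bound] depend on [T] alone, so they are shared by all [c j] and
    inherited by the limit, and convergence on [-M, M] is uniform. The exponent [u] is therefore
    free: although only [E1 s] is assumed bounded, the comparison serves other exponents too. *)
Lemma ultra_limit : exists g, [/\ egrow a g,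
  (forall n (e : R), 0 < e -> U [set j | normc (c j n - g n) <= e]) &
  forall M : R, 0 < M -> exists2 G : R, 0 <= G &
    forall eta : R, 0 < eta -> U [set j | forall u W, -1 < u ->
     (\int[mu]_(x in `[(- M)%R, M]) (`|x| `^ u)%:E <= W%:E)%E ->
     (E1loc u M g <= E1loc u M (c j) + (2 * G * eta * W)%:E)%E /\
     (E1loc u M (c j) <= E1loc u M g + (2 * G * eta * W)%:E)%E]].
Proof.
have KT T : a < T -> exists K : R, forall j n, normc (c j n) * n`!%:R <= K * T ^+ n.
  move=> aT; have [K HK] := E1_coef_bound a0 s1 aT.
  by exists K => j n; exact: HK (cg j) (cE j) n.
have a1 : a < a + 1 by rewrite ltrDl.
have T0 : 0 < a + 1 := lt_trans a0 a1.
have [K HK] := KT _ a1.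
have cB j n : normc (c j n) <= K * (a + 1) ^+ n.
  apply: le_trans (HK j n); rewrite ler_peMr ?normc_ge0// ler1n fact_gt0//.
have [g Hg] := ultra_coef UU cB.
have gB T K' : (forall j n, normc (c j n) * n`!%:R <= K' * T ^+ n) ->
    forall n, normc (g n) * n`!%:R <= K' * T ^+ n.
  move=> H n; have f0 : 0 < n`!%:R :> R by rewrite ltr0n fact_gt0.
  rewrite -ler_pdivlMr//; apply: (@ultra_limit_le U (fun j => c j n) _ _ UU _ (Hg n)) => j.
  by rewrite ler_pdivlMr.
have gg : egrow a g by move=> T aT; have [K' HK'] := KT T aT; exists K'; exact: gB HK'.
exists g; split => // M M0.
have HKg := gB _ _ HK.
pose G := K * expR ((a + 1) * M).
have K0 : 0 <= K := growth_const_ge0 HKg.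
exists G; first by rewrite mulr_ge0 ?expR_ge0.
move=> eta eta0.
have r0 : 0 < 2 * M by rewrite mulr_gt0.
have r20 : 0 <= 2 * (2 * M) by rewrite mulr_ge0// ltW.
have pB j : prad (fun n => c j n - g n) (2 * (2 * M))
   (K * expR ((a + 1) * (2 * (2 * M))) + K * expR ((a + 1) * (2 * (2 * M)))).
  exact: pradB r20 (egrow_prad (ltW T0) r20 (HK j)) (egrow_prad (ltW T0) r20 HKg).
have e20 : 0 < eta / 2 by rewrite divr_gt0.
apply: filterS (ultra_prad UU r0 e20 pB Hg) => j /= hj u W u1 HW.
have cl (x : R) : `|x| <= M -> normc (pser (c j) x%:C - pser g x%:C) <= eta.
  move=> xM; have xr : normc x%:C <= 2 * M / 2 by rewrite normcR mulrC mulKf.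
  have := pser_small r0 hj xr; rewrite (mulrC 2) divfK//.
  have xr2 : normc x%:C < 2 * (2 * M).
    apply: le_lt_trans xr _; rewrite mulrC mulKf// mulrA ltr_pMl//; lra.
  by rewrite (pserB (egrow_prad (ltW T0) r20 (HK j)) (egrow_prad (ltW T0) r20 HKg) xr2).
have cl' (x : R) : `|x| <= M -> normc (pser g x%:C - pser (c j) x%:C) <= eta.
  by move=> /cl; rewrite -normcN opprB.
have cGx (x : R) : `|x| <= M -> normc (pser (c j) x%:C) <= G by exact: growth_bounded (ltW T0) (HK j).
have gGx (x : R) : `|x| <= M -> normc (pser g x%:C) <= G by exact: growth_bounded (ltW T0) HKg.
have G0 : 0 <= G by rewrite mulr_ge0 ?expR_ge0.
split.
- exact: (E1loc_close a0 gg (cg j) G0 (ltW eta0) gGx cGx cl' HW).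
- exact: (E1loc_close a0 (cg j) gg G0 (ltW eta0) cGx gGx cl HW).
Qed.

End limit.

Lemma E1_le_of_loc a t (B : \bar R) c : 0 < a -> egrow a c ->
  (forall M : R, 0 < M -> (E1loc t M c <= B)%E) -> (E1 t c <= B)%E.
Proof.
move=> a0 cg H.
have f0 (x : R) : (0 <= (normc (pser c x%:C) ^+ 2 * `|x| `^ t)%:E)%E.
  by rewrite lee_fin mulr_ge0 ?sqr_ge0 ?powR_ge0.
pose F (i : nat) : set R := `[(- i.+1%:R)%R, i.+1%:R]%classic.
have -> : E1 t c = (\int[mu]_(x in \bigcup_i F i) (normc (pser c x%:C) ^+ 2 * `|x| `^ t)%:E)%E.
  congr integral; apply/seteqP; split=> // x _.
  exists (Num.bound `|x|) => //; rewrite /F /= in_itv /= -ler_norml.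
  by apply: le_trans (ltW (archi_boundP (normr_ge0 x))) _; rewrite ler_nat.
apply: integral_le_of_nondecreasing.
- apply/nondecreasing_seqP => n; rewrite subsetEset => x; rewrite /F /= !in_itv /= -!ler_norml => h.
  by rewrite (le_trans h)// ler_nat.
- by move=> i; exact: measurable_itv.
- exact: E1_measurable cg.
- exact: f0.
- by move=> i; exact: H.
Qed.

(* A minimizing sequence converges coefficientwise along an ultrafilter, hence
   uniformly on segments; no mass of [E1 s] escapes to infinity, as its part
   outside [-M, M] is at most [M ^ (s - t)] times [E1 t]. *)
Lemma minimizer a s t c0 : 0 < a -> -1 < s -> s < t -> egrow a c0 -> evenc c0 ->
  E1 s c0 != 0%E -> (E1 t c0 < +oo)%E ->
  exists (lam : R) g, [/\ 0 < lam, egrow a g, evenc g, (1 <= E1 s g)%E & (E1 t g <= lam%:E)%E] /\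
    forall c, egrow a c -> evenc c -> (lam%:E * E1 s c <= E1 t c)%E.
Proof.
move=> a0 s1 st c0g c0e c0n c0oo.
have t1 := lt_trans s1 st.
(* Collecting real upper bounds of [E1 t] instead of its values keeps the infimum in [R] and lets
   candidates of infinite [E1 t] drop out. *)
pose S := [set r : R | exists c, [/\ egrow a c, evenc c, E1 s c = 1%E & (E1 t c <= r%:E)%E]].
have S0 r : S r -> 0 <= r.
  by move=> [c [_ _ _ h]]; rewrite -lee_fin; exact: le_trans (E1_ge0 _ _) h.
have Sinf : has_inf S.
  split; last by exists 0 => r /S0.
  have [c [cg ce c1 c2]] := E1_normalize t a0 c0g c0e c0n (E1_fin a0 c0g s1 (ltW st) c0oo).
  have fc : E1 t c \is a fin_num.
    by rewrite c2 -(fineK (E1_fin_num c0oo)) -EFinM.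
  exists (fine (E1 t c)); exists c; split; [exact: cg|exact: ce|exact: c1|].
  by rewrite fineK.
pose lam := inf S.
have min c : egrow a c -> evenc c -> (lam%:E * E1 s c <= E1 t c)%E.
  move=> cg ce; have [->|toc] := eqVneq (E1 t c) +oo%E; first by rewrite leey.
  have {}toc : (E1 t c < +oo)%E by rewrite ltey.
  have soc := E1_fin a0 cg s1 (ltW st) toc.
  have [->|sn0] := eqVneq (E1 s c) 0%E; first by rewrite mule0 E1_ge0.
  have [c' [cg' ce' c1' c2']] := E1_normalize t a0 cg ce sn0 soc.
  have tf := E1_fin_num toc.
  have sf := E1_fin_num soc.
  have s0 : 0 < fine (E1 s c) by rewrite fine_gt0// soc lt_neqAle eq_sym sn0 E1_ge0.
  have : lam <= (fine (E1 s c))^-1 * fine (E1 t c).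
    apply: ge_inf; first by case: Sinf.
    exists c'; split; [exact: cg'|exact: ce'|exact: c1'|].
    by rewrite c2' EFinM fineK.
  rewrite -(fineK tf) -(fineK sf) -EFinM lee_fin /=.
  by rewrite mulrC ler_pdivlMr.
have seq j : exists c, [/\ egrow a c, evenc c, E1 s c = 1%E & (E1 t c <= (lam + j.+1%:R^-1)%:E)%E].
  have j0 : 0 < j.+1%:R^-1 :> R by rewrite invr_gt0.
  have [r [c [h1 h2 h3 h4]] rlam] := inf_adherent j0 Sinf.
  by exists c; split=> //; apply: le_trans h4 _; rewrite lee_fin ltW.
have [c Hc] := choice seq.
have [U [UU Uoo]] := @ultraFilterLemma nat \oo _.
have cg j : egrow a (c j) by case: (Hc j).
have cE j : E1 s (c j) = 1%E by case: (Hc j).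
have cE1 j : (E1 s (c j) <= 1)%E by rewrite cE.
have cEt j : (E1 t (c j) <= (lam + j.+1%:R^-1)%:E)%E by case: (Hc j).
have [g [gg Hg HM]] := ultra_limit a0 s1 UU cg cE1.
have ge : evenc g.
  move=> n on; apply/eqP; rewrite -normc_eq0 eq_le normc_ge0 andbT.
  apply: (@ultra_limit_le U (fun j => c j n) _ _ UU _ (Hg n)) => j.
  by have [_ ev _ _] := Hc j; rewrite (ev n on) (normc0 R).
have gt : (E1 t g <= lam%:E)%E.
  apply: (E1_le_of_loc a0 gg) => M M0.
  have [W [W0 HW]] := weight_finite t1 M0.
  have [G G0 HG] := HM M M0.
  apply: (@E1_eps_le _ _ (2 * G * W + 1)); first by rewrite addr_ge0 ?mulr_ge0.
  move=> e e0.
  (* [U] refines the filter of tails, so an index with good approximation can also be taken so large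
     that the excess 1 / (j + 1) over the infimum is at most [e]. *)
  have UJ : U [set j | (Num.bound e^-1 <= j)%N] by apply: Uoo; exact: nbhs_infty_ge.
  have [j [/= hj1 hj2]] := filter_ex (filterI (HG e e0) UJ).
  have [h _] := hj1 t W t1 HW.
  apply: le_trans h _; apply: (@le_trans _ _ ((lam + j.+1%:R^-1)%:E + (2 * G * e * W)%:E)%E).
    by apply: leeD => //; exact: le_trans (E1loc_le _ _ a0 (cg j)) (cEt j).
  rewrite -!EFinD lee_fin -addrA lerD2l mulrDr mulr1 addrC; apply: lerD.
    by rewrite le_eqVlt; apply/orP; left; apply/eqP; ring.
  rewrite invf_ple ?posrE//; apply: le_trans (ltW (archi_boundP _)) _; first by rewrite invr_ge0 ltW.
  by rewrite ler_nat ltnW.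
have lam0 : 0 <= lam by apply: lb_le_inf; [case: Sinf|exact: S0].
have gs : (1 <= E1 s g)%E.
  apply: (@E1_eps_le _ _ 2) => // e e0.
  (* [M] is chosen so that [M ^ (s - t)] is 1 / X. Every [E1 t (c j)] is at most [lam + 1], so the
     mass outside [-M, M] is at most [e]. *)
  pose X := (lam + 1) / e + 1; have X0 : 0 < X by rewrite ltr_wpDl// divr_ge0 ?addr_ge0// ltW.
  pose M := X `^ (t - s)^-1; have M0 : 0 < M by rewrite powR_gt0.
  have Mst : M `^ (s - t) = X^-1.
    rewrite /M -powRrM -[s - t]opprB mulrN mulVf ?gt_eqF ?subr_gt0//.
    by rewrite powR_inv1// ltW.
  have [W [W0 HW]] := weight_finite s1 M0.
  have [G G0 HG] := HM M M0.
  have k0 : 0 < 2 * G * W + 1 by rewrite ltr_wpDl ?mulr_ge0.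
  have eta0 : 0 < e / (2 * G * W + 1) by rewrite divr_gt0.
  have [j /= hj] := filter_ex (HG _ eta0).
  have [_ h] := hj s W s1 HW.
  rewrite -(cE j); apply: le_trans (E1_tail a0 (cg j) M0 (ltW st)) _.
  apply: (@le_trans _ _ ((E1loc s M g + (2 * G * (e / (2 * G * W + 1)) * W)%:E) + (X^-1)%:E * (lam + 1)%:E)%E).
    apply: leeD => //; rewrite Mst; apply: lee_wpmul2l; first by rewrite lee_fin invr_ge0 ltW.
    by apply: le_trans (cEt j) _; rewrite lee_fin lerD2l invf_le1 ?ler1n.
  rewrite -addeA; apply: leeD; first exact: E1loc_le gg.
  rewrite -EFinM -EFinD lee_fin mulr_natr mulr2n; apply: lerD.
    rewrite (_ : 2 * G * _ * W = e * (2 * G * W / (2 * G * W + 1))); last by ring.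
    by rewrite ler_piMr ?(ltW e0)// ler_pdivrMr// mul1r lerDl.
  rewrite mulrC ler_pdivrMr// /X mulrDr mulr1 mulrC divfK ?gt_eqF//.
  by rewrite lerDl ltW.
exists lam, g; split=> //; split=> //.
(* If [lam] were 0, then [E1 t g = 0] would force [E1 s g = 0], against [1 <= E1 s g]. *)
rewrite lt_neqAle lam0 andbT eq_sym; apply/negP => /eqP l0.
have E0 : E1 t g = 0%E by apply/eqP; rewrite eq_le E1_ge0 andbT; move: gt; rewrite l0.
by move: gs; rewrite (E1_eq0 s a0 gg E0) lee_fin ler10.
Qed.

(** The even minimizer also bounds functions without parity: [E1_even_odd] separates the parts and
    [E1_shift_le] transfers the inequality to the odd one. For equal exponents the ratio is 1 and
    [c0] itself serves. *)
Lemma minimizer_all a s t c0 : 0 < a -> -1 < s -> s <= t -> egrow a c0 -> evenc c0 ->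
  E1 s c0 != 0%E -> (E1 t c0 < +oo)%E ->
  exists (lam : R) g, [/\ 0 < lam, egrow a g, evenc g, E1 s g != 0%E & E1 t g = (lam%:E * E1 s g)%E] /\
    (E1 t g < +oo)%E /\
    forall c, egrow a c -> (lam%:E * E1 s c <= E1 t c)%E.
Proof.
move=> a0 s1; rewrite le_eqVlt => /predU1P[->|st] c0g c0e c0n c0oo.
  by exists 1, c0; split; [split; rewrite ?mul1e|split=> // c _; rewrite mul1e].
have [lam [g [[l0 gg ge gs gt] H]]] := minimizer a0 s1 st c0g c0e c0n c0oo.
have sn0 : E1 s g != 0%E.
  by apply/eqP => h; move: gs; rewrite h lee_fin ler10.
exists lam, g; split; last split.
- split=> //; apply/eqP; rewrite eq_le H// andbT; apply: le_trans gt _.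
  by rewrite -[leLHS]mule1; apply: lee_wpmul2l; rewrite ?lee_fin ?(ltW l0).
- exact: le_lt_trans gt (ltry _).
move=> c cg; have t1 := lt_trans s1 st.
rewrite (E1_even_odd a0 cg s1) (E1_even_odd a0 cg t1) ge0_muleDr ?E1_ge0//.
apply: leeD; first by apply: H; [exact: egrow_ce|exact: even_ce].
apply: (E1_shift_le a0 (egrow_co a0 cg) s1 st (ltW l0)).
by apply: H; [exact: egrow_co|exact: even_co].
Qed.

End minimizer.

(** * A nonzero function of finite energy *)

Section test_function.
Variable R : realType.
Notation mu := (@lebesgue_measure R).
Implicit Types (c : nat -> R[i]) (a s t : R).

Lemma ae_eq0_cont (h : R -> R) : continuous h -> ae_eq mu setT (fun x => (h x)%:E) (cst 0%E) ->
  forall x, h x = 0.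
Proof.
move=> ch [N [mN N0 HN]] x; apply: contrapT => /eqP hx.
have hx0 : 0 < `|h x| by rewrite normr_gt0.
have /cvgrPdist_lt /(_ _ hx0) /nbhs_ballP [r /= r0 Hr] := ch x.
have I (y : R) : `](x - r)%R, (x + r)%R[%classic y -> N y.
  rewrite /= in_itv /= => /andP[y1 y2]; apply: HN => /= /(_ I) [] hy.
  have /Hr : ball x r y by rewrite /ball /= ltr_distlC y1 y2.
  by rewrite hy subr0 ltxx.
have : (mu `](x - r)%R, (x + r)%R[%classic <= 0)%E.
  by rewrite -N0; apply: le_measure; rewrite ?inE//; exact: measurable_itv.
have xr : x - r < x + r by lra.
by rewrite lebesgue_measure_itv /= lte_fin xr -EFinD lee_fin; lra.
Qed.

Lemma E1_eq0_coef a t c : 0 < a -> egrow a c -> E1 t c = 0%E -> forall n, c n = 0.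
Proof.
move=> a0 cg E0.
have f0 (x : R) : (0 <= (normc (pser c x%:C) ^+ 2 * `|x| `^ t)%:E)%E.
  by rewrite lee_fin mulr_ge0 ?sqr_ge0 ?powR_ge0.
have ae1 : ae_eq mu setT (fun x : R => (normc (pser c x%:C) ^+ 2 * `|x| `^ t)%:E) (cst 0%E).
  apply/(ae_eq_integral_abs mu measurableT (E1_measurable t a0 cg)).
  by rewrite -[RHS]E0; apply: eq_integral => x _; rewrite gee0_abs.
have ae0 : \forall x \ae mu, x != 0.
  exists [set 0]; split; [exact: measurable_set1|exact: lebesgue_measure_set1|].
  by move=> x /= /negP; rewrite negbK => /eqP.
have ch : continuous (fun x : R => normc (pser c x%:C)).
  by move=> x; apply: ccont_normc; exact: egrow_entire cg x.
have H : ae_eq mu setT (fun x : R => (normc (pser c x%:C))%:E) (cst 0%E).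
  apply: filterS2 ae1 ae0 => x /(_ I) /eqP; rewrite /cst eqe mulf_eq0 expf_eq0 /=.
  move=> /orP[/eqP -> _ _ //|].
  by move=> /eqP /powR_eq0_eq0 /eqP; rewrite normr_eq0 => /eqP ->; rewrite eqxx.
have Z := ae_eq0_cont ch H.
have [K cK] := egrow_pradr a0 ler01 cg.
apply: (pser_eq0 ltr01 ltr01 cK) => x _ _.
by apply/eqP; rewrite -normc_eq0 Z.
Qed.

Lemma egrow_succ a c : 0 < a -> egrow a c -> egrow a (fun n => c n.+1).
Proof.
move=> a0 cg T aT; have [C HC] := cg T aT; exists (C * T) => n.
apply: (@le_trans _ _ (normc (c n.+1) * n.+1`!%:R)); last by rewrite -mulrA -exprS.
by rewrite ler_wpM2l ?normc_ge0// ler_nat factS leq_pmull.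
Qed.

Lemma etypeX a f N : 0 < a -> etype a f -> etype (N.+1%:R * a) (fun z => f z ^+ N.+1).
Proof.
move=> a0 [fe fg]; split.
  move=> p; have [l fl] := fe p.
  by eexists; exact: (cderiv_comp fl (cderivX N.+1 (f p))).
move=> T aT; have [|C HC] := fg (T / N.+1%:R); first by rewrite ltr_pdivlMr// mulrC.
exists (C ^+ N.+1) => z; rewrite normcX.
have -> : T * normc z = N.+1%:R * (T / N.+1%:R * normc z).
  by rewrite mulrA [N.+1%:R * _]mulrC divfK.
by rewrite expRM_natl -exprMn lerXn2r ?nnegrE ?normc_ge0// (le_trans _ (HC z))// normc_ge0.
Qed.

Lemma oneDsqr_fin : (\int[mu]_x ((oneDsqr x)^-1)%:E < +oo)%E.
Proof.
have m : measurable_fun setT (fun x : R => ((oneDsqr x)^-1)%:E).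
  by apply/measurable_EFinP; apply: continuous_measurable_fun; exact: continuous_oneDsqrV.
have f0 (x : R) : (0 <= ((oneDsqr x)^-1)%:E)%E by rewrite lee_fin invr_ge0 (le_trans ler01)// oneDsqr_ge1.
apply: le_lt_trans (integral_half m f0 _) _; first by move=> x; rewrite /oneDsqr sqrrN.
have E : (\int[mu]_(x in `]0%R, +oo[) ((oneDsqr x)^-1)%:E = (pi / 2)%:E)%E.
  by rewrite integral_itv_obnd_cbnd ?integral0y_oneDsqr//; apply: measurable_funS m.
by rewrite E -EFinD ltry.
Qed.

Lemma E1loc_fin a t (M : R) c : 0 < a -> egrow a c -> -1 < t -> 0 < M -> (E1loc t M c < +oo)%E.
Proof.
move=> a0 cg t1 M0.
have [G G0 HG] := pser_bounded a0 (ltW M0) cg.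
have [W [W0 HW]] := weight_finite t1 M0.
have mI : measurable (`[(- M)%R, M]%classic : set R) by exact: measurable_itv.
have w0 (x : R) : (0 <= (`|x| `^ t)%:E)%E by rewrite lee_fin powR_ge0.
have mw := @weight_measurable R t.
apply: (@le_lt_trans _ _ ((G ^+ 2)%:E * \int[mu]_(x in `[(- M)%R, M]) (`|x| `^ t)%:E)%E).
  rewrite -(ge0_integralZ_line mI (sqr_ge0 G) mw w0).
  apply: (ge0_le_integral_line mI (E1_measurable t a0 cg)); first exact: measurable_funeM.
    by move=> x; rewrite lee_fin mulr_ge0 ?sqr_ge0 ?powR_ge0.
  move=> x; rewrite /= in_itv /= -ler_norml => xM.
  by rewrite -EFinM lee_fin ler_wpM2r ?powR_ge0// lerXn2r ?nnegrE ?normc_ge0// HG.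
apply: (@le_lt_trans _ _ ((G ^+ 2)%:E * W%:E)%E); last by rewrite -EFinM ltry.
by apply: lee_wpmul2l => //; rewrite lee_fin sqr_ge0.
Qed.

Lemma E1_fin_of_decay a t (K : R) c : 0 < a -> egrow a c -> -1 < t -> 0 <= K ->
  (forall x : R, 1 < `|x| -> normc (pser c x%:C) ^+ 2 * `|x| `^ t <= K * (oneDsqr x)^-1) ->
  (E1 t c < +oo)%E.
Proof.
move=> a0 cg t1 K0 H.
have mI : measurable (`[(- 1)%R, 1%R]%classic : set R) by exact: measurable_itv.
have mIC : measurable (~` `[(- 1)%R, 1%R]%classic : set R) by exact: measurableC.
have f0 (x : R) : (0 <= (normc (pser c x%:C) ^+ 2 * `|x| `^ t)%:E)%E.
  by rewrite lee_fin mulr_ge0 ?sqr_ge0 ?powR_ge0.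
have m : measurable_fun setT (fun x : R => ((oneDsqr x)^-1)%:E).
  by apply/measurable_EFinP; apply: continuous_measurable_fun; exact: continuous_oneDsqrV.
have o0 (x : R) : (0 <= ((oneDsqr x)^-1)%:E)%E by rewrite lee_fin invr_ge0 (le_trans ler01)// oneDsqr_ge1.
rewrite /E1 (integral_setCU mI (E1_measurable t a0 cg) f0).
apply: lte_add_pinfty; last exact: E1loc_fin cg t1 ltr01.
apply: (@le_lt_trans _ _ (K%:E * \int[mu]_x ((oneDsqr x)^-1)%:E)%E); last first.
  have := oneDsqr_fin; rewrite -ge0_fin_numE; last exact: integral_ge0.
  by move=> /fineK <-; rewrite -EFinM ltry.
rewrite -(ge0_integralZ_line measurableT K0 m o0).
have mK : measurable_fun setT (fun x : R => (K%:E * ((oneDsqr x)^-1)%:E)%E) by exact: measurable_funeM.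
have k0 (x : R) : (0 <= K%:E * ((oneDsqr x)^-1)%:E)%E by rewrite mule_ge0.
apply: (@le_trans _ _ (\int[mu]_(x in ~` `[(- 1)%R, 1%R]%classic) (K%:E * ((oneDsqr x)^-1)%:E))%E).
  apply: (ge0_le_integral_line mIC (E1_measurable t a0 cg) mK f0) => x /=.
  rewrite in_itv /= => /negP; rewrite -ler_norml -ltNge => x1.
  by rewrite -EFinM lee_fin H.
by apply: ge0_subset_integral.
Qed.

(** The function is exp (i b z) - exp (- i b z), that is 2 i sin (b z). It does not vanish at i
    because the two exponentials have different moduli there. *)
Lemma sine_etype (b : R) : 0 < b -> exists h : R[i] -> R[i],
  [/\ etype b h, h 0 = 0, h 'i != 0 & forall x : R, normc (h x%:C) <= 2].
Proof.
move=> b0; pose w : R[i] := 0 +i* b.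
pose h z := cexp (w * z) - cexp (- w * z).
have wn : normc w = b by rewrite /w /= expr0n /= add0r sqrtr_sqr gtr0_norm.
have d (v z : R[i]) : exists l, cderiv (fun z => cexp (v * z)) z l.
  have [l Hl] : exists l, cderiv (fun z => v * z) z l.
    by eexists; exact: (cderivM (cderiv_cst v z) (cderiv_id z)).
  by eexists; exact: (cderiv_comp Hl (cderiv_cexp (v * z))).
exists h; split.
- split.
    move=> z; have [l1 H1] := d w z; have [l2 H2] := d (- w) z.
    by exists (l1 - l2); exact: cderivB.
  move=> T bT; exists 2 => z; apply: le_trans (le_normcB _ _) _.
  have e v : normc v = b -> normc (cexp (v * z)) <= expR (T * normc z).
    move=> vb; rewrite normc_cexp ler_expR.
    apply: le_trans (ler_norm _) _; apply: le_trans (le_Re_normc _) _.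
    by rewrite normcM vb ler_wpM2r ?normc_ge0// ltW.
  by rewrite mulr_natl mulr2n lerD// e// normcN.
- by rewrite /h !mulr0 subrr.
- rewrite subr_eq0; apply/eqP => /(congr1 (@normc R)); rewrite !normc_cexp => /expR_inj.
  by rewrite /w /=; lra.
- move=> x; apply: le_trans (le_normcB _ _) _; rewrite !normc_cexp.
  rewrite [Re (w * _)](_ : _ = 0); last by rewrite /w /=; ring.
  rewrite [Re (- w * _)](_ : _ = 0); last by rewrite /w /=; ring.
  by rewrite expR0.
Qed.

(* The function is [(sin (b z) / z) ^ N] up to a constant, with [b = a / N]. *)
Lemma test_function a t : 0 < a -> -1 < t -> exists c,
  [/\ egrow a c, evenc c, forall s, E1 s c != 0%E & (E1 t c < +oo)%E].
Proof.
move=> a0 t1.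
(* Evenness is arranged afterwards: a nonzero coefficient of even index survives in [ce c], one of
   odd index in [co c], and both have finite energy. *)
suff [c [cg [k ck] cE]] : exists c, [/\ egrow a c, exists k, c k != 0 & (E1 t c < +oo)%E].
  have t2 : t <= t + 2 by rewrite lerDl.
  move: cE; rewrite (E1_even_odd a0 cg t1) => cE.
  have ceE : (E1 t (ce c) < +oo)%E.
    by apply: le_lt_trans cE; rewrite leeDl ?E1_ge0.
  have coE : (E1 t (co c) < +oo)%E.
    apply: (E1_fin a0 (egrow_co a0 cg) t1 t2); apply: le_lt_trans cE.
    by rewrite leeDr ?E1_ge0.
  have [ok|ek] := boolP (odd k).
    exists (co c); split; [exact: egrow_co|exact: even_co| |exact: coE].
    move=> s; apply/eqP => /(E1_eq0_coef a0 (egrow_co a0 cg)) /(_ k.-1).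
    case: k ok ck => //= k; rewrite /co => /negbTE -> ck ck0.
    by rewrite ck0 eqxx in ck.
  exists (ce c); split; [exact: egrow_ce|exact: even_ce| |exact: ceE].
  move=> s; apply/eqP => /(E1_eq0_coef a0 (egrow_ce cg)) /(_ k).
  by rewrite /ce (negbTE ek) => ck0; rewrite ck0 eqxx in ck.
(* The squared modulus of (sin (b x) / x)^(N + 1) is O(|x|^(-2 (N + 1))); it must absorb the weight
   |x|^t and the growth |x|^2 of [oneDsqr], whence t + 2 <= 2 (N + 1). *)
pose N := Num.bound `|t|.
have Nt : t + 2 <= 2 * N.+1%:R.
  have := ltW (archi_boundP (normr_ge0 t)); rewrite -/N -natr1 => h.
  have := ler_norm t; have : 0 <= N%:R :> R by []; lra.
have N0 : 0 < N.+1%:R :> R by [].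
pose b := a / N.+1%:R; have b0 : 0 < b by rewrite divr_gt0.
have [h [ht h0 hi h2]] := sine_etype b0.
have [c cg hc] := etype_coef b0 ht.
pose q := pser (fun n => c n.+1).
have c0 : c 0%N = 0 by rewrite -pser0 -hc.
have hq z : h z = z * q z.
  rewrite hc; have r0 : 0 <= normc z + 1 by rewrite addr_ge0 ?normc_ge0.
  have [K cK] := egrow_pradr b0 r0 cg.
  by rewrite (pser_recl cK) ?c0 ?add0r// ltrDl.
have qt : etype b q := egrow_etype (ltW b0) (egrow_succ b0 cg).
have := etypeX N b0 qt; rewrite (_ : N.+1%:R * b = a); last by rewrite mulrC divfK ?gt_eqF.
move=> /(etype_coef a0) [u ug qu].
exists u; split=> //.
  apply: contrapT => H; have u0 n : u n = 0.
    by apply: contrapT => /eqP un; apply: H; exists n.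
  move/eqP: hi; apply; rewrite hq; apply/eqP; rewrite mulf_eq0; apply/orP; right.
  suff : q 'i ^+ N.+1 == 0 by rewrite expf_eq0 /=.
  rewrite qu (_ : u = fun=> 0); last by apply/funext.
  rewrite -normc_eq0 eq_le normc_ge0 andbT; apply: normc_csum => n.
  by rewrite big1// => i _; rewrite mul0r (normc0 R).
apply: (E1_fin_of_decay a0 ug t1 (K := 4 ^+ N.+1 * 2)); first by rewrite mulr_ge0 ?exprn_ge0.
move=> x x1; rewrite -qu normcX.
have X0 : 0 < `|x| by exact: lt_trans x1.
have o0 : 0 < oneDsqr x by rewrite (lt_le_trans ltr01)// oneDsqr_ge1.
have qx : normc (q x%:C) <= 2 / `|x|.
  by rewrite ler_pdivlMr// -(normcR x) mulrC -normcM -hq.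
have q4 : (normc (q x%:C) ^+ N.+1) ^+ 2 <= 4 ^+ N.+1 * `|x| ^- (2 * N.+1).
  rewrite -exprM mulnC exprM -(exprVn _ (2 * _)) exprM -exprMn lerXn2r ?nnegrE ?sqr_ge0//.
  rewrite (_ : 4 = 2 ^+ 2); last by rewrite -natrX.
  by rewrite -exprMn lerXn2r ?nnegrE ?normc_ge0 ?divr_ge0 ?(ltW X0).
apply: le_trans (ler_wpM2r (powR_ge0 _ _) q4) _.
rewrite -[leLHS]mulrA -[leRHS]mulrA; apply: ler_wpM2l; first by rewrite exprn_ge0.
rewrite ler_pdivlMr//.
rewrite -(powR_mulrn _ (ltW X0)) -powRN -powRD; last by rewrite (gt_eqF X0) implybT.
have -> : oneDsqr x = 1 + `|x| ^+ 2 by rewrite /oneDsqr real_normK ?num_real.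
apply: (@le_trans _ _ (`|x| `^ (- (2 * N.+1)%:R + t) * (2 * `|x| `^ 2))).
  rewrite ler_wpM2l ?powR_ge0// (powR_mulrn 2 (ltW X0)) mulrDl mul1r lerD2r.
  by rewrite -(expr1n _ 2) lerXn2r ?nnegrE ?ler01 ?(ltW X0) ?(ltW x1).
rewrite mulrCA ler_piMr// -powRD; last by rewrite (gt_eqF X0) implybT.
rewrite -[leRHS](powRr0 `|x|) ler_powR ?(ltW x1)// natrM; lra.
Qed.

End test_function.

(** * Polar integration on tuples *)

Section tuples.
Variable R : realType.
Notation T := (measurableTypeR R).
Notation mu := (@lebesgue_measure R).
Notation nu := (@lebesgue_Rn R).

Definition boxcont n (G : n.-tuple R -> R) := forall x (e : R), 0 < e ->
  exists2 r : R, 0 < r & forall y, (forall i, `|tnth y i - tnth x i| < r) -> `|G y - G x| <= e.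

(** The preimage of an open ray is a countable union over boxes with rational centre and radius 1 /
    (k + 1) on which [G] stays in the ray. *)
Lemma measurable_boxcont d0 (X : measurableType d0) n (u : X -> n.-tuple T) (G : n.-tuple R -> R) :
  measurable_fun setT u -> boxcont G -> measurable_fun setT (fun t => G (u t)).
Proof.
move=> mu_ cG; apply: (measurability _ (RGenOInfty.measurableE R)) => //.
move=> /= _ [_ [a ->] <-]; rewrite setTI.
pose near_ (q : n.-tuple rat * nat) (y : n.-tuple R) :=
  forall i, `|tnth y i - ratr (tnth q.1 i)| < q.2.+1%:R^-1.
pose P q := forall y, near_ q y -> a < G y.
pose B q := [set t | P q /\ near_ q (u t)].
have -> : (fun t => G (u t)) @^-1` `]a, +oo[%classic = \bigcup_(q in setT) B q.
  apply/seteqP; split => t /=; rewrite in_itv /= andbT; last by move=> [q _ [Pq]]; exact: Pq.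
  move=> at_; have e0 : 0 < (G (u t) - a) / 2 by rewrite divr_gt0 ?subr_gt0.
  have [r r0 Hr] := cG (u t) _ e0.
  pose k := Num.bound (2 / r).
  (* A box of radius 1 / (k + 1) containing the point has diameter 2 / (k + 1), so it lies within
     distance [r] of the point. *)
  have kr : 2 * k.+1%:R^-1 <= r.
    rewrite ler_pdivrMr// mulrC -ler_pdivrMr//.
    apply: le_trans (ltW (archi_boundP _)) _; first by rewrite divr_ge0// ltW.
    by rewrite ler_nat.
  have k0 : 0 < k.+1%:R^-1 :> R by rewrite invr_gt0.
  have H i : exists q : rat, `|tnth (u t) i - ratr q| < k.+1%:R^-1 :> R.
    have [|q] := @rat_in_itvoo R (tnth (u t) i - k.+1%:R^-1) (tnth (u t) i + k.+1%:R^-1).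
      by rewrite ltrD2l gtrN.
    by rewrite in_itv /= => /andP[q1 q2]; exists q; rewrite ltr_distlC q1 q2.
  have [q Hq] := choice H.
  have nq : near_ ([tuple q i | i < n], k) (u t) by move=> i; rewrite /= tnth_mktuple.
  exists ([tuple q i | i < n], k) => //; split=> // y ny.
  have /Hr : forall i, `|tnth y i - tnth (u t) i| < r.
    move=> i; apply: lt_le_trans kr; rewrite mulr_natl mulr2n.
    have := ltrD (ny i) (nq i); rewrite [X in _ + X]distrC; apply: le_lt_trans.
    by apply: le_trans (ler_normD _ _); rewrite subrKA.
  by rewrite ler_distl => /andP[h _]; lra.
apply: countable_bigcupT_measurable => [|q]; first exact: countableP.
have [p|np] := pselect (P q); last first.
  by rewrite (_ : B q = set0) //; apply/seteqP; split => // t [].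
rewrite (_ : B q = \bigcap_(i in setT) ((fun t => tnth (u t) i : R) @^-1`
  `](ratr (tnth q.1 i) - q.2.+1%:R^-1), (ratr (tnth q.1 i) + q.2.+1%:R^-1)[%classic)).
  apply: fin_bigcap_measurable => // i _; rewrite -[X in measurable X]setTI.
  apply: (measurableT_comp (measurable_tnth i) mu_) => //; exact: measurable_itv.
apply/seteqP; split => t /=.
  by move=> [_ h] i _ /=; rewrite in_itv /= -ltr_distlC distrC; exact: h.
by move=> h; split=> // i; have := h i I; rewrite /= in_itv /= -ltr_distlC distrC.
Qed.

Definition tscale n (c : R) (x : n.-tuple R) : n.-tuple R := [tuple of map ( *%R c) x].

Lemma tnth_tscale n c (x : n.-tuple R) i : tnth (tscale c x) i = c * tnth x i.
Proof. by rewrite tnth_map. Qed.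

Lemma eucl_norm_ge0 n (x : n.-tuple R) : 0 <= eucl_norm x.
Proof. exact: sqrtr_ge0. Qed.

Lemma eucl_norm_scale n c (x : n.-tuple R) : eucl_norm (tscale c x) = `|c| * eucl_norm x.
Proof.
rewrite /eucl_norm -sqrtr_sqr -sqrtrM ?sqr_ge0// mulr_sumr; congr Num.sqrt.
by apply: eq_bigr => i _; rewrite tnth_tscale exprMn.
Qed.

Lemma eucl_norm_eq0 n (x : n.-tuple R) : eucl_norm x = 0 -> forall i, tnth x i = 0.
Proof.
move=> /eqP; rewrite sqrtr_eq0 => h i; apply/eqP; rewrite -sqrf_eq0 eq_le sqr_ge0 andbT.
apply: le_trans h; rewrite (bigD1 i)//= lerDl sumr_ge0// => j _; exact: sqr_ge0.
Qed.

Lemma abs_tnth_le n (x : n.-tuple R) i : `|tnth x i| <= eucl_norm x.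
Proof.
rewrite -sqrtr_sqr ler_wsqrtr// (bigD1 i)//= lerDl sumr_ge0// => j _; exact: sqr_ge0.
Qed.

Lemma measurable_tscale n : measurable_fun setT (fun p : n.-tuple T * T => tscale p.2 p.1 : n.-tuple T).
Proof.
apply/measurable_fun_tnthP => i.
rewrite (_ : _ \o _ = (fun p : n.-tuple T * T => (p.2 : R) * (tnth p.1 i : R))); last first.
  by apply/funext => p /=; rewrite tnth_tscale.
apply: measurable_funM; first exact: measurable_snd.
exact: (measurableT_comp (measurable_tnth i) measurable_fst).
Qed.

Lemma measurable_tscalel n (c : R) : measurable_fun setT (fun x : n.-tuple T => tscale c x : n.-tuple T).
Proof.
apply/measurable_fun_tnthP => i.
rewrite (_ : _ \o _ = (fun x : n.-tuple T => c * (tnth x i : R))); last first.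
  by apply/funext => p /=; rewrite tnth_tscale.
by apply: measurable_funM => //; exact: measurable_tnth.
Qed.

Lemma measurable_eucl n : measurable_fun setT (fun x : n.-tuple T => eucl_norm (x : n.-tuple R)).
Proof.
apply: (measurableT_comp (f := fun v : R => Num.sqrt v)).
  by apply: continuous_measurable_fun; exact: sqrt_continuous.
apply: measurable_sum => i; apply: measurable_funX; exact: measurable_tnth.
Qed.

Lemma integral_cons n (G : n.+1.-tuple T -> \bar R) : measurable_fun setT G -> (forall x, 0 <= G x)%E ->
  (\int[nu n.+1]_x G x = \int[mu]_s \int[nu n]_t G (tuple_cons (s, t)))%E.
Proof.
move=> mG G0.
transitivity (\int[pushforward (mu \x nu n)%E (@tuple_cons _ _ n)]_x G x)%E; first by [].
rewrite ge0_integral_pushforward//; last exact: measurable_tuple_cons.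
rewrite preimage_setT (@fubini_tonelli1 _ _ _ _ _ mu (nu n))//.
  by apply: (measurableT_comp mG); exact: measurable_tuple_cons.
by move=> p; exact: G0.
Qed.

Lemma integral_cons_measurable n (G : n.+1.-tuple T -> \bar R) : measurable_fun setT G -> (forall x, 0 <= G x)%E ->
  measurable_fun setT (fun s : T => \int[nu n]_t G (tuple_cons (s, t)))%E.
Proof.
move=> mG G0; apply: (@measurable_fun_fubini_tonelli_F _ _ _ _ _ (nu n) (fun p => G (tuple_cons p))) => //.
by apply: (measurableT_comp mG); exact: measurable_tuple_cons.
Qed.

Lemma ge0_integral_tscale n (c : R) (G : n.-tuple T -> \bar R) : c != 0 -> measurable_fun setT G ->
  (forall x, 0 <= G x)%E -> ((`|c| ^+ n)%:E * \int[nu n]_x G (tscale c x) = \int[nu n]_x G x)%E.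
Proof.
move=> c0; elim: n G => [|n IH] G mG G0.
  rewrite expr0 mul1e; apply: eq_integral => x _; congr G.
  by rewrite (tuple0 x) (tuple0 (tscale _ _)).
have mGs : measurable_fun setT (fun x : n.+1.-tuple T => G (tscale c x)).
  by apply: (measurableT_comp mG); exact: measurable_tscalel.
rewrite (integral_cons mGs)// (integral_cons mG)//.
have c1 : 0 <= `|c| ^+ n by rewrite exprn_ge0.
rewrite -(ge0_integral_scale c0 (integral_cons_measurable mG G0)); last first.
  by move=> s; apply: integral_ge0.
rewrite exprS EFinM -muleA; congr (_ * _)%E.
rewrite -ge0_integralZl_EFin//; last 2 first.
- by move=> s _; apply: integral_ge0.
- exact: integral_cons_measurable mGs _.
apply: eq_integral => s _.
have mGc : measurable_fun setT (fun t : n.-tuple T => G (tuple_cons (c * s, t))).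
  apply: (measurableT_comp mG); apply: (measurableT_comp (@measurable_tuple_cons _ _ n)).
  exact: measurable_fun_pair.
rewrite -(IH _ mGc)//; congr (_ * _)%E; apply: eq_integral => t _; congr G.
exact/val_inj.
Qed.

Lemma lebesgue_Rn_origin n : (0 < n)%N -> nu n [set t | forall i, [set 0] (tnth t i)] = 0%E.
Proof.
case: n => // n _; rewrite /lebesgue_Rn.
rewrite (@power_measure_box R _ T mu n.+1 (fun=> [set (0 : R)])); last by move=> i; exact: measurable_set1.
by rewrite big_ord_recl /= lebesgue_measure_set1 mul0e.
Qed.

Lemma ae_neq0 n : (0 < n)%N -> \forall x \ae nu n, eucl_norm (x : n.-tuple R) != 0.
Proof.
move=> n0; exists [set t : n.-tuple T | forall i, [set (0 : R)] (tnth t i : R)]; split.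
- rewrite (_ : [set t | _] = \bigcap_(i in setT) ((fun t : n.-tuple T => tnth t i) @^-1` [set (0 : R)])).
    apply: fin_bigcap_measurable => // i _; rewrite -[X in measurable X]setTI.
    by apply: measurable_tnth => //; exact: measurable_set1.
  by apply/seteqP; split => t H i; [move=> _; exact: H|exact: (H i I)].
- exact: lebesgue_Rn_origin.
- by move=> x /= /negP; rewrite negbK => /eqP /eucl_norm_eq0.
Qed.

Lemma eq_integral_off0 (f g : R -> \bar R) : measurable_fun setT f -> measurable_fun setT g ->
  (forall s, 0 <= f s)%E -> (forall s, 0 <= g s)%E -> (forall s, s != 0 -> f s = g s) ->
  (\int[mu]_s f s = \int[mu]_s g s)%E.
Proof.
move=> mf mg f0 g0 fg; apply: ge0_ae_eq_integral => //.
exists [set 0]; split; [exact: measurable_set1|exact: lebesgue_measure_set1|].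
by move=> s /= H; apply: contrapT => /eqP s0; apply: H => _; exact: fg.
Qed.

Lemma lebesgue_itv_oo (a b : R) : a < b -> mu `]a, b[%classic = (b - a)%:E.
Proof. by move=> ab; rewrite lebesgue_measure_itv /= lte_fin ab EFinB. Qed.

Lemma lebesgue_itv_cc (a b : R) : a < b -> mu `[a, b]%classic = (b - a)%:E.
Proof. by move=> ab; rewrite lebesgue_measure_itv /= lte_fin ab EFinB. Qed.

Definition shell (v : R) : R := if (1 < v) && (v < 2) then 1 else 0.

Lemma shell_ge0 v : 0 <= shell v. Proof. by rewrite /shell; case: ifP. Qed.

Lemma measurable_shell d0 (X : measurableType d0) (h : X -> R) : measurable_fun setT h ->
  measurable_fun setT (fun x => shell (h x)).
Proof.
move=> mh; apply: measurable_fun_ifT => //.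
by apply: measurable_and; apply: measurable_fun_ltr.
Qed.

(** Its value is 2 ln 2, the integral of ds / |s| over 1/2 < |s| < 1. This measure is invariant
    under dilations, so rescaling the shell gives the same number. *)
Definition shell_const : \bar R := (\int[mu]_s (`|s|^-1 * shell `|s|^-1)%:E)%E.

Lemma measurable_absV d0 (X : measurableType d0) (h : X -> R) : measurable_fun setT h ->
  measurable_fun setT (fun x => `|h x|^-1).
Proof.
move=> mh; have -> : (fun x => `|h x|^-1) = (fun x => `|h x| `^ (-1)).
  by apply/funext => x; rewrite powR_inv1.
apply: (measurableT_comp (measurable_powR (-1))).
exact: (measurableT_comp (@normr_measurable R setT)).
Qed.

Lemma shell_const_scale (v : R) : 0 < v ->
  (\int[mu]_s (`|s|^-1 * shell (v * `|s|^-1))%:E = shell_const)%E.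
Proof.
move=> v0; have v1 : v != 0 by rewrite gt_eqF.
pose g (s : R) := (`|s|^-1 * shell (v * `|s|^-1))%:E.
have mg : measurable_fun setT g.
  have ma : measurable_fun setT (fun s : R => `|s|^-1) by apply: (@measurable_absV _ _ id).
  apply/measurable_EFinP; apply: measurable_funM => //.
  by apply: measurable_shell; exact: measurable_funM.
have g0 s : (0 <= g s)%E by rewrite lee_fin mulr_ge0 ?shell_ge0.
rewrite -(ge0_integral_scale v1 mg g0) gtr0_norm// -(ge0_integralZ_line measurableT (ltW v0)).
- apply: eq_integral => s _; rewrite /g normrM (gtr0_norm v0) invfM mulrA divff// mul1r.
  by rewrite -EFinM !mulrA divff// mul1r.
- apply: (measurableT_comp mg); exact: measurable_scale.
- by move=> s; exact: g0.
Qed.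

Lemma shell_const_gt0 : (0 < shell_const)%E.
Proof.
have ma : measurable_fun setT (fun s : R => `|s|^-1) by apply: (@measurable_absV _ _ id).
have mg : measurable_fun setT (fun s : R => (`|s|^-1 * shell `|s|^-1)%:E).
  by apply/measurable_EFinP; apply: measurable_funM => //; exact: measurable_shell.
have g0 (s : R) : (0 <= (`|s|^-1 * shell `|s|^-1)%:E)%E by rewrite lee_fin mulr_ge0 ?shell_ge0.
have mI : measurable (`](2^-1), 1[%classic : set R) by exact: measurable_itv.
apply: (@lt_le_trans _ _ (\int[mu]_(s in `](2^-1)%R, 1%R[) (1%:E : \bar R))%E).
  suff : (0 < mu `](2^-1)%R, 1%R[%classic)%E by rewrite integral_cst// mul1e.
  rewrite lebesgue_measure_itv /= lte_fin.
  have h : (2^-1 : R) < 1 by lra.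
  by rewrite h -EFinD lte_fin; lra.
apply: (@le_trans _ _ (\int[mu]_(s in `](2^-1)%R, 1%R[) (`|s|^-1 * shell `|s|^-1)%:E)%E).
  apply: (ge0_le_integral_line mI) => //.
  move=> s; rewrite /= in_itv /= => /andP[s1 s2]; have s0 : 0 < s by lra.
  rewrite lee_fin (gtr0_norm s0) /shell invf_gt1// s2 /=.
  by rewrite invf_plt ?posrE// s1 mulr1 ltW// invf_gt1.
by apply: ge0_subset_integral.
Qed.

Lemma shell_const_fin : (shell_const < +oo)%E.
Proof.
have ma : measurable_fun setT (fun s : R => `|s|^-1) by apply: (@measurable_absV _ _ id).
have mg : measurable_fun setT (fun s : R => (`|s|^-1 * shell `|s|^-1)%:E).
  by apply/measurable_EFinP; apply: measurable_funM => //; exact: measurable_shell.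
have g0 (s : R) : (0 <= (`|s|^-1 * shell `|s|^-1)%:E)%E by rewrite lee_fin mulr_ge0 ?shell_ge0.
have mI : measurable (`[(-1), 1]%classic : set R) by exact: measurable_itv.
have Z (s : R) : 1 < `|s| -> `|s|^-1 * shell `|s|^-1 = 0.
  move=> s1; rewrite /shell invf_gt1 ?(lt_trans _ s1)// ltNge (ltW s1) /= mulr0 //.
rewrite /shell_const (integral_setCU mI mg g0) integral0_eq ?add0e; last first.
  by move=> s /= /negP; rewrite in_itv /= -ler_norml -ltNge => /Z ->.
apply: (@le_lt_trans _ _ (\int[mu]_(s in `[(-1)%R, 1%R]) (2%:E : \bar R))%E).
  apply: (ge0_le_integral_line mI) => //.
  move=> s _; rewrite lee_fin /shell; case: ifP => [/andP[_ h]|_]; last by rewrite mulr0.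
  by rewrite mulr1 ltW.
suff : (2%:E * mu `[(-1)%R, 1%R]%classic < +oo)%E by rewrite integral_cst.
rewrite lebesgue_measure_itv /= lte_fin.
have h : (-1 : R) < 1 by lra.
by rewrite h -EFinD -EFinM ltry.
Qed.

Lemma measurable_polar n (G : n.-tuple T -> R) : measurable_fun setT G ->
  measurable_fun setT (fun p : n.-tuple T * T =>
    (`|p.2|^-1 * `|p.2| ^+ n * shell (eucl_norm (p.1 : n.-tuple R)) * G (tscale p.2 p.1))%:E).
Proof.
move=> mG.
have ms : measurable_fun setT (fun p : n.-tuple T * T => (p.2 : R)) by exact: measurable_snd.
have mV : measurable_fun setT (fun p : n.-tuple T * T => `|p.2 : R|^-1) by exact: measurable_absV.
have mE : measurable_fun setT (fun p : n.-tuple T * T => eucl_norm (p.1 : n.-tuple R)).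
  exact: (measurableT_comp (@measurable_eucl n) measurable_fst).
apply/measurable_EFinP; apply: measurable_funM; last first.
  by apply: (measurableT_comp mG); exact: measurable_tscale.
apply: measurable_funM; last exact: measurable_shell.
apply: measurable_funM => //; apply: measurable_funX.
exact: (measurableT_comp (@normr_measurable R setT)).
Qed.

(* The factor [|s|^-1 * |s| ^ n] is [|s| ^ (n - 1)] for [s != 0], but it also
   vanishes at [s = 0] when [n = 1] because [0^-1 = 0]. *)
Definition polar_int n (G : n.-tuple T -> R) (y : n.-tuple T) : \bar R :=
  (\int[mu]_s (`|s|^-1 * `|s| ^+ n * shell (eucl_norm (y : n.-tuple R)) * G (tscale s y))%:E)%E.

Lemma measurable_polar_int n (G : n.-tuple T -> R) : measurable_fun setT G -> (forall x, 0 <= G x) ->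
  measurable_fun setT (polar_int G).
Proof.
move=> mG G0; apply: (@measurable_fun_fubini_tonelli_F _ _ _ _ _ mu _ (measurable_polar mG)) => p.
by rewrite lee_fin mulr_ge0// mulr_ge0 ?shell_ge0// mulr_ge0 ?exprn_ge0.
Qed.

(* The scaling [x = s y] turns the right-hand side into an integral over [x]
   of [G x] times the integral of [|s|^-1] over [|x| / 2 < |s| < |x|], which
   does not depend on [x]. *)
Lemma polar_integral n (G : n.-tuple T -> R) : (0 < n)%N -> measurable_fun setT G -> (forall x, 0 <= G x) ->
  (shell_const * \int[nu n]_x (G x)%:E =
   \int[nu n]_y polar_int G y)%E.
Proof.
move=> n0 mG G0; rewrite /polar_int.
have mV : measurable_fun setT (fun p : n.-tuple T * T => `|p.2 : R|^-1).
  by apply: measurable_absV; exact: measurable_snd.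
have mE : measurable_fun setT (fun p : n.-tuple T * T => eucl_norm (p.1 : n.-tuple R)).
  exact: (measurableT_comp (@measurable_eucl n) measurable_fst).
pose f1 (p : n.-tuple T * T) := (`|p.2|^-1 * `|p.2| ^+ n * shell (eucl_norm (p.1 : n.-tuple R)) * G (tscale p.2 p.1))%:E.
have mf1 : measurable_fun setT f1 by exact: measurable_polar.
have f10 p : (0 <= f1 p)%E.
  by rewrite lee_fin mulr_ge0// mulr_ge0 ?shell_ge0// mulr_ge0 ?exprn_ge0.
pose f2 (p : n.-tuple T * T) := (`|p.2|^-1 * shell (eucl_norm (p.1 : n.-tuple R) * `|p.2|^-1) * G p.1)%:E.
have mf2 : measurable_fun setT f2.
  apply/measurable_EFinP; apply: measurable_funM; last first.
    exact: (measurableT_comp mG measurable_fst).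
  apply: measurable_funM => //; apply: measurable_shell; exact: measurable_funM.
have f20 p : (0 <= f2 p)%E.
  by rewrite lee_fin mulr_ge0// mulr_ge0 ?shell_ge0.
transitivity (\int[nu n]_y \int[mu]_s f2 (y, s))%E; last first.
  rewrite [LHS](@fubini_tonelli _ _ _ _ _ (nu n) mu f2 mf2 f20) [RHS](@fubini_tonelli _ _ _ _ _ (nu n) mu f1 mf1 f10).
  apply: eq_integral => s _.
  (* The change of variables needs a nonzero [s]; at 0 both integrands vanish by the convention
     [0^-1 = 0]. *)
  have [->|s0] := eqVneq (s : R) 0.
    rewrite !integral0_eq// => y _; rewrite /f1 /f2 /= normr0 invr0 !mul0r//.
  pose H (x : n.-tuple T) := (shell (eucl_norm (x : n.-tuple R) * `|s|^-1) * G x)%:E.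
  have mH : measurable_fun setT H.
    apply/measurable_EFinP; apply: measurable_funM => //.
    by apply: measurable_shell; apply: measurable_funM => //; exact: measurable_eucl.
  have H0 x : (0 <= H x)%E by rewrite lee_fin mulr_ge0 ?shell_ge0.
  have sV : 0 <= `|s|^-1 by rewrite invr_ge0.
  transitivity ((`|s|^-1)%:E * \int[nu n]_x H x)%E.
    rewrite -ge0_integralZl_EFin//; apply: eq_integral => y _.
    by rewrite /f2 /H /= -EFinM mulrA.
  rewrite -(ge0_integral_tscale s0 mH H0) muleA -EFinM -ge0_integralZl_EFin//; last first.
    by apply: (measurableT_comp mH); exact: measurable_tscalel.
  apply: eq_integral => y _; rewrite /f1 /H -EFinM eucl_norm_scale /=.
  have n1 : `|s| != 0 by rewrite normr_eq0.
  by rewrite [`|s| * _]mulrC mulfK// !mulrA.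
have mGE : measurable_fun setT (fun x : n.-tuple T => (G x)%:E) by exact/measurable_EFinP.
have SC : shell_const \is a fin_num.
  by rewrite ge0_fin_numE ?shell_const_fin// ltW// shell_const_gt0.
rewrite -(fineK SC) -ge0_integralZl_EFin//; last first.
  by rewrite fine_ge0// ltW// shell_const_gt0.
  by move=> x _; rewrite lee_fin.
apply: ge0_ae_eq_integral => //.
- by apply: measurable_funeM.
- exact: (@measurable_fun_fubini_tonelli_F _ _ _ _ _ mu f2 mf2 f20).
- by move=> x _; rewrite mule_ge0// ?lee_fin// fine_ge0// ltW// shell_const_gt0.
- by move=> x _; exact: integral_ge0.
have [N [mN N0 HN]] := ae_neq0 n0; exists N; split=> // x /= hx; apply: HN => /= x0.
apply: hx => _; rewrite fineK//.
have v0 : 0 < eucl_norm (x : n.-tuple R) by rewrite lt_neqAle eq_sym x0 eucl_norm_ge0.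
rewrite -(shell_const_scale v0) muleC -(ge0_integralZ_line measurableT (G0 x)).
- by apply: eq_integral => s _; rewrite /f2 -EFinM /= mulrC.
- have ma : measurable_fun setT (fun s : R => `|s|^-1) by apply: (@measurable_absV _ _ id).
  apply/measurable_EFinP; apply: measurable_funM => //.
  by apply: measurable_shell; exact: measurable_funM.
- by move=> s; rewrite lee_fin mulr_ge0 ?shell_ge0.
Qed.

End tuples.

(** * Entire functions of several variables *)

Section complex_space.
Variables (R : realType) (d : nat).
Implicit Types (x y t : d.-tuple R) (z p q : 'rV[R[i]]_d) (F : 'rV[R[i]]_d -> R[i]) (delta : R).

Lemma real_point_scale (c : R) x : real_point (tscale c x) = c%:C *: real_point x.
Proof. by apply/rowP => i; rewrite !mxE tnth_tscale rmorphM. Qed.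

Lemma real_pointD x y : real_point x + real_point y = real_point [tuple tnth x i + tnth y i | i < d].
Proof. by apply/rowP => i; rewrite !mxE tnth_mktuple rmorphD. Qed.

Lemma entire_slice F p q : entire F -> entire1 (fun w => F (p + w *: q)).
Proof.
move=> eF; apply/entire1P => w.
have h : differentiable (fun w : R[i]^o => p + w *: q : 'rV[R[i]]_d) (w : R[i]^o).
  exact: (@differentiableD _ _ _ (cst p) (fun w : R[i]^o => w *: q : 'rV[R[i]]_d)).
exact: (differentiable_comp h (eF _)).
Qed.

Lemma entire_cont F z (e : R) : entire F -> 0 < e -> exists2 r : R, 0 < r &
  forall z', (forall i, normc (z 0 i - z' 0 i) < r) -> normc (F z - F z') <= e.
Proof.
move=> eF e0; have cF := differentiable_continuous (eF z).
move/cvgrPdist_le : cF => /(_ e%:C); rewrite ltcR => /(_ e0).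
move=> /nbhs_ballP[r /= r0 Hr].
have [r' rr' r'0] : exists2 r' : R, r = r'%:C & 0 < r'.
  by case: r r0 {Hr} => a b; rewrite ltcE /= => /andP[/eqP -> a0]; exists a.
exists r' => // z' Hz'.
have : `|F z - F z'| <= e%:C.
  by apply: Hr; split=> // i j; rewrite (ord1 i) /ball /= normE rr' ltcR; exact: Hz'.
by rewrite normE lecR.
Qed.

Lemma boxcont_entire F : entire F -> boxcont (fun x => normc (F (real_point x))).
Proof.
move=> eF x e e0; have [r r0 Hr] := entire_cont (real_point x) eF e0.
exists r => // y Hy; have := Hr (real_point y) _.
have H i : normc (real_point x 0 i - real_point y 0 i) < r.
  by rewrite !mxE -rmorphB normcR distrC; exact: Hy.
move=> /(_ H) h; rewrite ler_norml lerNl opprB.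
by rewrite !(le_trans (lerB_normc _ _))// normcB.
Qed.

Lemma eucl_le1_abs t i : eucl_norm t <= 1 -> `|tnth t i| <= 1.
Proof. by move=> h; exact: le_trans (abs_tnth_le t i) h. Qed.

Lemma cn_norm_ubound z : has_ubound [set normc (\sum_(i < d) z 0 i * (tnth t i)%:C)
      | t in [set t : d.-tuple R | eucl_norm t <= 1]].
Proof.
exists (\sum_(i < d) normc (z 0 i)) => _ [t /= ht <-].
elim/big_ind2 : _ => [|u1 v1 u2 v2 h1 h2|i _].
- by rewrite (normc0 R).
- exact: le_trans (le_normcD _ _) (lerD h1 h2).
- by rewrite normcM normcR ler_piMr ?normc_ge0// eucl_le1_abs.
Qed.

Lemma cn_norm_ge z t : eucl_norm t <= 1 -> normc (\sum_(i < d) z 0 i * (tnth t i)%:C) <= cn_norm z.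
Proof. by move=> ht; apply: ub_le_sup; [exact: cn_norm_ubound|exists t]. Qed.

Lemma tuple0_le1 : eucl_norm [tuple 0 | i < d] <= 1 :> R.
Proof.
rewrite /eucl_norm big1 ?sqrtr0// => i _; by rewrite tnth_mktuple expr0n.
Qed.

Lemma cn_norm_le z (B : R) : (forall t, eucl_norm t <= 1 ->
  normc (\sum_(i < d) z 0 i * (tnth t i)%:C) <= B) -> cn_norm z <= B.
Proof.
move=> H; apply: ge_sup => [|_ [t /= ht <-]]; last exact: H.
by eexists; exists [tuple 0 | i < d] => //; exact: tuple0_le1.
Qed.

Lemma cn_norm_ge0 z : 0 <= cn_norm z.
Proof. exact: le_trans (normc_ge0 _) (cn_norm_ge z tuple0_le1). Qed.

Lemma eucl_sqr x : eucl_norm x ^+ 2 = \sum_(i < d) tnth x i ^+ 2.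
Proof. by rewrite sqr_sqrtr// sumr_ge0// => i _; rewrite sqr_ge0. Qed.

(** Cauchy-Schwarz, from the nonnegativity of the sum of the squares of [x_i - |x| t_i]. *)
Lemma dot_le x t : eucl_norm t <= 1 -> \sum_(i < d) tnth x i * tnth t i <= eucl_norm x.
Proof.
move=> t1; set a := eucl_norm x.
have a0 : 0 <= a by exact: eucl_norm_ge0.
have T1 : \sum_(i < d) tnth t i ^+ 2 <= 1.
  by rewrite -eucl_sqr expr_le1// eucl_norm_ge0.
have [a00|an0] := eqVneq a 0.
  by rewrite big1 ?a00// => i _; rewrite (eucl_norm_eq0 a00) mul0r.
have ap : 0 < a by rewrite lt_neqAle eq_sym an0.
have : 0 <= \sum_(i < d) (tnth x i - a * tnth t i) ^+ 2 by apply: sumr_ge0 => i _; exact: sqr_ge0.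
have -> : \sum_(i < d) (tnth x i - a * tnth t i) ^+ 2 =
    a ^+ 2 - 2 * a * (\sum_(i < d) tnth x i * tnth t i) + a ^+ 2 * \sum_(i < d) tnth t i ^+ 2.
  have A2 : a ^+ 2 = \sum_(i < d) tnth x i ^+ 2 by exact: eucl_sqr.
  rewrite [X in _ = X - _ + _]A2 !mulr_sumr -sumrB -big_split /=.
  by apply: eq_bigr => i _; ring.
move: T1; set S := \sum_(i < d) _; set D := \sum_(i < d) _ => T1 h.
have h2 : a ^+ 2 * S <= a ^+ 2 by rewrite ler_piMr// sqr_ge0.
rewrite -(ler_pM2l ap); rewrite expr2 in h2 h; lra.
Qed.

Lemma cn_norm_real_le x (w : R[i]) : cn_norm (w *: real_point x) <= normc w * eucl_norm x.
Proof.
apply: cn_norm_le => t t1.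
have -> : \sum_(i < d) (w *: real_point x) 0 i * (tnth t i)%:C =
    w * (\sum_(i < d) tnth x i * tnth t i)%:C.
  rewrite rmorph_sum mulr_sumr; apply: eq_bigr => i _.
  by rewrite !mxE rmorphM mulrA.
rewrite normcM normcR ler_wpM2l ?normc_ge0// ler_norml dot_le// andbT lerNl -sumrN.
have t1' : eucl_norm (tscale (-1) t) <= 1 by rewrite eucl_norm_scale normrN1 mul1r.
apply: le_trans (dot_le x t1'); apply: ler_sum => i _.
by rewrite tnth_tscale mulN1r mulrN.
Qed.

(** This equality on complex lines with real unit direction lets slices inherit the bound on the
    exponential type without loss. *)
Lemma cn_norm_unit x (w : R[i]) : eucl_norm x = 1 -> cn_norm (w *: real_point x) = normc w.
Proof.
move=> x1; apply/eqP; rewrite eq_le; apply/andP; split.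
  by apply: le_trans (cn_norm_real_le _ _) _; rewrite x1 mulr1.
have x1' : eucl_norm x <= 1 by rewrite x1.
apply: le_trans (cn_norm_ge _ x1').
have -> : \sum_(i < d) (w *: real_point x) 0 i * (tnth x i)%:C = w * (eucl_norm x ^+ 2)%:C.
  rewrite eucl_sqr rmorph_sum mulr_sumr; apply: eq_bigr => i _.
  by rewrite !mxE expr2 rmorphM mulrA.
by rewrite x1 expr1n mulr1.
Qed.

Lemma exp_type_bound F delta T : (exp_type F <= delta%:E)%E -> delta < T ->
  exists2 M : R, 0 <= M & forall z, M < cn_norm z -> normc (F z) <= expR (T * cn_norm z).
Proof.
move=> Fd dT; have : (exp_type F < T%:E)%E by apply: le_lt_trans Fd _; rewrite lte_fin.
move=> /ereal_inf_lt[_ [V [M _ MV] <-] VT].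
exists (Num.max M 0); first by rewrite le_max lexx orbT.
move=> z; rewrite gt_max => /andP[Mz z0].
have [Fz|Fz] := eqVneq (normc (F z)) 0; first by rewrite Fz expR_ge0.
have Fp : 0 < normc (F z) by rewrite lt_neqAle eq_sym Fz normc_ge0.
have : (((cn_norm z)^-1)%:E * lne (normc (F z))%:E <= T%:E)%E.
  apply: le_trans (ltW VT); apply: ereal_sup_ubound; exists z => //; exact: MV.
rewrite lne_EFin// -EFinM lee_fin ler_pdivrMl// => h.
by rewrite -[leLHS](@lnK R) ?posrE// ler_expR mulrC.
Qed.

Lemma exp_type_le F delta : (forall T, delta < T -> exists C : R, forall z,
  normc (F z) <= C * expR (T * cn_norm z)) -> (exp_type F <= delta%:E)%E.
Proof.
move=> H; apply/lee_addgt0Pr => e e0; have e20 : 0 < e / 2 by rewrite divr_gt0.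
have [|C HC] := H (delta + e / 2); first by rewrite ltrDl.
pose C1 := Num.max C 1.
have C10 : 0 < C1 by rewrite lt_max ltr01 orbT.
(* Beyond [M] the logarithm of the constant costs at most [e / 2] times the norm; the maximum with 0
   keeps the norm positive for the division. *)
pose M := Num.max (ln C1 / (e / 2)) 0.
apply: le_trans (ereal_inf_lbound _) _.
  by exists [set z | M < cn_norm z] => //; exists M.
apply: ge_ereal_sup => _ [z zMM <-].
have : M < cn_norm z by exact: zMM.
rewrite gt_max => /andP[zM z0].
have [->|Fz] := eqVneq (normc (F z)) 0.
  by rewrite le0_lneNy// gt0_muleNy ?lte_fin ?invr_gt0// leNye.
have Fp : 0 < normc (F z) by rewrite lt_neqAle eq_sym Fz normc_ge0.
rewrite lne_EFin// -EFinM -EFinD lee_fin ler_pdivrMl//.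
have h : ln (normc (F z)) <= ln (C1 * expR ((delta + e / 2) * cn_norm z)).
  rewrite ler_ln ?posrE// ?mulr_gt0 ?expR_gt0//; apply: le_trans (HC z) _.
  by rewrite ler_wpM2r ?expR_ge0// le_max lexx.
apply: le_trans h _; rewrite lnM ?posrE ?expR_gt0// expRK.
move: zM; rewrite ltr_pdivrMr// => zM.
have E : cn_norm z * (delta + e) = cn_norm z * (e / 2) + (delta + e / 2) * cn_norm z by field.
by rewrite E lerD2r ltW.
Qed.

Lemma slice_etype F delta x : 0 < delta -> entire F -> (exp_type F <= delta%:E)%E ->
  eucl_norm x = 1 -> etype delta (fun w => F (w *: real_point x)).
Proof.
move=> d0 eF Fd x1.
have e1 : entire1 (fun w => F (w *: real_point x)).
  move=> w; have [l Hl] := entire_slice 0 (real_point x) eF w; exists l.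
  by apply: cderiv_ext Hl => v; rewrite add0r.
split=> // T dT; have T0 := lt_trans d0 dT.
have [M M0 HM] := exp_type_bound Fd dT.
have [c [fc _ ck]] := entire_taylor e1.
have M10 : 0 < M + 1 by rewrite ltr_wpDl.
have [K cK] := ck _ M10.
have K0 := prad_ge0 cK.
have MM : M < M + 1 by rewrite ltrDl.
pose B := K / (1 - M / (M + 1)).
have B0 : 0 <= B.
  by rewrite divr_ge0// subr_ge0 ler_pdivrMr// mul1r ltW.
(* The type controls the slice only beyond [M]; on the disc of radius [M] the Taylor series supplies
   the bound [B]. *)
exists (B + 1) => w; have [wM|Mw] := leP (normc w) M.
  rewrite fc; apply: le_trans (normc_csum (bsum_pser M10 cK wM MM)) _.
  apply: (@le_trans _ _ (B + 1)); first by rewrite lerDl.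
  have ex1 : 1 <= expR (T * normc w).
    by rewrite -[leLHS]expR0 ler_expR mulr_ge0 ?normc_ge0// ltW.
  by apply: ler_peMr => //; rewrite addr_ge0.
have nw := cn_norm_unit w x1.
have := HM (w *: real_point x); rewrite nw => /(_ Mw) h; apply: le_trans h _.
by rewrite ler_peMl ?expR_ge0// lerDr.
Qed.

Lemma slice_coef F delta x : 0 < delta -> entire F -> (exp_type F <= delta%:E)%E ->
  eucl_norm x = 1 -> exists2 c, egrow delta c &
    forall s : R, F (real_point (tscale s x)) = pser c s%:C.
Proof.
move=> d0 eF Fd x1; have [c cg Hc] := etype_coef d0 (slice_etype d0 eF Fd x1).
by exists c => // s; rewrite real_point_scale Hc.
Qed.

(** For even [c] these are the coefficients of w |-> c(sqrt w), which is entire; composing with the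
    sum of squares thus requires no branch of the square root. *)
Definition kappa (c : nat -> R[i]) n := c n.*2.

Lemma pser_kappa a (c : nat -> R[i]) w : 0 < a -> egrow a c -> evenc c ->
  pser (kappa c) (w ^+ 2) = pser c w.
Proof.
move=> a0 cg ev; have r0 : 0 <= normc w + 1 by rewrite addr_ge0 ?normc_ge0.
have rp : 0 < normc w + 1 by rewrite ltr_wpDl ?normc_ge0.
have wr : normc w < normc w + 1 by rewrite ltrDl.
have [K cK] := egrow_pradr a0 r0 cg.
have kK : prad (kappa c) ((normc w + 1) ^+ 2) K.
  by move=> n; rewrite -exprM mulnC muln2; exact: cK.
have w2 : normc (w ^+ 2) < (normc w + 1) ^+ 2.
  by rewrite normcX ltrXn2r// ?nnegrE ?normc_ge0 ?(ltW rp).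
have S N : \sum_(0 <= i < N.*2) c i * w ^+ i = \sum_(0 <= i < N) kappa c i * (w ^+ 2) ^+ i.
  elim: N => [|N IH]; first by rewrite !big_nil.
  rewrite doubleS !big_nat_recr//= IH -addrA; congr (_ + _).
  rewrite (ev N.*2.+1) ?mul0r ?addr0; last by rewrite /= odd_double.
  by rewrite -exprM mul2n.
apply/eqP; rewrite -subr_eq0 -normc_eq0 eq_le normc_ge0 andbT.
apply/ler_addgt0Pl => e e0; rewrite addr0.
have e20 : 0 < e / 2 by rewrite divr_gt0.
have [N1 H1] := csum_cvg (bsum_pser rp cK (lexx _) wr) e20.
have [N2 H2] := csum_cvg (bsum_pser (exprn_gt0 2 rp) kK (lexx _) w2) e20.
pose N := maxn N1 N2.
have N1N : (N1 <= N.*2)%N.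
  by rewrite (leq_trans (leq_maxl _ _ : (N1 <= N)%N))// -addnn leq_addr.
have := lerD (H2 N (leq_maxr _ _)) (H1 _ N1N); rewrite -splitr S; apply: le_trans.
rewrite [X in _ <= _ + X]normcB; apply: le_trans (le_normcD _ _).
by rewrite addrA subrK.
Qed.

Definition lift_fun c z := pser (kappa c) (\sum_(i < d) z 0 i ^+ 2).

Lemma kappa_entire1 a (c : nat -> R[i]) : 0 < a -> egrow a c -> entire1 (pser (kappa c)).
Proof.
move=> a0 cg w; pose r := normc w + 1.
have r0 : 0 <= r by rewrite addr_ge0 ?normc_ge0.
have [K cK] := egrow_pradr a0 (sqrtr_ge0 r) cg.
have kK : prad (kappa c) r K.
  move=> n; have := cK n.*2; rewrite -mul2n exprM sqr_sqrtr// mul2n.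
  exact.
by eexists; apply: (cderiv_pser kK); rewrite /r ltrDl.
Qed.

Lemma lift_entire a (c : nat -> R[i]) : 0 < a -> egrow a c -> entire (lift_fun c).
Proof.
move=> a0 cg z.
have h : differentiable (fun z : 'rV[R[i]]_d => \sum_(i < d) z 0 i ^+ 2 : R[i]^o) z.
  rewrite (_ : (fun z => _) = \sum_(i < d) (fun z : 'rV[R[i]]_d => z 0 i ^+ 2 : R[i]^o)); last first.
    by apply/funext => u; rewrite fct_sumE.
  apply: differentiable_sum => i.
  rewrite (_ : (fun z => _) = (fun z : 'rV[R[i]]_d => z 0 i : R[i]^o) * (fun z => z 0 i)).
    by apply: differentiableM; exact: differentiable_coord.
  by apply/funext => u.
have /entire1P k := kappa_entire1 a0 cg.
exact: (differentiable_comp h (k _)).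
Qed.

Lemma Re_sqr_le (v : R[i]) : Re (v ^+ 2) <= Re v ^+ 2.
Proof.
case: v => p q; rewrite [Re _](_ : _ = p ^+ 2 - q ^+ 2); last by rewrite expr2 /=; ring.
by rewrite gerBl sqr_ge0.
Qed.

Lemma Re_mulR (v : R[i]) (s : R) : Re (v * s%:C) = Re v * s.
Proof. by case: v => p q /=; ring. Qed.

(* After multiplication of [z = x + i y] by a phase the sum of squares is
   real and nonnegative, hence equal to [|x|^2 - |y|^2]. *)
Lemma sum_sqr_le z : normc (\sum_(i < d) z 0 i ^+ 2) <= cn_norm z ^+ 2.
Proof.
set S := \sum_(i < d) _.
have [->|S0] := eqVneq S 0; first by rewrite (normc0 R) sqr_ge0.
have ww : sqrtc S ^+ 2 = S by exact: sqr_sqrtc.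
set w := sqrtc S in ww.
have w0 : w != 0 by apply: contraNneq S0 => w0; rewrite -ww w0 expr0n.
have nw0 : normc w != 0 by rewrite normc_eq0.
pose u : R[i] := (normc w)%:C / w.
have nu : normc u = 1.
  have : normc (u * w) = normc w by rewrite /u mulfVK// normcR ger0_norm ?normc_ge0.
  by rewrite normcM -[RHS]mul1r => /(mulIf nw0).
have uS : \sum_(i < d) (u * z 0 i) ^+ 2 = (normc w ^+ 2)%:C.
  have -> : \sum_(i < d) (u * z 0 i) ^+ 2 = u ^+ 2 * S.
    by rewrite mulr_sumr; apply: eq_bigr => i _; rewrite exprMn.
  by rewrite -ww -exprMn /u mulfVK// rmorphXn.
pose x : d.-tuple R := [tuple Re (u * z 0 i) | i < d].
have Sx : normc S <= eucl_norm x ^+ 2.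
  rewrite -ww normcX -[normc w ^+ 2]/(Re (normc w ^+ 2)%:C) -uS Re_sum eucl_sqr.
  by apply: ler_sum => i _; rewrite tnth_mktuple; exact: Re_sqr_le.
apply: le_trans Sx _; rewrite lerXn2r ?nnegrE ?eucl_norm_ge0 ?cn_norm_ge0//.
have [->|x0] := eqVneq (eucl_norm x) 0; first exact: cn_norm_ge0.
have xp : 0 < eucl_norm x by rewrite lt_neqAle eq_sym x0 eucl_norm_ge0.
pose t := tscale (eucl_norm x)^-1 x.
have t1 : eucl_norm t <= 1.
  by rewrite eucl_norm_scale gtr0_norm ?invr_gt0// mulVf.
apply: le_trans (cn_norm_ge z t1).
rewrite -[leRHS]mul1r -nu -normcM; apply: le_trans (le_Re_normc _); apply: le_trans (ler_norm _).
rewrite mulr_sumr Re_sum (_ : \sum_(i < d) _ = (eucl_norm x)^-1 * eucl_norm x ^+ 2).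
  by rewrite expr2 mulrA mulVf// mul1r.
rewrite eucl_sqr mulr_sumr; apply: eq_bigr => i _.
by rewrite mulrA Re_mulR /t tnth_tscale !tnth_mktuple mulrCA expr2.
Qed.

Lemma lift_exp_type delta (c : nat -> R[i]) : 0 < delta -> egrow delta c -> evenc c ->
  (exp_type (lift_fun c) <= delta%:E)%E.
Proof.
move=> d0 cg ev; apply: exp_type_le => T dT; have T0 := lt_trans d0 dT.
have [C HC] := cg _ dT; have C0 := growth_const_ge0 HC.
exists C => z; rewrite /lift_fun.
have := sum_sqr_le z; set S := \sum_(i < d) _ => Sz.
have ww : sqrtc S ^+ 2 = S by exact: sqr_sqrtc.
rewrite -ww (pser_kappa _ d0 cg ev).
apply: le_trans (normc_csum (normc_pser_exp _ (ltW T0) HC)) _.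
rewrite ler_wpM2l// ler_expR ler_wpM2l ?(ltW T0)//.
rewrite -(@ler_pXn2r _ 2) ?nnegrE ?normc_ge0 ?cn_norm_ge0//.
by rewrite -normcX ww.
Qed.

Lemma lift_real delta (c : nat -> R[i]) x : 0 < delta -> egrow delta c -> evenc c ->
  lift_fun c (real_point x) = pser c (eucl_norm x)%:C.
Proof.
move=> d0 cg ev; rewrite -(pser_kappa _ d0 cg ev) /lift_fun -rmorphXn /= eucl_sqr rmorph_sum.
by congr (pser _ _); apply: eq_bigr => i _; rewrite mxE rmorphXn.
Qed.

End complex_space.

(** * Energies in dimension d and their polar slices *)

Section energies.
Variables (R : realType) (d : nat).
Hypothesis d_gt0 : (0 < d)%N.
Notation T := (measurableTypeR R).
Notation mu := (@lebesgue_measure R).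
Notation nu := (@lebesgue_Rn R).
Implicit Types (x y : d.-tuple R) (z : 'rV[R[i]]_d) (F : 'rV[R[i]]_d -> R[i]) (delta a : R).

Definition dens a F x : R := normc (F (real_point x)) ^+ 2 * eucl_norm x `^ (2 * a + 2 - d%:R).

Lemma dens_ge0 a F x : 0 <= dens a F x.
Proof. by rewrite mulr_ge0 ?sqr_ge0 ?powR_ge0. Qed.

Lemma measurable_dens a F : entire F -> measurable_fun setT (fun x : d.-tuple T => dens a F x).
Proof.
move=> eF; apply: measurable_funM.
  apply: measurable_funX.
  exact: (@measurable_boxcont R _ _ d (fun x : d.-tuple T => x) _ (@measurable_id _ _ _) (boxcont_entire eF)).
exact: (measurableT_comp (measurable_powR _) (@measurable_eucl R d)).
Qed.

(** The substitution of s / |y| for s reduces to a unit direction. There the Jacobian |s|^(d-1)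
    meets the weight |s|^(2a+2-d) and leaves |s|^(2a+1), an exponent free of the dimension. *)
Lemma dens_slice a F delta (c : nat -> R[i]) y : entire F -> 0 < delta -> egrow delta c -> 0 < eucl_norm y ->
  (forall s : R, F (real_point (tscale s (tscale (eucl_norm y)^-1 y))) = pser c s%:C) ->
  ((eucl_norm y ^+ d)%:E * \int[mu]_s (`|s|^-1 * `|s| ^+ d * shell (eucl_norm y) * dens a F (tscale s y))%:E
   = (shell (eucl_norm y))%:E * E1 (2 * a + 1) c)%E.
Proof.
move=> eF de0 cg v0 Fc; set v := eucl_norm y in v0 Fc *.
pose x := tscale v^-1 y.
have vn : v != 0 by rewrite gt_eqF.
have x1 : eucl_norm x = 1 by rewrite eucl_norm_scale gtr0_norm ?invr_gt0// mulVf.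
have yx s : tscale s y = tscale (v * s) x.
  by apply: eq_from_tnth => i; rewrite !tnth_tscale mulrACA mulfV// mul1r.
pose g (s : R) := (`|s|^-1 * `|s| ^+ d * dens a F (tscale s x))%:E.
have ma : measurable_fun setT (fun s : R => `|s|^-1) by apply: (@measurable_absV _ _ _ id).
have md : measurable_fun setT (fun s : R => `|s| ^+ d).
  by apply: measurable_funX; exact: normr_measurable.
have mt : measurable_fun setT (fun s : T => tscale s x : d.-tuple T).
  apply: (measurableT_comp (@measurable_tscale R d) (g := fun s : T => (x : d.-tuple T, s))).
  exact: measurable_fun_pair.
have mg : measurable_fun setT g.
  apply/measurable_EFinP; apply: measurable_funM; first exact: measurable_funM.
  exact: (measurableT_comp (measurable_dens a eF) mt).
have g0 s : (0 <= g s)%E by rewrite lee_fin mulr_ge0 ?dens_ge0// mulr_ge0 ?exprn_ge0 ?invr_ge0.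
have mgv : measurable_fun setT (fun s : R => g (v * s)).
  by apply: (measurableT_comp mg); exact: measurable_scale.
have vd0 : 0 <= v ^+ d by rewrite exprn_ge0 ?(ltW v0).
have E1g : (\int[mu]_s g s = E1 (2 * a + 1) c)%E.
  apply: (eq_integral_off0 mg (E1_measurable (2 * a + 1) de0 cg) g0).
    by move=> s; rewrite lee_fin mulr_ge0 ?sqr_ge0 ?powR_ge0.
  move=> s s0.
  rewrite /g /dens Fc eucl_norm_scale x1 mulr1; congr EFin.
  have S0 : 0 < `|s| by rewrite normr_gt0.
  rewrite mulrCA; congr (_ * _).
  rewrite -(powR_inv1 (ltW S0)) -(powR_mulrn d (ltW S0)).
  rewrite -powRD; last by rewrite (gt_eqF S0) implybT.
  rewrite -powRD; last by rewrite (gt_eqF S0) implybT.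
  by congr powR; ring.
rewrite -E1g -(ge0_integral_scale vn mg g0) gtr0_norm//.
rewrite -(ge0_integralZ_line measurableT (ltW v0) mgv (fun s => g0 _)).
pose k (s : R) := (`|s|^-1 * `|s| ^+ d * shell v * dens a F (tscale s y))%:E.
have kE s : k s = (((v ^+ d)^-1 * shell v)%R%:E * (v%:E * g (v * s)%R))%E.
  rewrite /k /g -!EFinM yx normrM (gtr0_norm v0) invfM exprMn; congr EFin.
  have vdn : v ^+ d != 0 by rewrite expf_neq0.
  move: (v ^+ d) vdn (`|s|^-1) (`|s| ^+ d) (dens a F _) (shell v) => V Vn A B D S.
  by field; rewrite Vn vn.
have mk : measurable_fun setT (fun s : R => v%:E * g (v * s)%R)%E by exact: measurable_funeM.
have k0 s : (0 <= v%:E * g (v * s)%R)%E by rewrite mule_ge0// lee_fin ltW.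
rewrite [X in (_ * X)%E = _](_ : _ = (\int[mu]_s (((v ^+ d)^-1 * shell v)%R%:E * (v%:E * g (v * s)%R)))%E); last first.
  by apply: eq_integral => s _; exact: kE.
rewrite (ge0_integralZ_line measurableT _ mk k0) ?mulr_ge0 ?shell_ge0 ?invr_ge0//.
by rewrite muleA -EFinM mulrA divff ?mul1r// expf_neq0.
Qed.

(** Zero energy makes [F] vanish almost everywhere on the real points, hence everywhere there, since
    a nonzero value would persist on a box of positive measure. *)
Lemma energy_neq0 a F : entire F -> F <> cst 0 -> energy a F != 0%E.
Proof.
move=> eF Fn0; apply/eqP => E0; apply: Fn0.
have md := measurable_dens a eF.
have mdE : measurable_fun setT (fun x : d.-tuple T => (dens a F x)%:E) by exact/measurable_EFinP.
have [N [mN N0 HN]] : ae_eq (nu d) setT (fun x : d.-tuple T => (dens a F x)%:E) (cst 0%E).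
  apply/(ae_eq_integral_abs (nu d) measurableT mdE).
  by rewrite -[RHS]E0; apply: eq_integral => x _; rewrite gee0_abs ?lee_fin ?dens_ge0.
have [N2 [mN2 N20 HN2]] := @ae_neq0 R d d_gt0.
have Z x : F (real_point x) = 0.
  apply: contrapT => /eqP; rewrite -normc_gt0 => Fx.
  have e0 : 0 < normc (F (real_point x)) / 2 by rewrite divr_gt0.
  have [r r0 Hr] := boxcont_entire eF x e0.
  pose A i : set T := `](tnth x i - r), (tnth x i + r)[%classic.
  have mA i : measurable (A i) by exact: measurable_itv.
  have : (nu d [set t | forall i, A i (tnth t i)] <= 0)%E.
    rewrite -(@measureU0 _ _ _ (nu d) N N2 mN mN2 N20) in N0; rewrite -N0.
    apply: le_measure; rewrite ?inE.
    - rewrite (_ : [set t | _] = \bigcap_(i in setT) ((fun t : d.-tuple T => tnth t i) @^-1` A i)).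
        apply: fin_bigcap_measurable => // i _; rewrite -[X in measurable X]setTI.
        by apply: measurable_tnth.
      by apply/seteqP; split => t H i; [move=> _; exact: H|exact: (H i I)].
    - exact: measurableU.
    move=> y /= Hy.
    have /Hr : forall i, `|tnth y i - tnth x i| < r.
      by move=> i; have := Hy i; rewrite /A /= in_itv /= -ltr_distlC distrC.
    rewrite ler_distl => /andP[h _]; have Fy : 0 < normc (F (real_point y)) by lra.
    have [y0|y0] := eqVneq (eucl_norm y) 0.
      by right; apply: HN2 => /=; rewrite y0 eqxx.
    left; apply: HN => /= /(_ I) []; apply/eqP; rewrite mulf_neq0//.
      by rewrite expf_neq0// gt_eqF.
    by rewrite gt_eqF// powR_gt0// lt_neqAle eq_sym y0 eucl_norm_ge0.
  rewrite /lebesgue_Rn (power_measure_box mu mA).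
  rewrite (eq_bigr (fun=> (2 * r)%:E)); last first.
    move=> i _; have h : tnth x i - r < tnth x i + r by lra.
    by etransitivity; [exact: (lebesgue_itv_oo h)|congr EFin; ring].
  rewrite prodEFin lee_fin leNgt; apply/negP/negPn.
  by apply: prodr_gt0 => i _; rewrite mulr_gt0.
apply/funext => z; rewrite /cst.
pose x : d.-tuple R := [tuple Re (z 0 i) | i < d].
pose y : d.-tuple R := [tuple Im (z 0 i) | i < d].
(* The vanishing extends to complex points: w |-> F (x + w y) is entire, vanishes for real w, and
   takes the value [F z] at i. *)
have zE : z = real_point x + 'i *: real_point y.
  apply/rowP => i; rewrite !mxE !tnth_mktuple.
  by case: (z 0 i) => p q; apply/eqP; rewrite eq_complex /=; apply/andP; split; apply/eqP; ring.
have [c [fc _ ck]] := entire_taylor (entire_slice (real_point x) (real_point y) eF).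
have [K cK] := ck 1 ltr01.
have c0 n : c n = 0.
  apply: (pser_eq0 ltr01 ltr01 cK) => s _ _; rewrite -fc -real_point_scale.
  by rewrite real_pointD Z.
rewrite zE fc (_ : c = fun=> 0); last by apply/funext.
apply/eqP; rewrite -normc_eq0 eq_le normc_ge0 andbT; apply: normc_csum => n.
by rewrite big1// => i _; rewrite mul0r (normc0 R).
Qed.

End energies.

(** * Comparison with the one-dimensional problem *)

Section comparison.
Variables (R : realType) (d : nat) (a b delta lam : R).
Hypotheses (d_gt0 : (0 < d)%N) (delta_gt0 : 0 < delta) (lam_gt0 : 0 < lam).
Notation T := (measurableTypeR R).
Notation mu := (@lebesgue_measure R).
Notation nu := (@lebesgue_Rn R).
Implicit Types (F : 'rV[R[i]]_d -> R[i]) (y : d.-tuple R) (c : nat -> R[i]).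

Definition polar_dens e F y : \bar R := @polar_int R d (dens e F) y.

Lemma polar_dens_ge0 e F y : (0 <= polar_dens e F y)%E.
Proof.
apply: integral_ge0 => s _; rewrite lee_fin mulr_ge0 ?dens_ge0//.
by rewrite mulr_ge0 ?shell_ge0// mulr_ge0 ?exprn_ge0.
Qed.

Lemma energy_ge0 e F : (0 <= energy e F)%E.
Proof. by apply: integral_ge0 => x _; rewrite lee_fin; exact: dens_ge0. Qed.

Lemma energy_polar e F : entire F -> (shell_const R * energy e F = \int[nu d]_y polar_dens e F y)%E.
Proof. by move=> eF; exact: (polar_integral d_gt0 (measurable_dens e eF) (dens_ge0 e F)). Qed.

Lemma measurable_polar_dens e F : entire F -> measurable_fun setT (fun y : d.-tuple T => polar_dens e F y).
Proof. by move=> eF; exact: (measurable_polar_int (measurable_dens e eF) (dens_ge0 e F)). Qed.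

Lemma polar_dens0 e F y : eucl_norm y = 0 -> polar_dens e F y = 0%E.
Proof.
move=> y0; apply: integral0_eq => s _; rewrite y0 /shell ltNge ler01 /=.
by rewrite mulr0 mul0r.
Qed.

Lemma shell_const_mul_inj (u v : \bar R) : (shell_const R * u = shell_const R * v)%E -> u = v.
Proof.
have S0 := shell_const_gt0 R; have Soo := shell_const_fin R.
have SC : shell_const R \is a fin_num by rewrite ge0_fin_numE// ltW.
have F0 : 0 < fine (shell_const R) by rewrite fine_gt0// S0 Soo.
rewrite -(fineK SC) => h; apply/eqP; rewrite eq_le.
by apply/andP; split; rewrite -(@lee_pmul2l _ (fine (shell_const R))%:E)// h.
Qed.

Lemma shell_const_mul_le (u v : \bar R) : (shell_const R * u <= shell_const R * v)%E -> (u <= v)%E.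
Proof.
have S0 := shell_const_gt0 R; have Soo := shell_const_fin R.
have SC : shell_const R \is a fin_num by rewrite ge0_fin_numE// ltW.
have F0 : 0 < fine (shell_const R) by rewrite fine_gt0// S0 Soo.
by rewrite -(fineK SC) lee_pmul2l.
Qed.

(** The inequality is proved for the polar densities at each [y] and then integrated. The slice is
    chosen separately for each [y], so no measurable dependence of its coefficients on the direction
    is involved. *)
Lemma energy_le F : entire F -> (exp_type F <= delta%:E)%E ->
  (forall c, egrow delta c -> (lam%:E * E1 (2 * b + 1) c <= E1 (2 * a + 1) c)%E) ->
  (lam%:E * energy b F <= energy a F)%E.
Proof.
move=> eF Fd H; have l0 := ltW lam_gt0.
have P0 e := polar_dens_ge0 e F.
apply: shell_const_mul_le; rewrite muleCA !energy_polar//.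
rewrite -ge0_integralZl_EFin//; last exact: measurable_polar_dens.
apply: ge0_le_integral => //.
- by move=> y _; rewrite mule_ge0.
- by apply: measurable_funeM; exact: measurable_polar_dens.
- exact: measurable_polar_dens.
move=> y _.
have [y0|y0] := eqVneq (eucl_norm y) 0; first by rewrite !polar_dens0// mule0.
have v0 : 0 < eucl_norm y by rewrite lt_neqAle eq_sym y0 eucl_norm_ge0.
have x1 : eucl_norm (tscale (eucl_norm y)^-1 y) = 1.
  by rewrite eucl_norm_scale gtr0_norm ?invr_gt0// mulVf.
have [c cg Fc] := slice_coef delta_gt0 eF Fd x1.
have D e := dens_slice e eF delta_gt0 cg v0 Fc.
have vd : (0 < (eucl_norm y ^+ d)%:E)%E by rewrite lte_fin exprn_gt0.
rewrite -(@lee_pmul2l _ (eucl_norm y ^+ d)%:E)// muleCA.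
rewrite [X in (lam%:E * X <= _)%E]D [leRHS]D muleCA.
by apply: lee_wpmul2l; [rewrite lee_fin shell_ge0|exact: H].
Qed.

Section lifted.
Variable c : nat -> R[i].
Hypotheses (cg : egrow delta c) (ev : evenc c).
Let F := lift_fun (d := d) c.

Lemma lift_slice y : 0 < eucl_norm y ->
  forall s : R, F (real_point (tscale s (tscale (eucl_norm y)^-1 y))) = pser c s%:C.
Proof.
move=> v0 s; have V0 : 0 < (eucl_norm y)^-1 by rewrite invr_gt0.
have E : eucl_norm (tscale s (tscale (eucl_norm y)^-1 y)) = `|s|.
  by rewrite !eucl_norm_scale (gtr0_norm V0) mulVf ?mulr1// gt_eqF.
rewrite [LHS](lift_real _ delta_gt0 cg ev) E.
have [_|_] := ger0P s; first by [].
have -> : (- s)%:C = - s%:C :> R[i] by exact: rmorphN.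
exact: pser_neg.
Qed.

Lemma lift_polar_dens e y : 0 < eucl_norm y ->
  ((eucl_norm y ^+ d)%:E * polar_dens e F y = (shell (eucl_norm y))%:E * E1 (2 * e + 1) c)%E.
Proof.
move=> v0; have eF : entire F by exact: lift_entire cg.
exact: (@dens_slice R d e F delta c y eF delta_gt0 cg v0 (lift_slice v0)).
Qed.

Lemma lift_energy : E1 (2 * a + 1) c = (lam%:E * E1 (2 * b + 1) c)%E ->
  energy a F = (lam%:E * energy b F)%E.
Proof.
move=> cE; have l0 := ltW lam_gt0; have eF : entire F by exact: lift_entire cg.
apply: shell_const_mul_inj; rewrite muleCA !energy_polar//.
rewrite -ge0_integralZl_EFin//; last 2 first.
- by move=> y _; exact: polar_dens_ge0.
- exact: measurable_polar_dens.
apply: eq_integral => y _.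
have [y0|y0] := eqVneq (eucl_norm (y : d.-tuple R)) 0; first by rewrite !polar_dens0// mule0.
have v0 : 0 < eucl_norm (y : d.-tuple R) by rewrite lt_neqAle eq_sym y0 eucl_norm_ge0.
have vd : (0 < (eucl_norm (y : d.-tuple R) ^+ d)%:E)%E by rewrite lte_fin exprn_gt0.
have K : ((eucl_norm (y : d.-tuple R) ^+ d)%:E * polar_dens a F y =
    (eucl_norm (y : d.-tuple R) ^+ d)%:E * (lam%:E * polar_dens b F y))%E.
  by rewrite [RHS]muleCA !lift_polar_dens// cE muleCA.
apply/eqP; rewrite eq_le; apply/andP; split;
  by rewrite -(@lee_pmul2l _ (eucl_norm (y : d.-tuple R) ^+ d)%:E)// K.
Qed.

(** The shell is bounded and stays away from the origin: for 1 < |y| < 2 the polar density is [E1]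
    divided by |y|^d, hence at most [E1], and elsewhere it is 0. Its integral is thus at most [E1]
    times the volume of the cube [-2, 2]^d. *)
Lemma lift_energy_fin : (E1 (2 * a + 1) c < +oo)%E -> (energy a F < +oo)%E.
Proof.
move=> cE; have eF : entire F by exact: lift_entire cg.
have Ef := E1_fin_num cE; set E := fine (E1 (2 * a + 1) c).
have E0 : 0 <= E by rewrite fine_ge0// E1_ge0.
pose A (i : 'I_d) : set T := `[(-2)%R, 2%R]%classic.
have mA i : measurable (A i) by exact: measurable_itv.
pose B : set (d.-tuple T) := [set t | forall i, A i (tnth t i)].
have mB : measurable B.
  rewrite (_ : B = \bigcap_(i in setT) ((fun t : d.-tuple T => tnth t i) @^-1` A i)).
    apply: fin_bigcap_measurable => // i _; rewrite -[X in measurable X]setTI.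
    by apply: measurable_tnth.
  by apply/seteqP; split => t H i; [move=> _; exact: H|exact: (H i I)].
have B_fin : (nu d B < +oo)%E.
  rewrite /lebesgue_Rn (power_measure_box mu mA) (eq_bigr (fun=> (2 - (-2))%:E)).
    by rewrite prodEFin ltry.
  by move=> i _; apply: lebesgue_itv_cc; lra.
have S0 := shell_const_gt0 R; have Soo := shell_const_fin R.
have : (shell_const R * energy a F < +oo)%E.
  rewrite energy_polar//.
  apply: (@le_lt_trans _ _ (\int[nu d]_y (E%:E * (\1_B y)%:E))%E).
    apply: ge0_le_integral => //.
    - by move=> y _; exact: polar_dens_ge0.
    - exact: measurable_polar_dens.
    - by apply: measurable_funeM; apply/measurable_EFinP; exact: measurable_indic.
    move=> y _.
    have [y0|y0] := eqVneq (eucl_norm (y : d.-tuple R)) 0.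
      by rewrite polar_dens0// -EFinM lee_fin mulr_ge0.
    have v0 : 0 < eucl_norm (y : d.-tuple R) by rewrite lt_neqAle eq_sym y0 eucl_norm_ge0.
    have vd0 : 0 < eucl_norm (y : d.-tuple R) ^+ d by rewrite exprn_gt0.
    have vd : (0 < (eucl_norm (y : d.-tuple R) ^+ d)%:E)%E by rewrite lte_fin.
    rewrite -(@lee_pmul2l _ (eucl_norm (y : d.-tuple R) ^+ d)%:E)// lift_polar_dens//.
    rewrite -(fineK Ef) -/E -!EFinM lee_fin /shell; case: ifP => [/andP[v1 v2]|_]; last first.
      by rewrite mul0r mulr_ge0 ?(ltW vd0)// mulr_ge0.
    rewrite indicE mem_set ?mulr1 ?mul1r.
      by rewrite ler_peMl// exprn_ege1// ltW.
    move=> i; rewrite /A /= in_itv /= -ler_norml.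
    by apply: le_trans (abs_tnth_le (y : d.-tuple R) i) _; exact: ltW.
  rewrite ge0_integralZl_EFin//; last by apply/measurable_EFinP; exact: measurable_indic.
  rewrite integral_indic// setIT.
  exact: lte_mul_pinfty.
move=> h; have [Eoo|] := eqVneq (energy a F) +oo%E; last by rewrite ltey.
by rewrite Eoo gt0_muley in h.
Qed.

End lifted.

End comparison.

(** * The radial extremizer *)

Theorem theorem3 (R : realType) (alpha beta delta : R) (d : nat)
    (hd : (0 < d)%N) (hab : beta <= alpha) (hb : -1 < beta) (hdelta : 0 < delta) :
  exists F : 'rV[R[i]]_d -> R[i],
    extremizer alpha beta delta F /\ radial F.
Proof.
have s1 : -1 < 2 * beta + 1 by lra.
have st : 2 * beta + 1 <= 2 * alpha + 1 by lra.
have t1 : -1 < 2 * alpha + 1 by lra.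
have [c0 [c0g c0e c0n c0oo]] := test_function hdelta t1.
have [lam [g [[l0 gg ge gn gE] [goo H]]]] :=
  minimizer_all hdelta s1 st c0g c0e (c0n _) c0oo.
pose F := lift_fun (d := d) g.
have eF : entire F by exact: lift_entire gg.
have Ft : (exp_type F <= delta%:E)%E by exact: lift_exp_type.
have Foo : (energy alpha F < +oo)%E by exact: (lift_energy_fin hd hdelta gg ge goo).
have FE : energy alpha F = (lam%:E * energy beta F)%E by exact: (lift_energy hd hdelta l0 gg ge gE).
have Fn0 : F <> cst 0.
  move=> F0; move/eqP: gn; apply.
  have g0 n : g n = 0.
    have [K gK] := egrow_pradr hdelta ler01 gg.
    apply: (pser_eq0 ltr01 ltr01 gK) => x x0 _.
    (* A point of norm [x] on the first coordinate axis, through which the vanishing of [F] reaches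
       the series of [g]. *)
    pose y : d.-tuple R := [tuple if i == Ordinal hd then x else 0 | i < d].
    have y1 : eucl_norm y = x.
      rewrite /eucl_norm (bigD1 (Ordinal hd))//= tnth_mktuple eqxx big1 ?addr0.
        by rewrite sqrtr_sqr gtr0_norm.
      by move=> i /negbTE i0; rewrite tnth_mktuple i0 expr0n.
    by rewrite -y1 -(lift_real y hdelta gg ge) -/F F0.
  apply: integral0_eq => x _; rewrite (_ : pser g x%:C = 0) ?(normc0 R) ?expr0n ?mul0r//.
  apply/eqP; rewrite -normc_eq0 eq_le normc_ge0 andbT; apply: normc_csum => n.
  by rewrite big1// => i _; rewrite g0 mul0r (normc0 R).
have FB : (energy beta F < +oo)%E.
  rewrite ltey; apply/eqP => Eoo; move: Foo; rewrite FE Eoo gt0_muley ?lte_fin// ltxx//.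
(* Since [lam] is positive, a finite alpha-energy forces a finite beta-energy, and [energy_neq0]
   excludes 0; the quotient of extended reals is then an ordinary one. *)
have ratio (G : 'rV[R[i]]_d -> R[i]) : entire G -> G <> cst 0 -> (energy alpha G < +oo)%E -> (lam%:E * energy beta G <= energy alpha G)%E ->
    (lam%:E <= energy alpha G / energy beta G)%E.
  move=> eG Gn0 Goo Gle.
  have B0 := energy_neq0 hd beta eG Gn0.
  have Boo : (energy beta G < +oo)%E.
    rewrite ltey; apply/eqP => Eoo; move: Gle; rewrite Eoo gt0_muley ?lte_fin// => h.
    by have := le_lt_trans h Goo; rewrite ltxx.
  have Bf : energy beta G \is a fin_num by rewrite ge0_fin_numE ?energy_ge0.
  have Af : energy alpha G \is a fin_num by rewrite ge0_fin_numE ?energy_ge0.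
  have Bp : 0 < fine (energy beta G).
    by rewrite fine_gt0// Boo andbT lt_neqAle eq_sym B0 energy_ge0.
  move: Gle; rewrite -(fineK Bf) -(fineK Af) inver gt_eqF// -!EFinM !lee_fin => h.
  by rewrite ler_pdivlMr.
have Fr : (energy alpha F / energy beta F = lam%:E)%E.
  have Bf : energy beta F \is a fin_num by rewrite ge0_fin_numE ?energy_ge0.
  by rewrite FE -muleA divee ?mule1// energy_neq0.
have FH : in_H alpha delta F by split=> //; right.
exists F; split; last first.
  by move=> x y xy; rewrite /F !(lift_real _ hdelta gg ge) xy.
split=> //; rewrite Fr; apply/eqP; rewrite eq_le; apply/andP; split.
  apply: le_ereal_inf_tmp => _ [G [[eG Gt Goo] Gn0] <-].
  have {}Gt : (exp_type G <= delta%:E)%E by case: Gt => // G0; case: Gn0.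
  by apply: ratio => //; exact: (energy_le hd hdelta l0 eG Gt H).
by rewrite -Fr; apply: ereal_inf_lbound; exists F.
Qed.
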